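(* Let $d\ge1$, $0<\underline k\le\overline k$, and let $c>0$ be a constant depending only on $(d,\overline k,\underline k)$. Then there is a constant $C>0$ depending only on $(d,\overline k,\underline k)$ (and $c$) such that the following holds. Let $n\ge2$, let $\Sigma_1,\dots,\Sigma_n$ be $d\times d$ symmetric matrices with $\underline kI_d\preceq\Sigma_i\preceq\overline kI_d$ for all $i$, let $G^*\in\mathcal{P}(\mathbb{R}^d)$, and let $X_1,\dots,X_n$ be independent with $X_i$ having density $f_{G^*,\Sigma_i}$. Let $M\ge\sqrt{10\overline k\log n}$ and let $S\subset\mathbb{R}^d$ be a nonempty compact set. Let $\widehat G_n\in\mathcal{P}(\mathbb{R}^d)$ be any data-dependent probability measure (an exact or approximate maximizer of $\ell_n$) such that $$\ell_n(G^* )-\ell_n(\widehat G_n)\le c\,\varepsilon_n^2(M,S,G^* ).$$ Then, provided $n>\max(e\,\underline k^{-d/2},(2\pi)^{d/2})$, for all $t\ge1$, $$\mathbb{P}\Big(\bar h^2(f_{\widehat G_n,\bullet},f_{G^*,\bullet})\ge C\,t^2\varepsilon_n^2(M,S,G^* )\Big)\le 2n^{-t^2}.$$ Moreover, $$\mathbb{E}\Big[\bar h^2(f_{\widehat G_n,\bullet},f_{G^*,\bullet})\Big]\le C\,\varepsilon_n^2(M,S,G^* ).$$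
   Context: $\mathcal{P}(\mathbb{R}^d)$ is the set of Borel probability measures on $\mathbb{R}^d$. $\varphi_\Sigma$ is the $\mathcal{N}(0,\Sigma)$ density on $\mathbb{R}^d$, $f_{G,\Sigma}(x)=\int\varphi_\Sigma(x-\theta)\,dG(\theta)$, and $\ell_n(G)=\frac1n\sum_{i=1}^n\log f_{G,\Sigma_i}(X_i)$. $A\preceq B$ means $B-A$ is positive semidefinite. The average squared Hellinger distance is $\bar h^2(f_{G,\bullet},f_{H,\bullet})=\frac1n\sum_{i=1}^nh^2(f_{G,\Sigma_i},f_{H,\Sigma_i})$ with $h^2(f,g)=\frac12\int(\sqrt f-\sqrt g)^2$. For nonempty compact $S$, $\mathfrak{d}_S(\vartheta)=\inf_{s\in S}\|\vartheta-s\|_2$, $S^a=\{y:\mathfrak{d}_S(y)\le a\}$, and for $q>0$, $\mu_q=\big(\mathbb{E}_{\vartheta\sim G^*}[\mathfrak{d}_S(\vartheta)^q]\big)^{1/q}$ (possibly $+\infty$). The rate function is $$\varepsilon_n^2(M,S,G^* )=\mathrm{Vol}\big(S^{\overline k^{1/2}}\big)\frac{M^d}{n}(\log n)^{d/2+1}+\inf_{q\in[(d+1)/(2\log n),\infty)}\Big(\frac{2\mu_q}{M}\Big)^q\log n .$$ *)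

(* Defs.v *)
From HB Require Import structures.
From mathcomp Require Import all_boot all_order all_algebra.
From mathcomp Require Import all_classical all_reals all_analysis.
From mathcomp Require Import measurable_realfun.

Set Implicit Arguments.
Unset Strict Implicit.
Unset Printing Implicit Defensive.

Import Order.TTheory GRing.Theory Num.Theory.
Import numFieldNormedType.Exports.

Local Open Scope classical_set_scope.
Local Open Scope ring_scope.

(* R^d is the space of row vectors 'rV[R]_d with its Borel sigma-algebra.     *)
(* Beware that the library norm `|v| on 'rV[R]_d is the sup norm: it induces  *)
(* the usual topology, but the Euclidean norm is [norm2] below.               *)
Definition open_rV (R : realType) (d : nat) : set (set 'rV[R]_d) := open.
Arguments open_rV R d : clear implicits.

Notation borel_rV R d := (g_sigma_algebraType (open_rV R d)).

Section borel_rV_theory.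
Context {R : realType}.

Lemma open_measurable_rV n (U : set 'rV[R]_n) :
  open U -> measurable (U : set (borel_rV R n)).
Proof. exact: sub_gen_smallest. Qed.

Lemma measurable_coord n (i : 'I_n) :
  measurable_fun setT (fun v : borel_rV R n => v 0 i : R).
Proof.
apply: (measurability _ (RGenOpens.measurableE R)) => // _ [_ [a [b ->] <-]].
rewrite setTI; apply: open_measurable_rV.
by apply: open_comp; [move=> ? _; exact: coord_continuous|exact: interval_open].
Qed.

Definition rat_box n (c : 'rV[rat]_n * nat) : set 'rV[R]_n :=
  [set v | forall j, `|ratr (c.1 0 j) - v 0 j| < c.2.+1%:R^-1].

Lemma open_rV_bigcup n (U : set 'rV[R]_n) : open U ->
  U = \bigcup_(c in [set c | rat_box c `<=` U]) rat_box c.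
Proof.
move=> oU; apply/seteqP; split=> [v Uv|v [c /= cU /cU//]].
have /nbhs_ballP[e /= e0 veU] : nbhs v U by exact: open_nbhs_nbhs.
have [k] : exists k, 0 + k.+1%:R^-1 < e / 2.
  by apply: ltr_add_invr; rewrite divr_gt0.
rewrite add0r => ke; have k0 : 0 < k.+1%:R^-1 :> R by rewrite invr_gt0 ltr0Sn.
have /choice[f fP] : forall j : 'I_n, exists q : rat,
    `|ratr q - v 0 j| < k.+1%:R^-1.
  move=> j; have /rat_in_itvoo[q] : v 0 j < v 0 j + k.+1%:R^-1 by rewrite ltrDl.
  rewrite in_itv/= => /andP[q1 q2]; exists q.
  by rewrite gtr0_norm ?subr_gt0// ltrBlDl.
exists (\row_j f j, k) => [|j] /=; last by rewrite mxE.
move=> w /= wk; apply: veU; split=> // i j; rewrite ord1 /ball/=.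
rewrite -(subrKA (ratr (f j))) (le_lt_trans (ler_normD _ _))// (splitr e) ltrD//.
  by rewrite distrC (lt_trans (fP j)).
by have := wk j; rewrite mxE => /lt_trans; apply.
Qed.

Lemma measurable_fun_rV d (T : measurableType d) n (f : T -> borel_rV R n) :
  (forall j, measurable_fun setT (fun x => (f x : 'rV[R]_n) 0 j : R)) ->
  measurable_fun setT f.
Proof.
move=> mf; apply: (@measurability _ _ _ (borel_rV R n) setT f (open_rV R n)) => // _ [U oU <-].
rewrite setTI (open_rV_bigcup oU) bigcup_mkcond preimage_bigcup.
apply: countable_bigcupT_measurable => [|c]; first exact: countableP.
case: ifPn => _; last by rewrite preimage_set0.
rewrite (_ : _ @^-1` _ = \bigcap_(j in [set: 'I_n])
    [set x | `|ratr (c.1 0 j) - (f x : 'rV[R]_n) 0 j| < c.2.+1%:R^-1]); last first.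
  by apply/seteqP; split=> x /= h j => [_|]; exact: h.
apply: fin_bigcap_measurable => // j _.
rewrite -[X in measurable X]setTI.
have mg : measurable_fun setT
    (fun x => `|ratr (c.1 0 j) - (f x : 'rV[R]_n) 0 j|).
  apply: measurableT_comp => //.
  by apply: measurable_funB; [exact: measurable_cst|exact: mf].
have := mg measurableT `]-oo, c.2.+1%:R^-1[%classic (measurable_itv _).
by congr measurable; apply/seteqP; split => x /=; rewrite in_itv.
Qed.

Definition rVcons n (p : R * borel_rV R n) : borel_rV R n.+1 :=
  \row_i oapp (fun j => (p.2 : 'rV[R]_n) 0 j) p.1 (unlift ord0 i).

Definition rVuncons n (v : borel_rV R n.+1) : R * borel_rV R n :=
  ((v : 'rV[R]_n.+1) 0 0, \row_j (v : 'rV[R]_n.+1) 0 (lift ord0 j)).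

Lemma rVcons0 n (p : R * borel_rV R n) : (rVcons p : 'rV[R]_n.+1) 0 ord0 = p.1.
Proof. by rewrite mxE unlift_none. Qed.

Lemma rVconsS n (p : R * borel_rV R n) j :
  (rVcons p : 'rV[R]_n.+1) 0 (lift ord0 j) = (p.2 : 'rV[R]_n) 0 j.
Proof. by rewrite mxE liftK. Qed.

Lemma rVconsK n : cancel (@rVcons n) (@rVuncons n).
Proof.
move=> [x v]; rewrite /rVuncons rVcons0; congr (_, _).
by apply/rowP => j; rewrite mxE rVconsS.
Qed.

Lemma measurable_rVcons n : measurable_fun setT (@rVcons n).
Proof.
apply: measurable_fun_rV => j; case: (unliftP ord0 j) => [k|] ->.
- under eq_fun do rewrite rVconsS.
  apply: (measurableT_comp (f := fun v : borel_rV R n => (v : 'rV[R]_n) 0 k)).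
    exact: measurable_coord.
  exact: measurable_snd.
- by under eq_fun do rewrite rVcons0; exact: measurable_fst.
Qed.

Lemma measurable_rVuncons n : measurable_fun setT (@rVuncons n).
Proof.
apply/measurable_fun_pairP; split; first exact: measurable_coord.
apply: measurable_fun_rV => j.
by rewrite /rVuncons/=; under eq_fun do rewrite mxE; exact: measurable_coord.
Qed.

Section lebesgue_rV_step.
Variables (n : nat) (mu : {sigma_finite_measure set (borel_rV R n) -> \bar R}).

Definition lebesgue_rVS : set (borel_rV R n.+1) -> \bar R :=
  pushforward (@lebesgue_measure R \x mu)%E (@rVcons n).

Let mpre A : measurable A -> measurable (@rVcons n @^-1` A).
Proof.
by move=> mA; rewrite -[X in measurable X]setTI; exact: measurable_rVcons.
Qed.

Let lebesgue_rVS0 : lebesgue_rVS set0 = 0%E.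
Proof. by rewrite /lebesgue_rVS /pushforward preimage_set0 measure0. Qed.

Let lebesgue_rVS_ge0 A : (0 <= lebesgue_rVS A)%E.
Proof. by apply: integral_ge0 => x _; exact: measure_ge0. Qed.

Let lebesgue_rVS_sigma_additive : semi_sigma_additive lebesgue_rVS.
Proof.
move=> F mF tF mUF; rewrite /lebesgue_rVS /pushforward preimage_bigcup.
apply: measure_semi_sigma_additive => [k||].
- exact: mpre.
- by move=> i j Di Dj [p [/= Fip Fjp]]; apply: (tF i j) => //; exists (rVcons p).
- by rewrite -preimage_bigcup; exact: mpre.
Qed.

HB.instance Definition _ := isMeasure.Build _ _ _ lebesgue_rVS
  lebesgue_rVS0 lebesgue_rVS_ge0 lebesgue_rVS_sigma_additive.

Let lebesgue_rVS_sigma_finite : sigma_finite setT lebesgue_rVS.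
Proof.
have /sigma_finiteP[F [FT ndF Foo]] := sigma_finiteT (@lebesgue_measure R).
have /sigma_finiteP[G [GT ndG Goo]] := sigma_finiteT mu.
exists (fun k => @rVuncons n @^-1` (F k `*` G k)) => [|k].
  apply/seteqP; split=> // v _.
  have [i _ Fi] : (\bigcup_i F i) (rVuncons v).1 by rewrite -FT.
  have [j _ Gj] : (\bigcup_i G i) (rVuncons v).2 by rewrite -GT.
  exists (maxn i j) => //; split.
  - by move: (rVuncons v).1 Fi; exact/subsetPset/ndF/leq_maxl.
  - by move: (rVuncons v).2 Gj; exact/subsetPset/ndG/leq_maxr.
have [mF Fk] := Foo k; have [mG Gk] := Goo k; split.
  rewrite -[X in measurable X]setTI; apply: measurable_rVuncons => //.
  exact: measurableX.
rewrite /lebesgue_rVS /pushforward -comp_preimage (_ : _ \o _ = id); last first.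
  by apply/funext => p /=; rewrite rVconsK.
by rewrite preimage_id product_measure1E// lte_mul_pinfty// ge0_fin_numE.
Qed.

HB.instance Definition _ :=
  Measure_isSigmaFinite.Build _ _ _ lebesgue_rVS lebesgue_rVS_sigma_finite.

End lebesgue_rV_step.

(* The measure on R^0 is the unit mass at the only point, and the one on      *)
(* R^n.+1 is the image of the product of the ones on R and R^n under          *)
(* (x, v) |-> x :: v.                                                         *)
Fixpoint lebesgue_rV n : {sigma_finite_measure set (borel_rV R n) -> \bar R} :=
  if n is m.+1 then lebesgue_rVS (lebesgue_rV m)
  else @dirac _ (borel_rV R 0) (0 : 'rV[R]_0) R.

End borel_rV_theory.
Arguments lebesgue_rV {R} n.

Lemma lebesgue_rV_box (R : realType) n (A : 'I_n -> set R) :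
    (forall i, measurable (A i)) ->
  lebesgue_rV n [set v | forall i, A i ((v : 'rV[R]_n) 0 i)] =
  (\prod_(i < n) lebesgue_measure (A i))%E.
Proof.
elim: n A => [|n ih] A mA.
  by rewrite big_ord0 /= diracE mem_set// => -[].
pose B := [set v : borel_rV R n |
  forall i, A (lift ord0 i) ((v : 'rV[R]_n) 0 i)].
have mB : measurable B.
  have -> : B = \bigcap_(i in [set: 'I_n])
      (fun v => (v : 'rV[R]_n) 0 i) @^-1` A (lift ord0 i).
    by apply/seteqP; split=> v /= h i => [_|]; exact: h.
  apply: fin_bigcap_measurable => // i _; rewrite -[X in measurable X]setTI.
  by apply: measurable_coord => //; exact: mA.
rewrite big_ord_recl/= /lebesgue_rVS /pushforward -ih//.
rewrite -product_measure1E; [|exact: mA|exact: mB].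
congr (product_measure1 _ _ _); apply/seteqP; split=> -[x v] /=.
- move=> h; split=> [|i]; first by have := h ord0; rewrite rVcons0.
  by have := h (lift ord0 i); rewrite rVconsS.
- move=> [Ax Av] i; case: (unliftP ord0 i) => [k|] ->.
    by rewrite rVconsS.
  by rewrite rVcons0.
Qed.

Section independence.
Context d d' (T : measurableType d) (T' : measurableType d') (R : realType).
Context (P : probability T R).

Definition mutually_independent (I : finType) (X : I -> {RV P >-> T'}) : Prop :=
  forall (J : {set I}) (A : I -> set T'), (forall i, measurable (A i)) ->
  P (\bigcap_(i in [set` J]) X i @^-1` A i) =
  (\prod_(i in J) P (X i @^-1` A i))%E.

End independence.

Section heteroscedastic_mixture.
Context {R : realType}.

Definition has_density d (dO : measure_display) (Omega : measurableType dO)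
    (P : probability Omega R) (X : {RV P >-> borel_rV R d})
    (f : 'rV[R]_d -> R) : Prop :=
  forall A : set (borel_rV R d), measurable A ->
  distribution P X A = (\int[lebesgue_rV d]_(x in A) (f x)%:E)%E.

Definition norm2 d (v : 'rV[R]_d) : R := Num.sqrt (\sum_(i < d) v 0 i ^+ 2).

Definition psdmx d (A : 'M[R]_d) : Prop :=
  A^T = A /\ forall v : 'rV[R]_d, 0 <= (v *m A *m v^T) 0 0.

Definition loewner_le d (A B : 'M[R]_d) : Prop := psdmx (B - A).

Definition gauss_density d (Sigma : 'M[R]_d) (x : 'rV[R]_d) : R :=
  (Num.sqrt ((2 * pi) ^+ d * \det Sigma))^-1 *
  expR (- ((x *m invmx Sigma *m x^T) 0 0 / 2)).

Definition mixture_density d (G : probability (borel_rV R d) R) (Sigma : 'M[R]_d)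
    (x : 'rV[R]_d) : R :=
  \int[G]_theta gauss_density Sigma (x - theta).

Definition avg_loglik d n (Sigma : 'I_n -> 'M[R]_d) (x : 'I_n -> 'rV[R]_d)
    (G : probability (borel_rV R d) R) : R :=
  n%:R^-1 * \sum_(i < n) ln (mixture_density G (Sigma i) (x i)).

Definition hellinger2 d (f g : 'rV[R]_d -> R) : R :=
  2^-1 * \int[lebesgue_rV d]_x (Num.sqrt (f x) - Num.sqrt (g x)) ^+ 2.

Definition avg_hellinger2 d n (f g : 'I_n -> 'rV[R]_d -> R) : R :=
  n%:R^-1 * \sum_(i < n) hellinger2 (f i) (g i).

Definition dist_set d (S : set 'rV[R]_d) (v : 'rV[R]_d) : R :=
  inf [set norm2 (v - s) | s in S].

Definition fattening d (S : set 'rV[R]_d) (a : R) : set 'rV[R]_d :=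
  [set y | dist_set S y <= a].

Definition dist_moment d (S : set 'rV[R]_d) (G : probability (borel_rV R d) R)
    (q : R) : \bar R :=
  ('E_G[fun theta : borel_rV R d => (dist_set S theta `^ q)%R] `^ q^-1%R)%E.

(* Extended-valued: the infimum is +oo when every moment involved is.         *)
Definition rate d (kbar : R) (n : nat) (M : R) (S : set 'rV[R]_d)
    (G : probability (borel_rV R d) R) : \bar R :=
  (lebesgue_rV d (fattening S (Num.sqrt kbar))
     * (M ^+ d / n%:R * ln n%:R `^ (d%:R / 2 + 1))%:E
   + ereal_inf [set (2%:E * dist_moment S G q * M^-1%:E) `^ q * (ln n%:R)%:E
               | q in [set q : R | (d.+1%:R / (2 * ln n%:R) <= q)%R]])%E.

End heteroscedastic_mixture.

(* Main.v *)
(* With L = ln n, the argument follows the classical scheme for the NPMLE:      *)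
(* cover the mixtures uniformly on the fattening S^M, and control separately   *)
(* the observations falling outside S^M.                                       *)
(*                                                                             *)
(* - Covering.  Cut R^d into cubes of side of order sqrt L.  For x in S^M, the *)
(*   density f_{G,Sigma}(x) depends on G, up to n^-2 and simultaneously for    *)
(*   all Sigma, only through the moments of order O(L) of G on the 3^d cubes   *)
(*   around x (Taylor expansion of the exponential).  Quantising these moments *)
(*   gives a finite code, of log-cardinality                                   *)
(*   O(Vol(S^{sqrt kbar}) M^d L^{d/2+1}), such that measures with equal codes  *)
(*   have mixtures within n^-2 on S^M; no discretisation by Caratheodory is    *)
(*   needed.                                                                   *)
(* - Tail.  On all of R^d, f_Ghat <= exp(W) (f_H + v) whenever Ghat and H have *)
(*   the same code, where v is a small integrable weight (a sum of Cauchy      *)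
(*   kernels centred at a maximal separated subset of S) and W vanishes on S^M *)
(*   and is 3 L + 2 d ln(dist/M) outside.  A Chernoff bound with parameter of  *)
(*   order 1/L controls the sum of the W(X_i) by the moment term of the rate.  *)
(* - Likelihood ratio.  For a fixed H, prod_i sqrt((f_H + v) / f_Gstar)(X_i)  *)
(*   has mean at most exp(- sum_i h^2 + n sqrt(int v)); sum over the codes and *)
(*   apply Markov's inequality.                                                *)

Require Import Defs.
From HB Require Import structures.
From mathcomp Require Import all_boot all_order all_algebra.
From mathcomp Require Import all_classical all_reals all_analysis.
From mathcomp Require Import measurable_realfun ring lra zify.

Set Implicit Arguments.
Unset Strict Implicit.
Unset Printing Implicit Defensive.

Import Order.TTheory GRing.Theory Num.Theory.
Import numFieldNormedType.Exports.

Local Open Scope classical_set_scope.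
Local Open Scope ring_scope.

(** * Independence and Lebesgue measure on R^d *)

(** Let [L] be $\ln n$ and [A] be $n\varepsilon_n^2$. The near-maximality of $\hat G$ says that
    $\prod_i (f_{\hat G}/f_{Gstar})(X_i)\ge e^{-cA}$, the indices $\Sigma_i$ being understood. For a
    fixed $H$, independence gives $\prod_i\sqrt{f_H/f_{Gstar}}(X_i)$ the mean
    $\prod_i(1-h_i^2)\le\exp(-\sum_i h_i^2)$, so by Markov's inequality an $H$ with $\sum_i h_i^2$ a
    large multiple of [A] reaches such a likelihood ratio only with probability
    $e^{-\mathrm{const}\cdot A}$. Since $\hat G$ is random, it must be replaced by one of at most
    $e^{O(A)}$ fixed measures.

    The replacement is [exists_code]. Near a point of $S^M$ the Gaussian kernel is a polynomial of
    degree $O(L)$ up to a negligible error, so two measures with almost equal local moments have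
    mixtures within $e^{-2L}=n^{-2}$ there ([mixture_diff_le], [code_close]); rounding the moments
    gives a finite code ([ln_card_code]). The cells to be recorded are those around a net of $S$
    with $O(\mathrm{Vol}(S^{\overline k^{1/2}}))$ points ([exists_separated_net]).

    The remaining error is absorbed in a weight $v$: on $S^M$ one has $f_{\hat G}\le f_H+v$, and
    elsewhere $f_{\hat G}\le e^W(f_H+v)$ with $W$ the [tail_score] ([mixture_le_tail_score]). If
    $\int v\le\sigma^2$, adding $v$ raises each affinity by at most $\sigma$
    ([integral_sqrt_add_le]), and $n\sigma$ is $O(A)$. The sum of the $W(X_i)$ is $O(A)$ with high
    probability, because $e^{\lambda W}$ with $\lambda$ of order $1/L$ is controlled by [excess],
    whose mean is bounded through the moment of $Gstar$ for every admissible $q$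
    ([integral_excess_le], [prob_tail_score_le]).

    [deviation_bound] puts these together when $\ln n$ exceeds a constant threshold. Below the
    threshold $\varepsilon_n^2$ is bounded away from 0 while $h^2\le1$, so a large [C] suffices. The
    bound on the mean follows from the case $t=1$ and $1/n=O(\varepsilon_n^2)$. *)

Section measure_lemmas.
Local Open Scope ereal_scope.
Context {R : realType}.
Import HBNNSimple.

(** The indicator case passes to simple functions by linearity and to all [g] by monotone
    convergence. It serves twice: with [h] the product of the other factors, to peel one variable
    off a product of independent ones, and with [X] the identity, to integrate against a density. *)
Lemma integral_transfer d1 d2 (T1 : measurableType d1) (T2 : measurableType d2)
    (mu1 : {measure set T1 -> \bar R}) (mu2 : {measure set T2 -> \bar R})
    (X : T1 -> T2) (h : T1 -> R) (g : T2 -> \bar R) :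
    measurable_fun setT X -> measurable_fun setT h -> (forall x, 0 <= h x)%R ->
    (forall A, measurable A -> \int[mu1]_(x in X @^-1` A) (h x)%:E = mu2 A) ->
    measurable_fun setT g -> (forall y, 0 <= g y) ->
  \int[mu1]_x ((h x)%:E * g (X x)) = \int[mu2]_y g y.
Proof.
move=> mX mh h0 hA mg g0.
have mXA A : measurable A -> measurable (X @^-1` A).
  by move=> mA; rewrite -[X in measurable X]setTI; exact: mX.
pose f_ := nnsfun_approx measurableT mg.
have mfX n : measurable_fun setT (fun x => (f_ n (X x))%:E).
  by apply/measurable_EFinP; exact: measurableT_comp.
have mhE : measurable_fun setT (EFin \o h) by exact/measurable_EFinP.
transitivity (limn (fun n => \int[mu1]_x ((h x)%:E * (f_ n (X x))%:E))).
  rewrite -monotone_convergence//; last 3 first.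
  - by move=> n; exact: emeasurable_funM.
  - by move=> n x _; rewrite mule_ge0// lee_fin.
  - move=> x _ m n mn; rewrite lee_wpmul2l// ?lee_fin//.
    exact/lefP/nd_nnsfun_approx.
  apply: eq_integral => x _; apply/esym/cvg_lim => //=.
  by apply: cvgeZl => //; apply: cvg_nnsfun_approx.
transitivity (limn (fun n => \int[mu2]_x (f_ n x)%:E)); last first.
  rewrite -monotone_convergence//.
  - apply: eq_integral => y _; apply/cvg_lim => //.
    exact: cvg_nnsfun_approx.
  - by move=> n; exact/measurable_EFinP.
  - by move=> n y _; rewrite lee_fin.
  - by move=> y _ m n mn; rewrite lee_fin; exact/lefP/nd_nnsfun_approx.
congr (limn _); apply/funext => n.
have mI r : measurable (f_ n @^-1` [set r]) by [].
rewrite integralT_nnsfun sintegralE.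
transitivity (\int[mu1]_x
    \sum_(k \in range (f_ n)) (k%:E * ((h x)%:E * (\1_(X @^-1` (f_ n @^-1` [set k])) x)%:E))).
  apply: eq_integral => x _.
  rewrite fimfunE -fsumEFin// ge0_mule_fsumr; last first.
    by move=> k; rewrite nnfun_muleindic_ge0.
  apply: eq_fsbigr => k _.
  by rewrite EFinM muleCA.
rewrite ge0_integral_fsum//; last 2 first.
- move=> k; apply: measurable_funeM; apply: emeasurable_funM => //.
  by apply/measurable_EFinP; exact: measurable_indic (mXA _ (mI k)).
- move=> k x _; case: (ltP k 0%R) => k0; last by rewrite !mule_ge0// lee_fin.
  by rewrite preimage_nnfun0// preimage_set0 indicE in_set0 !mule0.
apply: eq_fsbigr => k _.
case: (ltP k 0%R) => k0.
  rewrite preimage_nnfun0// preimage_set0 measure0 mule0.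
  by rewrite integral0_eq// => x _; rewrite indicE in_set0 !mule0.
rewrite ge0_integralZl//; last 2 first.
- apply: emeasurable_funM => //.
  by apply/measurable_EFinP; exact: measurable_indic (mXA _ (mI k)).
- by move=> x _; rewrite mule_ge0// lee_fin.
congr (_ * _); rewrite -hA// [RHS]integral_mkcond.
apply: eq_integral => x _; rewrite epatch_indic//.
Qed.

End measure_lemmas.

Section independence_lemmas.
Local Open Scope ereal_scope.
Context {R : realType} d d' (T : measurableType d) (T' : measurableType d').
Context (P : probability T R) (I : finType) (X : I -> {RV P >-> T'}).
Hypothesis X_indep : mutually_independent X.

(** Independence concerns events, so the factors are freed one at a time: [H] allows arbitrary
    functions on the list [s] and indicators elsewhere. For empty [s] it is the definition of
    independence. To add [k], the case where [g k] is an indicator shows that [P] weighted by the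
    other factors has a multiple of the law of [X k] as its image under [X k]. *)
Lemma indep_integral_prod (g : I -> T' -> R) (e : I -> R) :
    (forall i, measurable_fun setT (g i)) -> (forall i y, 0 <= g i y)%R ->
    (forall i, \int[P]_x (g i (X i x))%:E = (e i)%:E) ->
  \int[P]_x (\prod_i g i (X i x))%:E = (\prod_i e i)%:E.
Proof.
suff H (s : seq I) : forall (g : I -> T' -> R) (e : I -> R),
    (forall i, measurable_fun setT (g i)) -> (forall i y, 0 <= g i y)%R ->
    (forall i, \int[P]_x (g i (X i x))%:E = (e i)%:E) ->
    (forall i, i \notin s -> exists2 A, measurable A & g i = \1_A) ->
    \int[P]_x (\prod_i g i (X i x))%:E = (\prod_i e i)%:E.
  by move=> mg g0 ge; apply: (H (enum I)) => // i; rewrite mem_enum.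
elim: s => [|k s IH] {}g {}e mg g0 ge gs.
  have /choice[A gA] : forall i, exists A, measurable A /\ g i = \1_A.
    by move=> i; have [|A mA gA] := gs i; [|exists A].
  have mA i : measurable (A i) by case: (gA i).
  have eA i : (e i)%:E = P (X i @^-1` A i).
    rewrite -ge; have [_ ->] := gA i.
    rewrite (_ : (fun x => _) = (fun x => (\1_(X i @^-1` A i) x)%:E))//.
    rewrite integral_indic ?setIT//.
    by rewrite -[X in measurable X]setTI; exact: measurable_funP.
  rewrite -prodEFin (eq_bigr _ (fun i _ => eA i)).
  have XI := X_indep (finset.setT : {set I}) mA.
  rewrite (eq_bigl xpredT) in XI; last by move=> i; rewrite finset.in_setT.
  rewrite -XI.
  set B := \bigcap_(i in _) _.
  have mB : measurable B.
    apply: fin_bigcap_measurable => // i _.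
    by rewrite -[X in measurable X]setTI; exact: measurable_funP.
  rewrite -[in RHS](setIT B) -integral_indic//.
  apply: eq_integral => x _; congr EFin.
  have -> : (\prod_i g i (X i x) = \prod_i \1_(A i) (X i x) :> R)%R.
    by apply: eq_bigr => i _; have [_ ->] := gA i.
  rewrite indicE; case: (boolP (x \in B)) => [/set_mem xB|xB].
    rewrite big1// => i _; rewrite indicE mem_set//; apply: xB => /=.
    by rewrite finset.in_setT.
  have [i xi] : exists i, X i x \notin A i.
    apply/existsP; move: xB; apply: contraR; rewrite negb_exists => /forallP h.
    by apply/mem_set => i _ /=; have := h i; rewrite negbK => /set_mem.
  by rewrite (bigD1 i)//= indicE (negbTE xi) mul0r.
rewrite (bigD1 k)//=.
have mXi i (f : T' -> R) : measurable_fun setT f ->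
    measurable_fun setT (fun x => f (X i x)).
  by move=> mf; exact: measurableT_comp.
pose h x := (\prod_(i | i != k) g i (X i x))%R.
have h0 x : (0 <= h x)%R by apply: prodr_ge0.
have mh : measurable_fun setT h.
  rewrite /h; under eq_fun do rewrite -big_filter.
  by apply: measurable_prod => i _; exact: mXi.
have c0 : (0 <= \prod_(i | i != k) e i)%R.
  apply: prodr_ge0 => i _; rewrite -lee_fin -ge.
  by apply: integral_ge0 => x _; rewrite lee_fin.
pose c := NngNum c0.
pose mu2 := mscale c (distribution P (X k)).
transitivity (\int[P]_x ((h x)%:E * (EFin \o g k) (X k x))).
  by apply: eq_integral => x _ /=; rewrite -EFinM (bigD1 k)//= mulrC.
rewrite (@integral_transfer _ _ _ _ _ _ mu2 _ _ (EFin \o g k))//; last 3 first.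
- move=> A mA; pose g' i := if i == k then \1_A else g i.
  have mXA : measurable (X k @^-1` A).
    by rewrite -[X in measurable X]setTI; exact: measurable_funP.
  transitivity (\int[P]_x (\prod_i g' i (X i x))%:E).
    rewrite integral_mkcond; apply: eq_integral => x _.
    rewrite epatch_indic/= -EFinM; congr EFin.
    rewrite (bigD1 k)//= /g' eqxx mulrC; congr (_ * _)%R.
    by apply: eq_bigr => i /negbTE ->.
  rewrite (IH g' (fun i => if i == k then fine (P (X k @^-1` A)) else e i)).
  - rewrite (bigD1 k)//= eqxx /mu2 /mscale/= EFinM muleC.
    congr (_ * _); first by congr EFin; apply: eq_bigr => i /negbTE ->.
    by rewrite fineK// fin_num_measure.
  - move=> i; rewrite /g'; case: ifP => // _; exact: measurable_indic.
  - by move=> i y; rewrite /g'; case: ifP.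
  - move=> i; rewrite /g'; case: ifP => [/eqP ->|//].
    rewrite (_ : (fun x => _) = (fun x => (\1_(X k @^-1` A) x)%:E))//.
    by rewrite integral_indic// setIT fineK// fin_num_measure.
  - move=> i si; rewrite /g'; case: ifPn => [_|ik]; first by exists A.
    by apply: gs; rewrite inE negb_or ik.
- exact/measurable_EFinP.
- by move=> y; rewrite lee_fin.
rewrite ge0_integral_mscale//; last 2 first.
- exact/measurable_EFinP.
- by move=> y _; rewrite lee_fin.
rewrite EFinM muleC; congr (_ * _).
rewrite ge0_integral_distribution//; last 2 first.
- exact/measurable_EFinP.
- by move=> y; rewrite lee_fin.
exact: ge.
Qed.

End independence_lemmas.

Section lebesgue_rV_lemmas.
Context {R : realType}.
Local Notation leb := (@lebesgue_measure R).

Lemma integral_shift (t : R) (g : R -> \bar R) : measurable_fun setT g ->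
  (forall x, 0 <= g x)%E -> (\int[leb]_x g (x - t)%R = \int[leb]_x g x)%E.
Proof.
move=> mg g0.
have ms : measurable_fun setT (fun x : measurableTypeR R => (x - t)%R : measurableTypeR R).
  by apply: measurable_funB.
transitivity (\int[pushforward leb (fun x : measurableTypeR R => (x - t)%R : measurableTypeR R)]_y g y)%E.
  by rewrite ge0_integral_pushforward.
apply: eq_measure_integral => A mA _; apply/esym.
apply: lebesgue_measure_unique => //= _ [[a b]] _ <-.
rewrite /pushforward.
rewrite (_ : _ @^-1` _ = `]a + t, b + t]%classic); last first.
  by apply/seteqP; split => x /=; rewrite !in_itv/= ltrBrDr lerBlDr.
rewrite !lebesgue_measure_itv/= !lte_fin ltrD2r; case: ifP => // _.
by rewrite -!EFinB opprD addrACA subrr addr0.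
Qed.

(** Cauchy kernels serve both as tail weight and as a majorant of the Gaussian; their integral comes
    from the antiderivative [s * atan (x / s)] on the half-line. *)
Lemma integral_cauchy_kernel (s : R) : 0 < s ->
  (\int[leb]_x ((1 + (x / s) ^+ 2)^-1)%:E = (pi * s)%:E)%E.
Proof.
move=> s0.
pose f (x : R) : R := (1 + (x / s) ^+ 2)^-1.
have p0 x : 0 < 1 + (x / s) ^+ 2 by rewrite ltr_pwDl// sqr_ge0.
have f0 x : 0 <= f x by rewrite invr_ge0 ltW.
have cf : continuous f.
  move=> x; apply: cvgV; first by rewrite gt_eqF.
  apply: cvgD; first exact: cvg_cst.
  rewrite expr2; under eq_fun do rewrite expr2.
  by apply: cvgM; apply: cvgM; (try exact: cvg_id); exact: cvg_cst.
rewrite (ge0_symfun_integralT f0 cf); last first.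
  by move=> x; rewrite /f/= mulNr sqrrN.
rewrite (_ : [set x | 0 <= x] = `[0, +oo[%classic); last first.
  by apply/seteqP; split => x /=; rewrite in_itv/= andbT.
rewrite (@ge0_continuous_FTC2y _ f (fun x => s * atan (x / s)) 0 (s * (pi / 2))).
- rewrite mul0r atan0 mulr0 sube0 -EFinM; congr EFin.
  by field.
- by move=> x _.
- exact: continuous_subspaceT.
- apply: cvgM; first exact: cvg_cst.
  apply: (cvg_comp (fun x : R => x / s) atan); last exact: cvgy_atan.
  apply/cvgryPge => A; near=> x.
  rewrite ler_pdivlMr//; near: x; exact: nbhs_pinfty_ge.
- by move=> x _; apply: ex_derive.
- apply: cvg_at_right_filter; apply: cvgM; first exact: cvg_cst.
  apply: continuous_comp; last exact: continuous_atan.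
  by apply: cvgM; [exact: cvg_id|exact: cvg_cst].
- move=> x _; rewrite derive1E.
  have dg : is_derive x 1 (fun x => x / s) s^-1.
    rewrite (_ : (fun x => x / s) = s^-1 *: id).
      by apply: is_derive_eq; rewrite /GRing.scale/= mulr1.
    by apply/funext => y; rewrite /= mulrC.
  have da : is_derive x 1 (fun x => atan (x / s)) ((1 + (x / s) ^+ 2)^-1 / s).
    exact: is_derive1_comp.
  rewrite derive_val /GRing.scale/= /f mulrCA divff ?mulr1// gt_eqF.
Unshelve. all: by end_near.
Qed.

Lemma integral_rVS n (g : borel_rV R n.+1 -> \bar R) :
    measurable_fun setT g -> (forall x, 0 <= g x)%E ->
  (\int[lebesgue_rV n.+1]_v g v =
   \int[leb]_x \int[lebesgue_rV n]_v g (rVcons (x, v)))%E.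
Proof.
move=> mg g0.
have mgc : measurable_fun setT (fun p : R * borel_rV R n => g (rVcons p)).
  by apply: measurableT_comp => //; exact: measurable_rVcons.
transitivity (\int[leb \x lebesgue_rV n]_p g (rVcons p))%E.
  by rewrite /= /lebesgue_rVS ge0_integral_pushforward//; exact: measurable_rVcons.
by rewrite (@fubini_tonelli1 _ _ _ _ _ leb (lebesgue_rV n)).
Qed.

Lemma measurable_shift_rV n (t : 'rV[R]_n) :
  measurable_fun setT (fun x : borel_rV R n => (x : 'rV[R]_n) - t : borel_rV R n).
Proof.
apply: measurable_fun_rV => j; under eq_fun do rewrite !mxE.
by apply: measurable_funB; [exact: measurable_coord|exact: measurable_cst].
Qed.

Lemma integral_rV_shift n (t : 'rV[R]_n) (g : borel_rV R n -> \bar R) :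
    measurable_fun setT g -> (forall x, 0 <= g x)%E ->
  (\int[lebesgue_rV n]_x g ((x : 'rV[R]_n) - t)%R = \int[lebesgue_rV n]_x g x)%E.
Proof.
elim: n t g => [|n IH] t g mg g0.
  by apply: eq_integral => x _; congr g; apply/rowP => -[].
have mgt : measurable_fun setT (fun x : borel_rV R n.+1 => g ((x : 'rV[R]_n.+1) - t)).
  exact: (measurableT_comp mg (measurable_shift_rV t)).
rewrite !integral_rVS//.
pose t' : 'rV[R]_n := \row_j t 0 (lift ord0 j).
have E x v : rVcons (x, v) - t = rVcons (x - t 0 ord0, (v : 'rV[R]_n) - t') :> 'rV[R]_n.+1.
  apply/rowP => j; rewrite !mxE/=.
  by case: unliftP => [k|] -> //=; rewrite !mxE.
under eq_integral do under eq_integral do rewrite E.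
have mgx x : measurable_fun setT (fun v : borel_rV R n => g (rVcons (x, v))).
  apply: (measurableT_comp mg).
  by apply: (measurableT_comp (@measurable_rVcons _ _)) => //.
under eq_integral => x _ do
  rewrite (IH t' (fun v => g (rVcons (x - t 0 ord0, v))))//.
rewrite (@integral_shift (t 0 ord0) (fun x => \int[lebesgue_rV n]_v g (rVcons (x, v)))%E)//.
- apply: (measurable_fun_fubini_tonelli_F (fun p => g (rVcons p))) => //.
  by apply: measurableT_comp => //; exact: measurable_rVcons.
- by move=> x; apply: integral_ge0 => v _.
Qed.

Lemma integral_rV_prod n (g : 'I_n -> R -> R) (e : 'I_n -> R) :
    (forall i, measurable_fun setT (g i)) -> (forall i x, 0 <= g i x) ->
    (forall i, (\int[leb]_x (g i x)%:E = (e i)%:E)%E) ->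
  (\int[lebesgue_rV n]_v (\prod_i g i ((v : 'rV[R]_n) 0 i))%:E =
   (\prod_i e i)%:E)%E.
Proof.
elim: n g e => [|n IH] g e mg g0 ge.
  rewrite big_ord0; under eq_integral do rewrite big_ord0.
  by rewrite integral_cst//= diracT mul1e.
have mP m (h : 'I_m -> R -> R) : (forall i, measurable_fun setT (h i)) ->
    measurable_fun setT (fun v : borel_rV R m => \prod_i h i ((v : 'rV[R]_m) 0 i)).
  move=> mh; apply: measurable_prod => i _.
  by apply: (measurableT_comp (mh i)); exact: measurable_coord.
rewrite integral_rVS//; last 2 first.
- by apply/measurable_EFinP; exact: mP.
- by move=> v; rewrite lee_fin prodr_ge0.
rewrite big_ord_recl.
transitivity (\int[leb]_x ((\prod_(i < n) e (lift ord0 i))%:E * (g ord0 x)%:E))%E.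
  apply: eq_integral => x _.
  rewrite -(IH (fun i => g (lift ord0 i)) (fun i => e (lift ord0 i)))//.
  rewrite muleC -ge0_integralZl//.
  - apply: eq_integral => v _; rewrite -EFinM; congr EFin.
    rewrite big_ord_recl rVcons0/=; congr (_ * _).
    by apply: eq_bigr => i _; rewrite rVconsS.
  - by apply/measurable_EFinP; exact: (mP n (fun i => g (lift ord0 i))).
  - by move=> v _; rewrite lee_fin prodr_ge0.
  - by rewrite lee_fin.
rewrite ge0_integralZl//.
- by rewrite ge -EFinM mulrC.
- by apply/measurable_EFinP; exact: mg.
- by move=> x _; rewrite lee_fin.
rewrite lee_fin prodr_ge0// => i _; rewrite -lee_fin -ge.
by apply: integral_ge0 => x _; rewrite lee_fin.
Qed.

End lebesgue_rV_lemmas.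

(** * Quadratic forms, Gaussian mixtures and Hellinger affinity *)

Section quadratic_forms.
Context {R : realType}.

Definition sqnorm d (v : 'rV[R]_d) : R := \sum_(i < d) v 0 i ^+ 2.

Lemma mx11B (A B : 'M[R]_1) : (A - B) 0 0 = A 0 0 - B 0 0.
Proof. by rewrite !mxE. Qed.

Lemma mx11Z (c : R) (A : 'M[R]_1) : (c *: A) 0 0 = c * A 0 0.
Proof. by rewrite mxE. Qed.

Lemma sqnormE d (v : 'rV[R]_d) : sqnorm v = (v *m v^T) 0 0.
Proof. by rewrite mxE; apply: eq_bigr => i _; rewrite mxE expr2. Qed.

Lemma sqnorm_ge0 d (v : 'rV[R]_d) : 0 <= sqnorm v.
Proof. by apply: sumr_ge0 => i _; exact: sqr_ge0. Qed.

Lemma sqr_coord_le_sqnorm d (v : 'rV[R]_d) i : v 0 i ^+ 2 <= sqnorm v.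
Proof.
by rewrite /sqnorm (bigD1 i)//= lerDl sumr_ge0// => j _; exact: sqr_ge0.
Qed.

Lemma loewner_le_scalarl d (k : R) (A : 'M[R]_d) : loewner_le k%:M A ->
  forall v : 'rV[R]_d, k * sqnorm v <= (v *m A *m v^T) 0 0.
Proof.
move=> [_ h] v; have := h v.
by rewrite mulmxBr mulmxBl mul_mx_scalar -scalemxAl !mxE sqnormE !mxE subr_ge0.
Qed.

Lemma loewner_le_scalarr d (k : R) (A : 'M[R]_d) : loewner_le A k%:M ->
  forall v : 'rV[R]_d, (v *m A *m v^T) 0 0 <= k * sqnorm v.
Proof.
move=> [_ h] v; have := h v.
by rewrite mulmxBr mulmxBl mul_mx_scalar -scalemxAl !mxE sqnormE !mxE subr_ge0.
Qed.

Lemma sqnorm_row_mx n (u : 'rV[R]_1) (v : 'rV[R]_n) :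
  sqnorm (row_mx u v : 'rV[R]_(1 + n)) = u 0 0 ^+ 2 + sqnorm v.
Proof.
rewrite /sqnorm big_split_ord/= big_ord1 row_mxEl; congr (_ + _).
by apply: eq_bigr => i _; rewrite row_mxEr.
Qed.

(* Gaussian elimination: the Schur complement of the first entry is again    *)
(* bounded below by k, and the determinant is the product of the pivots.     *)
Lemma det_ge_of_form_ge d (k : R) (A : 'M[R]_d) : 0 < k -> A^T = A ->
  (forall v : 'rV[R]_d, k * sqnorm v <= (v *m A *m v^T) 0 0) ->
  k ^+ d <= \det A.
Proof.
move=> k0; elim: d A => [|n IH] A symA Age; first by rewrite expr0 det_mx00.
have := @submxK _ 1 n 1 n A.
set a := ulsubmx _; set b := ursubmx _; set b' := dlsubmx _; set A' := drsubmx _.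
move=> eA.
have b'E : b' = b^T.
  by apply/matrixP => i j; rewrite !mxE -[in LHS]symA mxE.
have A'sym : A'^T = A'.
  by apply/matrixP => i j; rewrite !mxE -[in RHS]symA mxE.
clearbody a b b' A'; subst b'.
have mxDE (B C : 'M[R]_1) : (B + C) 0 0 = B 0 0 + C 0 0 by rewrite mxE.
have mxNE (B : 'M[R]_1) : (- B) 0 0 = - B 0 0 by rewrite mxE.
have mxSE (c : R) : (c%:M : 'M[R]_1) 0 0 = c by rewrite mxE eqxx.
have Age' (w : 'rV[R]_(1 + n)) :
    k * sqnorm w <= (w *m block_mx a b b^T A' *m w^T) 0 0.
  by rewrite eA; exact: Age.
have form (u : 'rV[R]_1) (v : 'rV[R]_n) : k * (u 0 0 ^+ 2 + sqnorm v) <=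
    u 0 0 ^+ 2 * a 0 0 + 2 * u 0 0 * (v *m b^T) 0 0 + (v *m A' *m v^T) 0 0.
  have := Age' (row_mx u v).
  rewrite sqnorm_row_mx mul_row_block tr_row_mx mul_row_col !mulmxDl.
  have -> : u *m a *m u^T = (u 0 0 ^+ 2 * a 0 0)%:M.
    by apply/matrixP => i j; rewrite !ord1 !mxE big_ord1 !mxE big_ord1 mulr1n mulrAC expr2.
  have e1 : v *m b^T *m u^T = (u 0 0 * (v *m b^T) 0 0)%:M.
    by apply/matrixP => i j; rewrite !ord1 mxE big_ord1 !mxE/= mulr1n mulrC.
  have e2 : u *m b *m v^T = (u 0 0 * (v *m b^T) 0 0)%:M.
    have -> : u *m b *m v^T = (v *m b^T *m u^T)^T.
      by rewrite !trmx_mul !trmxK mulmxA.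
    rewrite e1.
    by apply/matrixP => i j; rewrite !ord1 !mxE.
  rewrite e1 e2 !mxDE !mxSE; lra.
have a_ge : k <= a 0 0.
  have := form 1%:M 0; rewrite !mul0mx mxSE !mxE /sqnorm.
  rewrite big1 => [|i _]; first by lra.
  by rewrite mxE expr0n.
have a0 : a 0 0 != 0 by rewrite gt_eqF// (lt_le_trans k0).
pose S := A' - (a 0 0)^-1 *: (b^T *m b).
have detA : \det A = a 0 0 * \det S.
  pose Lo : 'M[R]_(1 + n) := block_mx 1%:M 0 ((a 0 0)^-1 *: b^T) 1%:M.
  pose Up : 'M[R]_(1 + n) := block_mx a b 0 S.
  have AE : A = Lo *m Up.
    have e1 : (a 0 0)^-1 *: b^T *m a = b^T.
      apply/matrixP => i j.
      by rewrite mxE big_ord1 !ord1 !mxE mulrAC mulVf ?mul1r.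
    have e2 : (a 0 0)^-1 *: b^T *m b + S = A'.
      by rewrite -scalemxAl /S addrC subrK.
    by rewrite /Lo /Up mulmx_block !mul1mx ?mul0mx ?mulmx0 !addr0 e1 e2 eA.
  have dLo : \det Lo = 1 by rewrite det_lblock !det1 mul1r.
  have dUp : \det Up = a 0 0 * \det S by rewrite det_ublock det_mx11.
  by rewrite AE det_mulmx dLo dUp mul1r.
have Ssym : S^T = S.
  by rewrite /S linearB/= linearZ/= trmx_mul trmxK A'sym.
have S_ge (v : 'rV[R]_n) : k * sqnorm v <= (v *m S *m v^T) 0 0.
  (* This first coordinate minimises the form for given [v]; the minimum is the form of the Schur
     complement at [v]. *)
  have := form (- ((v *m b^T) 0 0 / a 0 0))%:M v.
  have -> : v *m S *m v^T = v *m A' *m v^T - ((v *m b^T) 0 0 ^+ 2 / a 0 0)%:M.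
    have sE : v *m (b^T *m b) *m v^T = ((v *m b^T) 0 0 ^+ 2)%:M.
      rewrite mulmxA -mulmxA; have -> : b *m v^T = (v *m b^T)^T.
        by rewrite trmx_mul trmxK.
      set w := v *m b^T; apply/matrixP => i j.
      by rewrite !ord1 mxE big_ord1 !mxE/= mulr1n expr2.
    by rewrite /S mulmxBr mulmxBl -scalemxAr -scalemxAl sE scale_scalar_mx mulrC.
  rewrite mxDE mxNE !mxSE; set w := (v *m A' *m v^T) 0 0; set s := (v *m b^T) 0 0.
  have -> : (- (s / a 0 0)) ^+ 2 * a 0 0 = s ^+ 2 / a 0 0 by field.
  have -> : 2 * - (s / a 0 0) * s = - (2 * (s ^+ 2 / a 0 0)) by field.
  have : 0 <= k * (- (s / a 0 0)) ^+ 2 by rewrite mulr_ge0 ?sqr_ge0// ltW.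
  lra.
by rewrite detA exprS ler_pM// ?IH// ?exprn_ge0// ltW.
Qed.

Section spd.
Variables (d : nat) (klow kbar : R) (Sigma : 'M[R]_d).
Hypotheses (klow0 : 0 < klow) (kbar0 : 0 < kbar) (Sigma_sym : Sigma^T = Sigma).
Hypotheses (Sigma_ge : loewner_le klow%:M Sigma).
Hypotheses (Sigma_le : loewner_le Sigma kbar%:M).

Lemma det_ge : klow ^+ d <= \det Sigma.
Proof. exact: det_ge_of_form_ge (loewner_le_scalarl Sigma_ge). Qed.

Lemma Sigma_unit : Sigma \in unitmx.
Proof. by rewrite unitmxE unitfE gt_eqF// (lt_le_trans _ det_ge)// exprn_gt0. Qed.

Let invE (x : 'rV[R]_d) : x *m invmx Sigma *m Sigma = x.
Proof. by rewrite mulmxKV ?Sigma_unit. Qed.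

Let inv_sym : (invmx Sigma)^T = invmx Sigma.
Proof. by rewrite trmx_inv Sigma_sym. Qed.

Let formE (x : 'rV[R]_d) :
  let y := x *m invmx Sigma in y *m Sigma *m y^T = x *m invmx Sigma *m x^T.
Proof. by rewrite /= invE trmx_mul inv_sym mulmxA. Qed.

(** For $y=x\Sigma^{-1}$ the number $w=x\Sigma^{-1}x^T$ is also the form of $\Sigma$ at $y$, so
    [klow] $|y|^2\le w$; expanding $|x-$ [klow] $y|^2\ge0$ then gives the claim without
    diagonalising $\Sigma$. *)
Lemma form_inv_le (x : 'rV[R]_d) :
  (x *m invmx Sigma *m x^T) 0 0 <= sqnorm x / klow.
Proof.
rewrite ler_pdivlMr//.
pose y := x *m invmx Sigma.
have h1 : klow * sqnorm y <= (x *m invmx Sigma *m x^T) 0 0.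
  by rewrite -formE; exact: loewner_le_scalarl.
have : 0 <= sqnorm (x - klow *: y) by exact: sqnorm_ge0.
rewrite sqnormE mulmxBl [(_ - _)^T]linearB/= [(_ *: _)^T]linearZ/= !mulmxBr -!scalemxAl -!scalemxAr.
have -> : x *m y^T = x *m invmx Sigma *m x^T by rewrite trmx_mul inv_sym mulmxA.
rewrite -/y in h1 *; rewrite !(mx11B, mx11Z) -!sqnormE.
move: h1; set w := (y *m _) 0 0; set yy := sqnorm y; set xx := sqnorm x.
move=> h1 h2; have := ler_wpM2l (ltW klow0) h1.
nra.
Qed.

(** The form of $\Sigma$ at $y-x/$ [kbar] is nonnegative; expand it and use $x\Sigma x^T\le$ [kbar]
    $|x|^2$. *)
Lemma form_inv_ge (x : 'rV[R]_d) :
  sqnorm x / kbar <= (x *m invmx Sigma *m x^T) 0 0.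
Proof.
pose y := x *m invmx Sigma.
have h1 := loewner_le_scalarr Sigma_le x.
have : 0 <= ((y - kbar^-1 *: x) *m Sigma *m (y - kbar^-1 *: x)^T) 0 0.
  apply: le_trans (loewner_le_scalarl Sigma_ge _).
  by rewrite mulr_ge0 ?sqnorm_ge0// ltW.
rewrite [(_ - _)^T]linearB/= [(_ *: _)^T]linearZ/= mulmxBl !mulmxBr !mulmxBl -!scalemxAl -!scalemxAr.
rewrite (formE x) -/y.
have -> : x *m Sigma *m y^T = x *m x^T.
  have -> : x *m Sigma *m y^T = (y *m Sigma *m x^T)^T.
    by rewrite !trmx_mul trmxK Sigma_sym mulmxA.
  by rewrite invE trmx_mul trmxK.
rewrite invE.
rewrite !(mx11B, mx11Z) -!sqnormE.
set w := (y *m _) 0 0; move: h1; set v := (x *m Sigma *m _) 0 0.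
set xx := sqnorm x => h1.
have k0 : 0 < kbar^-1 by rewrite invr_gt0.
have h3 : kbar^-1 * v <= xx.
  by rewrite mulrC ler_pdivrMr// mulrC.
nra.
Qed.

(** The entry is a coordinate of $y=e_i\Sigma^{-1}$, and [klow] $|y|^2\le e_i\Sigma^{-1}e_i^T\le1/$
    [klow]. *)
Lemma norm_inv_entry_le i j : `|invmx Sigma i j| <= klow^-1.
Proof.
pose x : 'rV[R]_d := delta_mx 0 i.
pose y := x *m invmx Sigma.
have h1 : klow * sqnorm y <= (x *m invmx Sigma *m x^T) 0 0.
  by rewrite -formE; exact: loewner_le_scalarl.
have x1 : sqnorm x = 1.
  rewrite /sqnorm (bigD1 i)//= mxE !eqxx expr1n big1 ?addr0// => k ki.
  by rewrite mxE (negbTE ki) andbF expr0n.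
have h2 := le_trans h1 (form_inv_le x); rewrite x1 in h2.
have h3 := sqr_coord_le_sqnorm y j.
have -> : invmx Sigma i j = y 0 j by rewrite /y -rowE mxE.
have k0 : 0 < klow^-1 by rewrite invr_gt0.
rewrite -(@ler_pXn2r _ 2)//; last by rewrite nnegrE ltW.
rewrite real_normK ?num_real//.
apply: (le_trans h3); rewrite expr2 -ler_pdivrMl// invrK; lra.
Qed.

Lemma gauss_density_le (x : 'rV[R]_d) :
  gauss_density Sigma x <=
  (Num.sqrt ((2 * pi * klow) ^+ d))^-1 * expR (- (sqnorm x / (2 * kbar))).
Proof.
have p0 : 0 < 2 * pi :> R by rewrite mulr_gt0// pi_gt0.
rewrite /gauss_density ler_pM// ?invr_ge0 ?sqrtr_ge0 ?expR_ge0//.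
  rewrite lef_pV2 ?posrE ?sqrtr_gt0; last 2 first.
  - by rewrite mulr_gt0 ?exprn_gt0// (lt_le_trans _ det_ge)// exprn_gt0.
  - by rewrite exprn_gt0// mulr_gt0.
  by apply: ler_wsqrtr; rewrite exprMn ler_wpM2l ?det_ge// exprn_ge0// ltW.
by rewrite ler_expR lerN2 invfM mulrA mulrAC ler_wpM2r ?invr_ge0// form_inv_ge.
Qed.

Lemma gauss_density_gt0 (x : 'rV[R]_d) : 0 < gauss_density Sigma x.
Proof.
rewrite /gauss_density mulr_gt0 ?expR_gt0// invr_gt0 sqrtr_gt0 mulr_gt0//.
  by rewrite exprn_gt0// mulr_gt0// pi_gt0.
by rewrite (lt_le_trans _ det_ge)// exprn_gt0.
Qed.

End spd.
End quadratic_forms.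

(** * Gaussian mixtures: positivity, measurability and integrals against them *)

Section mixtures.
Context {R : realType}.

Lemma measurable_Num_sqrt : measurable_fun [set: R] (@Num.sqrt R).
Proof. by apply: continuous_measurable_fun; exact: sqrt_continuous. Qed.

Lemma bounded_integrable dT (T : measurableType dT) (P : probability T R)
    (f : T -> R) (M : R) : measurable_fun setT f -> (forall x, `|f x| <= M) ->
  P.-integrable setT (EFin \o f).
Proof.
move=> mf fM; apply: (@measurable_bounded_integrable _ _ _ P f setT) => //.
  by rewrite [X in (X < _)%E]probability_setT ltry.
exists M; split; first exact: num_real.
by move=> y My x _ /=; rewrite (le_trans (fM x))// ltW.
Qed.

Lemma integral_prob_cst dT (T : measurableType dT) (P : probability T R) (c : \bar R) :
  (\int[P]_x c = c)%E.
Proof. by rewrite integral_cst// [X in (_ * X)%E]probability_setT mule1. Qed.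

Lemma ge0_integral_EFinD dT (T : measurableType dT) (mu : {measure set T -> \bar R})
    (f g : T -> R) : measurable_fun setT f -> measurable_fun setT g ->
    (forall x, 0 <= f x) -> (forall x, 0 <= g x) ->
  (\int[mu]_x (f x + g x)%:E = \int[mu]_x (f x)%:E + \int[mu]_x (g x)%:E)%E.
Proof.
move=> mf mg f0 g0; under eq_integral do rewrite EFinD.
by rewrite ge0_integralD//; do ?exact/measurable_EFinP; move=> x _; rewrite lee_fin.
Qed.

Lemma ge0_integral_EFinZ dT (T : measurableType dT) (mu : {measure set T -> \bar R})
    (c : R) (f : T -> R) : 0 <= c -> measurable_fun setT f -> (forall x, 0 <= f x) ->
  (\int[mu]_x (c * f x)%:E = c%:E * \int[mu]_x (f x)%:E)%E.
Proof.
move=> c0 mf f0; under eq_integral do rewrite EFinM.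
by rewrite ge0_integralZl//; do ?exact/measurable_EFinP; move=> x _; rewrite lee_fin.
Qed.

Lemma ge0_le_integral_EFin dT (T : measurableType dT) (mu : {measure set T -> \bar R})
    (f g : T -> R) : measurable_fun setT f -> measurable_fun setT g ->
    (forall x, 0 <= f x) -> (forall x, f x <= g x) ->
  (\int[mu]_x (f x)%:E <= \int[mu]_x (g x)%:E)%E.
Proof.
move=> mf mg f0 fg; apply: ge0_le_integral => //.
- by move=> x _; rewrite lee_fin.
- exact/measurable_EFinP.
- exact/measurable_EFinP.
- by move=> x _; rewrite lee_fin.
Qed.

Variable d : nat.
Implicit Types G H : probability (borel_rV R d) R.

Lemma measurable_subrV :
  measurable_fun setT (fun p : borel_rV R d * borel_rV R d =>
    (p.1 : 'rV[R]_d) - (p.2 : 'rV[R]_d) : borel_rV R d).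
Proof.
apply: measurable_fun_rV => j; under eq_fun do rewrite !mxE.
apply: measurable_funB.
  by apply: (measurableT_comp (measurable_coord j)); exact: measurable_fst.
by apply: (measurableT_comp (measurable_coord j)); exact: measurable_snd.
Qed.

Lemma measurable_form (B : 'M[R]_d) :
  measurable_fun setT (fun x : borel_rV R d => ((x : 'rV[R]_d) *m B *m (x : 'rV[R]_d)^T) 0 0).
Proof.
under eq_fun do rewrite mxE; apply: measurable_sum => j.
under eq_fun do rewrite !mxE.
apply: measurable_funM; last exact: measurable_coord.
apply: measurable_sum => i; apply: measurable_funM; last exact: measurable_cst.
exact: measurable_coord.
Qed.

Lemma measurable_sqnorm :
  measurable_fun setT (fun x : borel_rV R d => sqnorm (x : 'rV[R]_d)).
Proof.
apply: measurable_sum => i; apply: measurable_funX; exact: measurable_coord.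
Qed.

Lemma measurable_gauss_density (Sigma : 'M[R]_d) :
  measurable_fun setT (fun x : borel_rV R d => gauss_density Sigma x).
Proof.
apply: measurable_funM; first exact: measurable_cst.
apply: measurableT_comp => //; apply: measurableT_comp => //.
apply: measurable_funM; last exact: measurable_cst.
exact: measurable_form.
Qed.

Variables (klow kbar : R) (Sigma : 'M[R]_d).
Hypotheses (klow0 : 0 < klow) (kbar0 : 0 < kbar) (Sigma_sym : Sigma^T = Sigma).
Hypotheses (Sigma_ge : loewner_le klow%:M Sigma).
Hypotheses (Sigma_le : loewner_le Sigma kbar%:M).

Definition gauss_sup : R := (Num.sqrt ((2 * pi * klow) ^+ d))^-1.

Lemma gauss_sup_gt0 : 0 < gauss_sup.
Proof. by rewrite invr_gt0 sqrtr_gt0 exprn_gt0// !mulr_gt0// pi_gt0. Qed.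

Let gauss_ge0 x : 0 <= gauss_density Sigma x.
Proof. exact/ltW/(gauss_density_gt0 klow0 Sigma_sym Sigma_ge). Qed.

Lemma gauss_density_le_sup (x : 'rV[R]_d) : gauss_density Sigma x <= gauss_sup.
Proof.
apply: le_trans (gauss_density_le klow0 kbar0 Sigma_sym Sigma_ge Sigma_le x) _.
rewrite -[leRHS]mulr1 ler_wpM2l ?(ltW gauss_sup_gt0)//.
rewrite -expR0 ler_expR oppr_le0 divr_ge0 ?sqnorm_ge0// mulr_ge0// ltW//.
Qed.

Let mgauss_shift x : measurable_fun setT (fun t : borel_rV R d =>
  gauss_density Sigma (x - (t : 'rV[R]_d))).
Proof.
apply: (measurableT_comp (measurable_gauss_density Sigma)).
apply: (measurableT_comp measurable_subrV (g := fun t : borel_rV R d => (x : borel_rV R d, t))).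
exact: measurable_pair1.
Qed.

Lemma integrable_gauss_shift G x :
  G.-integrable setT (fun t : borel_rV R d => (gauss_density Sigma (x - (t : 'rV[R]_d)))%:E).
Proof.
apply: (@bounded_integrable _ _ G _ gauss_sup) => // t.
by rewrite ger0_norm// gauss_density_le_sup.
Qed.

Lemma mixture_densityE G x : ((mixture_density G Sigma x)%:E =
  \int[G]_t (gauss_density Sigma (x - (t : 'rV[R]_d)))%:E)%E.
Proof.
by rewrite /mixture_density fineK// integrable_fin_num//; exact: integrable_gauss_shift.
Qed.

Lemma mixture_density_ge0 G x : 0 <= mixture_density G Sigma x.
Proof. by apply: Rintegral_ge0. Qed.

Lemma mixture_density_le G x : mixture_density G Sigma x <= gauss_sup.
Proof.
rewrite -lee_fin mixture_densityE.
apply: (@le_trans _ _ (\int[G]_t (cst gauss_sup%:E t))%E).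
  apply: ge0_le_integral => //.
  - by move=> t _; rewrite lee_fin.
  - exact/measurable_EFinP.
  - by move=> t _; rewrite lee_fin gauss_density_le_sup.
by rewrite integral_prob_cst.
Qed.

(** A zero integral would make the everywhere positive Gaussian factor vanish almost everywhere, so
    the whole space would be [G]-null. *)
Lemma mixture_density_gt0 G x : 0 < mixture_density G Sigma x.
Proof.
rewrite lt_neqAle mixture_density_ge0 andbT eq_sym; apply/eqP => f0.
pose h (t : borel_rV R d) := (gauss_density Sigma (x - (t : 'rV[R]_d)))%:E.
have mh : measurable_fun setT h by exact/measurable_EFinP.
have : (\int[G]_t `|h t| = 0)%E.
  rewrite -[RHS]/(0%:E) -f0 mixture_densityE; apply: eq_integral => t _.
  by rewrite gee0_abs// lee_fin.
move/(ae_eq_integral_abs G measurableT mh) => [A [mA GA0 hA]].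
have AT : A = setT.
  apply/seteqP; split => // t _; apply: hA => /= /(_ I) /eqP.
  by rewrite eqe gt_eqF//; exact: (gauss_density_gt0 klow0 Sigma_sym Sigma_ge).
have := probability_setT G; rewrite -AT GA0 => /eqP; rewrite eq_sym onee_eq0.
by [].
Qed.

Lemma measurable_gauss_sub : measurable_fun setT
  (fun p : borel_rV R d * borel_rV R d => gauss_density Sigma ((p.1 : 'rV[R]_d) - (p.2 : 'rV[R]_d))).
Proof.
exact: (measurableT_comp (measurable_gauss_density Sigma) measurable_subrV).
Qed.

Lemma measurable_mixture_density G :
  measurable_fun setT (fun x : borel_rV R d => mixture_density G Sigma x).
Proof.
apply/measurable_EFinP.
rewrite (_ : EFin \o _ = (fun x : borel_rV R d =>
    \int[G]_t (gauss_density Sigma ((x : 'rV[R]_d) - (t : 'rV[R]_d)))%:E)%E); last first.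
  by apply/funext => x; rewrite /= mixture_densityE.
apply: (@measurable_fun_fubini_tonelli_F _ _ _ _ _ G
  (fun p : borel_rV R d * borel_rV R d =>
    (gauss_density Sigma ((p.1 : 'rV[R]_d) - (p.2 : 'rV[R]_d)))%:E)).
- by apply/measurable_EFinP; exact: measurable_gauss_sub.
- by move=> p; rewrite lee_fin.
Qed.

(** An observation is a latent [t] drawn from [G] plus Gaussian noise; on integrals this is Tonelli
    followed by translation invariance. *)
Lemma integral_mixture G (g : borel_rV R d -> \bar R) :
    measurable_fun setT g -> (forall x, 0 <= g x)%E ->
  (\int[lebesgue_rV d]_x ((mixture_density G Sigma x)%:E * g x) =
   \int[G]_t \int[lebesgue_rV d]_x
     ((gauss_density Sigma x)%:E * g ((x : 'rV[R]_d) + (t : 'rV[R]_d))%R))%E.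
Proof.
move=> mg g0.
pose F (p : borel_rV R d * borel_rV R d) : \bar R :=
  ((gauss_density Sigma ((p.1 : 'rV[R]_d) - (p.2 : 'rV[R]_d)))%:E * g p.1)%E.
have mF : measurable_fun setT F.
  apply: emeasurable_funM; first by apply/measurable_EFinP; exact: measurable_gauss_sub.
  by apply: measurableT_comp => //; exact: measurable_fst.
have F0 p : (0 <= F p)%E by rewrite mule_ge0// lee_fin.
transitivity (\int[lebesgue_rV d]_x \int[G]_t F (x, t))%E.
  apply: eq_integral => x _; rewrite mixture_densityE muleC -ge0_integralZl//.
  - by apply: eq_integral => t _; rewrite muleC.
  - exact/measurable_EFinP.
  - by move=> t _; rewrite lee_fin.
transitivity (\int[G]_t \int[lebesgue_rV d]_x F (x, t))%E.
  exact: (@fubini_tonelli _ _ _ _ _ (lebesgue_rV d) G F mF F0).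
apply: eq_integral => t _; rewrite /F/=.
rewrite -(@integral_rV_shift _ _ (t : 'rV[R]_d) (fun x : borel_rV R d =>
   ((gauss_density Sigma x)%:E * g ((x : 'rV[R]_d) + (t : 'rV[R]_d))%R)%E))//.
- by apply: eq_integral => x _; rewrite subrK.
- apply: emeasurable_funM.
    by apply/measurable_EFinP; exact: measurable_gauss_density.
  apply: (measurableT_comp mg (g := fun x : borel_rV R d =>
    (x : 'rV[R]_d) + (t : 'rV[R]_d) : borel_rV R d)).
  have := @measurable_shift_rV R d (- (t : 'rV[R]_d)).
  by under eq_fun do rewrite opprK.
- by move=> x; rewrite mule_ge0// lee_fin.
Qed.

(* The normalisation of the Gaussian density is obtained from that of a single *)
(* mixture, which avoids the change of variables by Sigma^{1/2}.               *)
Lemma integral_gauss_of_mixture G :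
    (\int[lebesgue_rV d]_x (mixture_density G Sigma x)%:E = 1)%E ->
  (\int[lebesgue_rV d]_x (gauss_density Sigma x)%:E = 1)%E.
Proof.
move=> <-; transitivity (\int[lebesgue_rV d]_x ((mixture_density G Sigma x)%:E * cst 1 x))%E.
  rewrite integral_mixture//.
  under [RHS]eq_integral do under eq_integral do rewrite /cst mule1.
  by rewrite integral_prob_cst.
by apply: eq_integral => x _; rewrite mule1.
Qed.

Lemma integral_mixture1 H :
    (\int[lebesgue_rV d]_x (gauss_density Sigma x)%:E = 1)%E ->
  (\int[lebesgue_rV d]_x (mixture_density H Sigma x)%:E = 1)%E.
Proof.
move=> g1; transitivity (\int[lebesgue_rV d]_x ((mixture_density H Sigma x)%:E * cst 1 x))%E.
  by apply: eq_integral => x _; rewrite mule1.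
rewrite integral_mixture//.
under eq_integral do under eq_integral do rewrite /cst mule1.
by rewrite g1 integral_prob_cst.
Qed.

End mixtures.

(** * Hellinger affinity and its perturbation by a small weight *)

Section hellinger.
Context {R : realType} (d : nat).
Local Notation mu := (@lebesgue_rV R d).
Variables (f g : borel_rV R d -> R).
Hypotheses (mf : measurable_fun setT f) (mg : measurable_fun setT g).
Hypotheses (f0 : forall x, 0 <= f x) (g0 : forall x, 0 <= g x).
Hypotheses (f1 : (\int[mu]_x (f x)%:E = 1)%E) (g1 : (\int[mu]_x (g x)%:E = 1)%E).

Let ms : measurable_fun setT (fun x => Num.sqrt (f x)).
Proof. by apply: (measurableT_comp measurable_Num_sqrt). Qed.
Let mt : measurable_fun setT (fun x => Num.sqrt (g x)).
Proof. by apply: (measurableT_comp measurable_Num_sqrt). Qed.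

(** Integrate $(\sqrt f-\sqrt g)^2+2\sqrt f\sqrt g=f+g$, whose right side has integral 2. As
    [hellinger2] uses a real-valued integral, the finiteness of both terms has to be extracted from
    this identity. *)
Lemma hellinger_affinity :
  [/\ 0 <= hellinger2 f g, hellinger2 f g <= 1 &
  (\int[mu]_x (Num.sqrt (f x) * Num.sqrt (g x))%:E = (1 - hellinger2 f g)%:E)%E].
Proof.
have m2 : measurable_fun setT (fun x : borel_rV R d => (Num.sqrt (f x) - Num.sqrt (g x)) ^+ 2).
  by apply: measurable_funX; exact: measurable_funB.
have mst : measurable_fun setT (fun x : borel_rV R d => Num.sqrt (f x) * Num.sqrt (g x)).
  exact: measurable_funM.
pose A := (\int[mu]_x ((Num.sqrt (f x) - Num.sqrt (g x)) ^+ 2)%:E)%E.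
pose B := (\int[mu]_x (Num.sqrt (f x) * Num.sqrt (g x))%:E)%E.
have A0 : (0 <= A)%E by apply: integral_ge0 => x _; rewrite lee_fin sqr_ge0.
have B0 : (0 <= B)%E by apply: integral_ge0 => x _; rewrite lee_fin mulr_ge0.
have AB : (A + 2%:E * B = 2%:E)%E.
  have m2st : measurable_fun setT (fun x : borel_rV R d =>
      2 * (Num.sqrt (f x) * Num.sqrt (g x))) by exact: measurable_funM.
  rewrite /A /B -ge0_integral_EFinZ//.
  have p1 (x : borel_rV R d) : 0 <= (Num.sqrt (f x) - Num.sqrt (g x)) ^+ 2.
    exact: sqr_ge0.
  have p2 (x : borel_rV R d) : 0 <= 2 * (Num.sqrt (f x) * Num.sqrt (g x)).
    by rewrite !mulr_ge0.
  rewrite -(ge0_integral_EFinD mu m2 m2st p1 p2).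
  transitivity (\int[mu]_x (f x + g x)%:E)%E.
    apply: eq_integral => x _; congr EFin.
    rewrite -[in RHS](sqr_sqrtr (f0 x)) -[in RHS](sqr_sqrtr (g0 x)); ring.
  by rewrite ge0_integral_EFinD// f1 g1 -EFinD.
have hE : hellinger2 f g = 2^-1 * fine A by [].
have [Af Bf] : A \is a fin_num /\ B \is a fin_num.
  have B2 : (0 <= 2%:E * B)%E by rewrite mule_ge0.
  have Af : A \is a fin_num.
    by rewrite ge0_fin_numE// (@le_lt_trans _ _ 2%:E) ?ltry// -AB leeDl.
  split=> //; have : (2%:E * B < +oo)%E.
    by rewrite (@le_lt_trans _ _ 2%:E) ?ltry// -[leRHS]AB leeDr.
  rewrite ge0_fin_numE//; move: B B0 {B2 AB} => [b _ _| _|//].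
    by rewrite ltry.
  by rewrite gt0_muley// lte_fin.
rewrite hE -/B; move: A B A0 B0 AB {hE} Af Bf => [a| |] [b| |]//.
rewrite !lee_fin -EFinM -EFinD/= => a0 b0 [ab] _ _; split => //; first by lra.
  by lra.
by congr EFin; lra.
Qed.

(** Use $\sqrt{f+v}\le\sqrt f+\sqrt v$, then $\sqrt{vg}\le v/(2s)+sg/2$: each of the last two terms
    integrates to at most $s/2$. *)
Lemma integral_sqrt_add_le (v : borel_rV R d -> R) (s : R) :
    measurable_fun setT v -> (forall x, 0 <= v x) -> 0 < s ->
    (\int[mu]_x (v x)%:E <= (s ^+ 2)%:E)%E ->
  (\int[mu]_x (Num.sqrt (f x + v x) * Num.sqrt (g x))%:E <=
   (1 - hellinger2 f g + s)%:E)%E.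
Proof.
move=> mv v0 s0 vs; have [_ _ hE] := hellinger_affinity.
have mst : measurable_fun setT (fun x : borel_rV R d => Num.sqrt (f x) * Num.sqrt (g x)).
  exact: measurable_funM.
have mcv : measurable_fun setT (fun x : borel_rV R d => (2 * s)^-1 * v x).
  exact: measurable_funM.
have mcg : measurable_fun setT (fun x : borel_rV R d => s / 2 * g x).
  exact: measurable_funM.
have cv0 x : 0 <= (2 * s)^-1 * v x.
  by rewrite mulr_ge0// invr_ge0 mulr_ge0// ltW.
have cg0 x : 0 <= s / 2 * g x by rewrite mulr_ge0// divr_ge0// ltW.
apply: (@le_trans _ _ (\int[mu]_x (Num.sqrt (f x) * Num.sqrt (g x) +
   ((2 * s)^-1 * v x + s / 2 * g x))%:E)%E).
  apply: ge0_le_integral_EFin.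
  - apply: measurable_funM => //.
    by apply: (measurableT_comp measurable_Num_sqrt); exact: measurable_funD.
  - by apply: measurable_funD => //; exact: measurable_funD.
  - by move=> x; rewrite mulr_ge0.
  move=> x.
  have h1 : Num.sqrt (f x + v x) <= Num.sqrt (f x) + Num.sqrt (v x).
    rewrite -(@ler_pXn2r _ 2)// ?nnegrE ?addr_ge0//.
    rewrite sqrrD !sqr_sqrtr ?addr_ge0// lerD2r lerDl.
    by rewrite mulrn_wge0// mulr_ge0.
  have h2 : Num.sqrt (v x) * Num.sqrt (g x) <= (2 * s)^-1 * v x + s / 2 * g x.
    (* AM-GM *)
    rewrite -[in leRHS](sqr_sqrtr (v0 x)) -[in leRHS](sqr_sqrtr (g0 x)).
    set a := Num.sqrt _; set b := Num.sqrt _.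
    have : 0 <= (2 * s)^-1 * (a - s * b) ^+ 2.
      by rewrite mulr_ge0 ?sqr_ge0// invr_ge0 mulr_ge0// ltW.
    have -> : (2 * s)^-1 * (a - s * b) ^+ 2 =
       (2 * s)^-1 * a ^+ 2 + s / 2 * b ^+ 2 - a * b.
      by field; rewrite gt_eqF.
    by rewrite subr_ge0.
  apply: le_trans (ler_wpM2r _ h1) _ => //.
  by rewrite mulrDl lerD2l.
have st0 (x : borel_rV R d) : 0 <= Num.sqrt (f x) * Num.sqrt (g x).
  by rewrite mulr_ge0.
have cvg0 (x : borel_rV R d) : 0 <= (2 * s)^-1 * v x + s / 2 * g x.
  by rewrite addr_ge0.
rewrite (ge0_integral_EFinD mu mst (measurable_funD mcv mcg) st0 cvg0).
rewrite ge0_integral_EFinD//.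
rewrite ge0_integral_EFinZ//; last by rewrite invr_ge0 mulr_ge0// ltW.
rewrite ge0_integral_EFinZ//; last by rewrite divr_ge0// ltW.
rewrite hE g1 mule1 [leRHS]EFinD leeD2l//.
have -> : (s%:E = ((2 * s)^-1)%:E * (s ^+ 2)%:E + (s / 2)%:E)%E.
  by rewrite -EFinM -EFinD; congr EFin; field; rewrite gt_eqF.
by rewrite leeD2r// lee_wpmul2l// lee_fin invr_ge0 mulr_ge0// ltW.
Qed.

End hellinger.

(** * Distance to a set and separated nets *)

Section euclidean_distance.
Context {R : realType} (d : nat).
Implicit Types x y v : 'rV[R]_d.

Lemma norm2E v : norm2 v = Num.sqrt (sqnorm v).
Proof. by []. Qed.

Lemma norm2_ge0 v : 0 <= norm2 v.
Proof. exact: sqrtr_ge0. Qed.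

Lemma sqr_norm2 v : norm2 v ^+ 2 = sqnorm v.
Proof. by rewrite sqr_sqrtr// sqnorm_ge0. Qed.

Lemma norm2_le v (a : R) : 0 <= a -> (norm2 v <= a) = (sqnorm v <= a ^+ 2).
Proof. by move=> a0; rewrite -sqr_norm2 ler_pXn2r// nnegrE norm2_ge0. Qed.

Lemma sqnormN v : sqnorm (- v) = sqnorm v.
Proof. by apply: eq_bigr => i _; rewrite mxE sqrrN. Qed.

Lemma norm2N v : norm2 (- v) = norm2 v.
Proof. by rewrite !norm2E sqnormN. Qed.

Lemma norm2B x y : norm2 (x - y) = norm2 (y - x).
Proof. by rewrite -norm2N opprB. Qed.

Lemma coord_le_norm2 v i : `|v 0 i| <= norm2 v.
Proof.
rewrite -(@ler_pXn2r _ 2)// ?nnegrE ?norm2_ge0// real_normK ?num_real//.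
by rewrite sqr_norm2 sqr_coord_le_sqnorm.
Qed.

Lemma sqnorm_le_coord v (r : R) : (forall i, `|v 0 i| <= r) ->
  sqnorm v <= d%:R * r ^+ 2.
Proof.
move=> vr; rewrite /sqnorm mulr_natl -[in leRHS](card_ord d) -sumr_const.
apply: ler_sum => i _; rewrite -(real_normK (num_real _)).
by rewrite ler_pXn2r// ?nnegrE// (le_trans _ (vr i)).
Qed.

Lemma ler_norm2D x y : norm2 (x + y) <= norm2 x + norm2 y.
Proof.
pose dot := \sum_i x 0 i * y 0 i.
have E (s : R) : sqnorm (x + s *: y) = sqnorm x + 2 * s * dot + s ^+ 2 * sqnorm y.
  rewrite /sqnorm /dot !mulr_sumr -!big_split/=.
  by apply: eq_bigr => i _; rewrite !mxE; ring.
have cs : dot <= norm2 x * norm2 y.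
  have [y0|y0] := eqVneq (norm2 y) 0.
    have yi i : y 0 i = 0.
      by apply/eqP; rewrite -normr_le0 -y0 coord_le_norm2.
    by rewrite y0 mulr0 /dot big1// => i _; rewrite yi mulr0.
  have yp : 0 < norm2 y by rewrite lt_neqAle eq_sym y0 norm2_ge0.
  have [x0|x0] := eqVneq (norm2 x) 0.
    have xi i : x 0 i = 0.
      by apply/eqP; rewrite -normr_le0 -x0 coord_le_norm2.
    by rewrite x0 mul0r /dot big1// => i _; rewrite xi mul0r.
  have xp : 0 < norm2 x by rewrite lt_neqAle eq_sym x0 norm2_ge0.
  have := sqnorm_ge0 (x + (- (norm2 x / norm2 y)) *: y).
  rewrite E -!sqr_norm2.
  have -> : norm2 x ^+ 2 + 2 * - (norm2 x / norm2 y) * dot +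
     (- (norm2 x / norm2 y)) ^+ 2 * norm2 y ^+ 2 =
     (2 * (norm2 x / norm2 y)) * (norm2 x * norm2 y - dot) by field.
  by rewrite pmulr_rge0 ?subr_ge0// mulr_gt0// divr_gt0.
rewrite norm2_le ?addr_ge0 ?norm2_ge0//.
have := E 1; rewrite scale1r => ->; rewrite -!sqr_norm2 sqrrD.
by rewrite mulr1 expr1n mul1r; move: cs; lra.
Qed.

Lemma continuous_sqnormB x : continuous (fun v => sqnorm (v - x)).
Proof.
apply: (@continuous_big R _ +%R 0 xpredT _ 'rV[R]_d (index_enum 'I_d)
  (fun i v => (v - x) 0 i ^+ 2)); first exact: add_continuous.
move=> i _ v.
apply: (continuous_comp _ (@exprn_continuous R 2 _)).
have -> : (fun v : 'rV[R]_d => (v - x) 0 i) = (fun v => v 0 i - x 0 i).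
  by apply/funext => w; rewrite !mxE.
apply: continuousB; [exact: coord_continuous|exact: cst_continuous].
Qed.

Variable S : set 'rV[R]_d.
Hypothesis S0 : S !=set0.

Lemma dist_set_lbound v : has_lbound [set norm2 (v - s) | s in S].
Proof. by exists 0 => _ [s _ <-]; exact: norm2_ge0. Qed.

Lemma dist_set_ge0 v : 0 <= dist_set S v.
Proof.
apply: lb_le_inf; first by case: S0 => s Ss; exists (norm2 (v - s)), s.
by move=> _ [s _ <-]; exact: norm2_ge0.
Qed.

Lemma dist_set_le v s : S s -> dist_set S v <= norm2 (v - s).
Proof. by move=> Ss; apply: ge_inf; [exact: dist_set_lbound|exists s]. Qed.

Lemma dist_set_ltP v (a : R) : dist_set S v < a ->
  exists2 s, S s & norm2 (v - s) < a.
Proof.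
case/inf_lt; first by case: S0 => s Ss; exists (norm2 (v - s)), s.
by move=> _ [s Ss <-] h; exists s.
Qed.

Lemma dist_setD v z : dist_set S (v + z) <= dist_set S v + norm2 z.
Proof.
apply/ler_addgt0Pl => e e0.
have [s Ss hs] : exists2 s, S s & norm2 (v - s) < dist_set S v + e.
  by apply: dist_set_ltP; rewrite ltrDl.
apply: (le_trans (dist_set_le _ Ss)); rewrite addrAC.
apply: (le_trans (ler_norm2D _ _)); rewrite addrA lerD2r.
by rewrite [leRHS]addrC ltW.
Qed.

(** The strict sublevel sets are unions of open Euclidean balls centred in [S], hence open. *)
Lemma measurable_dist_set :
  measurable_fun setT (fun v : borel_rV R d => dist_set S v).
Proof.
apply: (measurability _ (RGenInftyO.measurableE R)) => // _ [_ [a ->] <-].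
rewrite setTI; apply: open_measurable_rV.
rewrite (_ : _ @^-1` _ = \bigcup_(s in S) [set v : 'rV[R]_d | norm2 (v - s) < a]); last first.
  apply/seteqP; split => v /=; rewrite in_itv/=.
    by move=> /dist_set_ltP[s Ss h]; exists s.
  by move=> [s Ss h]; apply: le_lt_trans (dist_set_le _ Ss) h.
apply: bigcup_open => s _.
have [a0|a0] := ltP 0 a; last first.
  rewrite (_ : [set _ | _] = set0); first exact: open0.
  apply/seteqP; split => // v /= h.
  by have := le_lt_trans (norm2_ge0 _) (lt_le_trans h a0); rewrite ltxx.
rewrite (_ : [set _ | _] = (fun v => sqnorm (v - s)) @^-1` `]-oo, a ^+ 2[%classic); last first.
  apply/seteqP; split => v /=; rewrite in_itv/= -sqr_norm2 ltr_pXn2r// ?nnegrE ?norm2_ge0 ?ltW//.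
apply: open_comp; last exact: interval_open.
by move=> v _; exact: continuous_sqnormB.
Qed.

Lemma measurable_fattening (a : R) : measurable (fattening S a : set (borel_rV R d)).
Proof.
have := measurable_dist_set measurableT (measurable_itv `]-oo, a]).
rewrite setTI; congr measurable; apply/seteqP; split => v /=; rewrite /fattening/= in_itv//.
Qed.

Hypothesis d0 : (0 < d)%N.

(** Cubes stand in for Euclidean balls because their volume is explicit; a point of [cube h x] is
    within Euclidean distance [d * h] of [x]. *)
Definition cube (h : R) x : set (borel_rV R d) :=
  [set v | forall i, `[x 0 i - h, x 0 i + h]%classic ((v : 'rV[R]_d) 0 i)].

Lemma measurable_cube h x : measurable (cube h x).
Proof.
have -> : cube h x = \bigcap_(i in [set: 'I_d])
    (fun v => (v : 'rV[R]_d) 0 i) @^-1` `[x 0 i - h, x 0 i + h]%classic.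
  by apply/seteqP; split=> v /= hv i => [_|]; exact: hv.
apply: fin_bigcap_measurable => // i _; rewrite -[X in measurable X]setTI.
exact: measurable_coord.
Qed.

Lemma lebesgue_cube h x : 0 <= h -> lebesgue_rV d (cube h x) = ((2 * h) ^+ d)%:E.
Proof.
move=> h0.
rewrite (@lebesgue_rV_box R d (fun i => `[x 0 i - h, x 0 i + h]%classic)); last first.
  by move=> i; exact: measurable_itv.
rewrite (eq_bigr (fun=> (2 * h)%:E)); last first.
  move=> i _; rewrite lebesgue_measure_itv/= lte_fin.
  case: ifPn => [_|]; first by rewrite -EFinB; congr EFin; ring.
  by rewrite -leNgt => hh; congr EFin; lra.
by rewrite prodEFin prodr_const card_ord.
Qed.

Lemma norm2_cube h x v : 0 <= h -> cube h x v -> norm2 ((v : 'rV[R]_d) - x) <= d%:R * h.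
Proof.
move=> h0 vx; rewrite norm2_le ?mulr_ge0//.
apply: (@le_trans _ _ (d%:R * h ^+ 2)).
  apply: sqnorm_le_coord => i; have := vx i; rewrite /= in_itv/= !mxE ler_distl.
  by [].
rewrite exprMn ler_wpM2r ?sqr_ge0// expr2 ler_peMl//.
by rewrite ler1n.
Qed.

Fixpoint cubes (h : R) (s : seq 'rV[R]_d) : set (borel_rV R d) :=
  if s is x :: s' then cube h x `|` cubes h s' else set0.

Lemma cubesP h s v : cubes h s v <-> exists2 x, x \in s & cube h x v.
Proof.
elim: s => [|x s IH] /=; first by split=> // -[].
split=> [[vx|/IH[y ys yv]]|[y]].
- by exists x; rewrite ?mem_head.
- by exists y; rewrite // inE ys orbT.
- by rewrite inE => /predU1P[->|ys] yv; [left|right; apply/IH; exists y].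
Qed.

Definition separated (rho : R) (s : seq 'rV[R]_d) : bool :=
  pairwise (fun x y => rho < norm2 (x - y)) s.

Lemma measurable_cubes h s : measurable (cubes h s).
Proof.
by elim: s => [|x s IH] //=; apply: measurableU => //; exact: measurable_cube.
Qed.

Lemma lebesgue_cubes (h : R) s : 0 <= h -> separated (2 * d%:R * h) s ->
  lebesgue_rV d (cubes h s) = ((size s)%:R * (2 * h) ^+ d)%:E.
Proof.
move=> h0; elim: s => [_|x s IH /= /andP[/allP xs ss]]; first by rewrite mul0r measure0.
rewrite measureU//; last 3 first.
- exact: measurable_cube.
- exact: measurable_cubes.
- apply/seteqP; split => // v [xv /cubesP[y ys yv]].
  have := xs _ ys; rewrite ltNge => /negP; apply.
  rewrite -(subrKA (v : 'rV[R]_d)) (le_trans (ler_norm2D _ _))//.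
  rewrite norm2B -mulrA mulr_natl mulr2n lerD//; exact: norm2_cube.
rewrite [X in (X + _)%E]lebesgue_cube// [X in (_ + X)%E]IH// -EFinD; congr EFin.
by rewrite -[in RHS]natr1; ring.
Qed.

(** Take a [rho]-separated list in [S] of maximal length; maximality makes it a [rho]-net. Cubes of
    half-side [rho / (2 * d)] around its points are disjoint and lie in the fattening by [rho], so
    its volume bounds the length, which is also why a maximal list exists. *)
Lemma exists_separated_net (rho : R) (V : R) : 0 < rho ->
    lebesgue_rV d (fattening S rho) = V%:E ->
  exists s : seq 'rV[R]_d, [/\ (0 < size s)%N, (forall x, x \in s -> S x),
    (forall x, S x -> exists2 y, y \in s & norm2 (x - y) <= rho) &
    (size s)%:R * (rho / d%:R) ^+ d <= V].
Proof.
move=> rho0 SV; have dp : 0 < d%:R :> R by rewrite ltr0n.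
pose h := rho / (2 * d%:R).
have h0 : 0 < h by rewrite divr_gt0// mulr_gt0.
have hE : 2 * d%:R * h = rho by rewrite mulrC divfK// gt_eqF// mulr_gt0.
have hE2 : 2 * h = rho / d%:R by rewrite /h; field; rewrite gt_eqF.
pose good (s : seq 'rV[R]_d) := (forall x, x \in s -> S x) /\ separated rho s.
have size_le s : good s -> (size s)%:R * (rho / d%:R) ^+ d <= V.
  move=> [sS ss]; rewrite -lee_fin -SV -hE2 -lebesgue_cubes ?hE//; last exact: ltW.
  apply: (@le_measure _ _ _ (lebesgue_rV d)); rewrite ?inE; [exact: measurable_cubes|exact: measurable_fattening|].
  move=> v /cubesP[x xs xv]; apply: (le_trans (dist_set_le _ (sS _ xs))).
  apply: (le_trans (norm2_cube (ltW h0) xv)).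
  by rewrite -hE; apply: ler_wpM2r; rewrite ?ltW//; lra.
pose P m := `[< exists2 s, good s & size s = m >].
have P1 : P 1%N.
  case: S0 => x Sx; apply/asboolP; exists [:: x] => //; split=> //.
  by move=> y; rewrite inE => /eqP ->.
have vp : 0 < (rho / d%:R) ^+ d by rewrite exprn_gt0// divr_gt0.
have Pub m : P m -> (m <= Num.trunc (V / (rho / d%:R) ^+ d))%N.
  move=> /asboolP[s gs sm].
  have mV : m%:R <= V / (rho / d%:R) ^+ d :> R.
    by rewrite ler_pdivlMr// -sm; exact: size_le.
  by rewrite truncn_ge_nat// (le_trans _ mV).
have exP : exists m, P m by exists 1%N.
case: (ex_maxnP exP Pub) => m /asboolP[s gs sm] mmax.
exists s; split.
- by rewrite sm; exact: mmax.
- by case: gs.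
- move=> x Sx; apply: contrapT => hx.
  have : P m.+1.
    apply/asboolP; exists (x :: s); last by rewrite /= sm.
    case: gs => sS ss; split=> [y|].
      by rewrite inE => /predU1P[->//|]; exact: sS.
    rewrite /separated/= -/(separated rho s) ss andbT.
    apply/allP => y ys; rewrite ltNge; apply/negP => xy.
    by apply: hx; exists y.
  by move/mmax; rewrite ltnn.
- exact: size_le.
Qed.

End euclidean_distance.

(** * Moment matching and finite codes *)

Section exp_taylor.
Context {R : realType}.

Definition exp_poly (K : nat) (x : R) : R := \sum_(0 <= j < K) x ^+ j / j`!%:R.

Lemma exp_poly_cvg x : exp_poly ^~ x @ \oo --> expR x.
Proof.
have := @is_cvg_series_exp_coeff R x; rewrite /expR.
exact.
Qed.

Lemma exp_poly_le_expR K x : 0 <= x -> exp_poly K x <= expR x.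
Proof.
move=> x0.
have cv := @exp_poly_cvg x.
rewrite -(cvg_lim _ cv)//.
apply: nondecreasing_cvgn_le; last by apply/cvg_ex; exists (expR x).
apply/nondecreasing_seqP => n; rewrite /exp_poly big_nat_recr//= lerDl.
by rewrite divr_ge0// exprn_ge0.
Qed.

(** For $j\ge K$ one has $x^j\le e^{-K}(ex)^j$, so the remainder is at most $e^{-K}$ times the
    exponential series at $ex$. Thus [K] a little above $ex$ makes it exponentially small. *)
Lemma exp_poly_tail K x : 0 <= x ->
  `|expR (- x) - exp_poly K (- x)| <= expR (expR 1 * x - K%:R).
Proof.
move=> x0; have cv := @exp_poly_cvg (- x).
have cv' : `|exp_poly m (- x) - exp_poly K (- x)| @[m --> \oo] -->
    `|expR (- x) - exp_poly K (- x)|.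
  by apply: cvg_norm; apply: cvgB; [exact: cv|exact: cvg_cst].
rewrite -(cvg_lim _ cv')//; apply: limr_le; first by apply/cvg_ex; eexists; exact: cv'.
near=> m.
have Km : (K <= m)%N by near: m; exact: nbhs_infty_ge.
have -> : exp_poly m (- x) - exp_poly K (- x) =
    \sum_(K <= j < m) (- x) ^+ j / j`!%:R.
  by rewrite /exp_poly (@big_cat_nat _ _ _ K 0%N m)//= addrAC subrr add0r.
apply: (le_trans (ler_norm_sum _ _ _)).
have e1 : 1 <= expR 1 :> R by rewrite -expR0 ler_expR.
apply: (@le_trans _ _ (\sum_(K <= j < m) expR (- K%:R) * ((expR 1 * x) ^+ j / j`!%:R))).
  rewrite !big_nat; apply: ler_sum => j /andP[Kj _].
  rewrite normrM normrX normrN (ger0_norm x0) normfV (ger0_norm (ler0n _ _)).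
  rewrite mulrA ler_wpM2r ?invr_ge0// exprMn mulrA ler_peMl ?exprn_ge0//.
  rewrite -expRM_natl mulr1 -expRD -[leLHS]expR0 ler_expR addrC subr_ge0 ler_nat//.
rewrite -mulr_sumr addrC expRD ler_wpM2l ?expR_ge0//.
apply: le_trans (exp_poly_le_expR m _); last by rewrite mulr_ge0// expR_ge0.
rewrite /exp_poly (@big_cat_nat _ _ _ K 0%N m)//= lerDr sumr_ge0// => j _.
by rewrite divr_ge0// exprn_ge0// mulr_ge0// expR_ge0.
Unshelve. all: by end_near.
Qed.

End exp_taylor.

Section moment_matching.
Context {R : realType} {dT : measure_display} (T : measurableType dT).
Variables (G H : probability T R) (Q : set T) (mQ : measurable Q).
Variables (d : nat) (y : 'I_d -> T -> R).
Hypotheses (my : forall i, measurable_fun setT (y i)).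
Hypotheses (yQ : forall t, Q t -> forall i, `|y i t| <= 1).

Definition monomial (a : 'I_d -> nat) (t : T) : R := \prod_i y i t ^+ a i.

Definition measurable_bounded_on (w : T -> R) : Prop :=
  measurable_fun setT w /\ exists B, forall t, Q t -> `|w t| <= B.

Local Notation mbo := measurable_bounded_on.

Lemma normr_Rintegral_le (P : probability T R) (f : T -> R) (c : R) :
  measurable_fun setT f -> (forall t, `|f t| <= c) -> `|\int[P]_t f t| <= c.
Proof.
move=> mf fc; have fi := bounded_integrable P mf fc.
rewrite (le_trans (le_normr_Rintegral _ fi))//.
have fi' : P.-integrable setT (EFin \o (fun t => `|f t|)).
  apply: (@bounded_integrable _ _ _ P _ c) => [|t]; last by rewrite normr_id.
  exact: measurableT_comp.
rewrite -lee_fin fineK; last exact: integrable_fin_num fi'.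
rewrite -[leRHS](integral_prob_cst P); apply: ge0_le_integral => //.
- by apply/measurable_EFinP; exact: measurableT_comp.
- by move=> t _; rewrite lee_fin.
Qed.

Lemma measurable_bounded_onM w1 w2 : mbo w1 -> mbo w2 -> mbo (fun t => w1 t * w2 t).
Proof.
move=> [m1 [B1 h1]] [m2 [B2 h2]]; split; first exact: measurable_funM.
exists (B1 * B2) => t Qt; rewrite normrM ler_pM// ?h1 ?h2//.
Qed.

Lemma measurable_bounded_onD w1 w2 : mbo w1 -> mbo w2 -> mbo (fun t => w1 t + w2 t).
Proof.
move=> [m1 [B1 h1]] [m2 [B2 h2]]; split; first exact: measurable_funD.
by exists (B1 + B2) => t Qt; rewrite (le_trans (ler_normD _ _))// lerD// ?h1 ?h2.
Qed.

Lemma measurable_bounded_on_cst c : mbo (fun=> c).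
Proof. by split; [exact: measurable_cst|exists `|c|]. Qed.

Lemma measurable_bounded_on_coord i : mbo (y i).
Proof. by split=> //; exists 1 => t Qt; exact: yQ. Qed.

Lemma measurable_bounded_on_monomial a : mbo (monomial a).
Proof.
split.
  by apply: measurable_prod => i _; exact: measurable_funX.
exists 1 => t Qt; rewrite /monomial normr_prod.
by apply: prodr_ile1 => i _; rewrite normr_ge0 normrX exprn_ile1// yQ.
Qed.

Lemma integrable_indic_mul (P : probability T R) w : mbo w ->
  P.-integrable setT (EFin \o (fun t => \1_Q t * w t)).
Proof.
move=> [mw [B hB]]; apply: (@bounded_integrable _ _ _ P _ `|B|).
  by apply: measurable_funM => //; exact: measurable_indic.
move=> t; rewrite indicE; case: (boolP (t \in Q)) => [/set_mem Qt|_].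
  by rewrite mul1r (le_trans (hB _ Qt))// ler_norm.
by rewrite mul0r normr0.
Qed.

Definition int_diff (w : T -> R) : R :=
  \int[G]_t (\1_Q t * w t) - \int[H]_t (\1_Q t * w t).

Lemma int_diffD w1 w2 : mbo w1 -> mbo w2 ->
  int_diff (fun t => w1 t + w2 t) = int_diff w1 + int_diff w2.
Proof.
move=> h1 h2; rewrite /int_diff.
under eq_Rintegral do rewrite mulrDr.
under [X in _ - X = _]eq_Rintegral do rewrite mulrDr.
rewrite !RintegralD//; [ring| | | |]; exact: integrable_indic_mul.
Qed.

Lemma int_diffZ c w : mbo w -> int_diff (fun t => c * w t) = c * int_diff w.
Proof.
move=> h; rewrite /int_diff mulrBr.
under eq_Rintegral do rewrite mulrCA.
under [X in _ - X = _]eq_Rintegral do rewrite mulrCA.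
by rewrite !RintegralZl//; exact: integrable_indic_mul.
Qed.

Variables (Dm : nat) (delta : R).
Hypothesis delta0 : 0 <= delta.
Hypothesis moments : forall a : 'I_d -> nat, (forall i, (a i <= Dm)%N) ->
  `|int_diff (monomial a)| <= delta.

(* Stands for: w is a polynomial of degree at most D in the coordinates y,    *)
(* whose coefficients have absolute values summing to at most A / delta.      *)
Definition close_upto (D : nat) (A : R) (w : T -> R) : Prop :=
  [/\ mbo w, 0 <= A & forall a : 'I_d -> nat, (forall i, (a i + D <= Dm)%N) ->
  `|int_diff (fun t => w t * monomial a t)| <= A].

Lemma close_upto_eq D A w1 w2 : w1 =1 w2 -> close_upto D A w1 -> close_upto D A w2.
Proof. by move=> /funext ->. Qed.

Lemma close_upto_le D D' A A' w : (D <= D')%N -> A <= A' ->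
  close_upto D A w -> close_upto D' A' w.
Proof.
move=> DD AA [h A0 hw]; split=> //; first exact: le_trans AA.
by move=> a ha; apply: le_trans (hw a _) AA => i; apply: leq_trans (ha i); rewrite leq_add2l.
Qed.

Lemma close_upto1 : close_upto 0 delta (fun=> 1).
Proof.
split=> //; first exact: measurable_bounded_on_cst.
move=> a ha; rewrite (_ : (fun t => _) = monomial a); last first.
  by apply/funext => t; rewrite mul1r.
by apply: moments => i; rewrite -[X in (X <= _)%N]addn0.
Qed.

Lemma close_uptoZ D A c w : close_upto D A w ->
  close_upto D (`|c| * A) (fun t => c * w t).
Proof.
move=> [h A0 hw]; split.
- by apply: measurable_bounded_onM => //; exact: measurable_bounded_on_cst.
- by rewrite mulr_ge0.
move=> a ha; rewrite (_ : (fun t => _) = (fun t => c * (w t * monomial a t))); last first.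
  by apply/funext => t; rewrite mulrA.
rewrite int_diffZ; last first.
  by apply: measurable_bounded_onM => //; exact: measurable_bounded_on_monomial.
by rewrite normrM ler_wpM2l// hw.
Qed.

Lemma close_uptoD D A1 A2 w1 w2 : close_upto D A1 w1 -> close_upto D A2 w2 ->
  close_upto D (A1 + A2) (fun t => w1 t + w2 t).
Proof.
move=> [h1 A10 hw1] [h2 A20 hw2]; split.
- exact: measurable_bounded_onD.
- by rewrite addr_ge0.
move=> a ha; rewrite (_ : (fun t => _) =
    (fun t => w1 t * monomial a t + w2 t * monomial a t)); last first.
  by apply/funext => t; rewrite mulrDl.
rewrite int_diffD; last 2 first.
- by apply: measurable_bounded_onM => //; exact: measurable_bounded_on_monomial.
- by apply: measurable_bounded_onM => //; exact: measurable_bounded_on_monomial.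
by rewrite (le_trans (ler_normD _ _))// lerD// ?hw1 ?hw2.
Qed.

Lemma close_upto_sum D (I : Type) (s : seq I) (A : I -> R) (w : I -> T -> R) :
    (forall i, close_upto D (A i) (w i)) ->
  close_upto D (\sum_(i <- s) A i) (fun t => \sum_(i <- s) w i t).
Proof.
move=> hw; elim: s => [|i s IH].
  rewrite big_nil; apply: (@close_upto_eq _ _ (fun=> 0)).
    by move=> t; rewrite big_nil.
  split=> //; first exact: measurable_bounded_on_cst.
  move=> a _; rewrite (_ : (fun t => _) = (fun t => 0 * monomial a t))//.
  by rewrite int_diffZ ?mul0r ?normr0//; exact: measurable_bounded_on_monomial.
rewrite big_cons; apply: (@close_upto_eq _ _ (fun t => w i t + \sum_(j <- s) w j t)).
  by move=> t; rewrite big_cons.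
exact: close_uptoD.
Qed.

(** Multiplication by a coordinate only raises one exponent of the test monomial; this is why
    [close_upto] tests against all monomials of leftover degree. *)
Lemma close_upto_coord D A w i : close_upto D A w ->
  close_upto D.+1 A (fun t => y i t * w t).
Proof.
move=> [h A0 hw]; split=> //.
  by apply: measurable_bounded_onM => //; exact: measurable_bounded_on_coord.
move=> a ha; pose a' j := if j == i then (a j).+1 else a j.
rewrite (_ : (fun t => _) = (fun t => w t * monomial a' t)); last first.
  apply/funext => t; rewrite [y i t * w t]mulrC -mulrA; congr (_ * _).
  rewrite /monomial [in LHS](bigD1 i)//= [in RHS](bigD1 i)//= /a' eqxx exprS mulrA.
  congr (_ * _).
  by apply: eq_bigr => j /negbTE ->.
apply: hw => j; rewrite /a'; case: ifP => [_|_].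
  by rewrite addSnnS.
by apply: leq_trans (ha j); rewrite leq_add2l.
Qed.

Variables (B : 'M[R]_d) (beta : R) (b Z : R) (z : 'I_d -> R).
Hypotheses (Bbeta : forall i j, `|B i j| <= beta).
Hypotheses (Z0 : 0 <= Z + 1) (zZ : forall i, `|z i| <= Z).

(** With [B] the inverse covariance and [z] the position of $x$ in the coordinates [y] of a cube of
    side [b], this is the Gaussian exponent $(x-v)\Sigma^{-1}(x-v)^T/2$. *)
Definition local_form (t : T) : R :=
  \sum_i \sum_j (b ^+ 2 * B i j / 2) * ((z i - y i t) * (z j - y j t)).

Definition local_rate : R := (d * d)%:R * (b ^+ 2 * beta / 2 * (Z + 1) ^+ 2).

Lemma close_upto_affine D A w i : close_upto D A w ->
  close_upto D.+1 ((Z + 1) * A) (fun t => (z i - y i t) * w t).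
Proof.
move=> hw; have [_ A0 _] := hw.
apply: (@close_upto_eq _ _ (fun t => z i * w t + (-1) * (y i t * w t))).
  by move=> t; ring.
rewrite mulrDl; apply: close_uptoD.
  apply: close_upto_le (close_uptoZ (z i) hw) => //.
  by rewrite ler_wpM2r.
have := close_uptoZ (-1) (close_upto_coord i hw).
by rewrite normrN1.
Qed.

(** [local_rate] bounds the sum of the absolute coefficients of [local_form]: [d * d] products, each
    with factor at most [b ^+ 2 * beta / 2] and two affine factors of coefficient sum at most
    [Z + 1]. *)
Lemma close_upto_form D A w : close_upto D A w ->
  close_upto D.+2 (local_rate * A) (fun t => local_form t * w t).
Proof.
move=> hw; have [_ A0 _] := hw.
pose c := b ^+ 2 * beta / 2 * ((Z + 1) * ((Z + 1) * A)).
apply: (@close_upto_eq _ _ (fun t => \sum_i \sum_j (b ^+ 2 * B i j / 2) *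
    ((z i - y i t) * ((z j - y j t) * w t)))).
  move=> t; rewrite /local_form mulr_suml; apply: eq_bigr => i _.
  by rewrite mulr_suml; apply: eq_bigr => j _; ring.
have -> : local_rate * A = \sum_(i < d) \sum_(j < d) c.
  rewrite !sumr_const !card_ord -mulrnA -mulr_natl /local_rate /c; ring.
apply: close_upto_sum => i; apply: close_upto_sum => j.
apply: close_upto_le (close_uptoZ _ (close_upto_affine i (close_upto_affine j hw))) => //.
rewrite ler_wpM2r// ?mulr_ge0//.
have -> : b ^+ 2 * B i j / 2 = (b ^+ 2 / 2) * B i j by ring.
have -> : b ^+ 2 * beta / 2 = (b ^+ 2 / 2) * beta by ring.
have c0 : 0 <= b ^+ 2 / 2 by rewrite divr_ge0// sqr_ge0.
by rewrite normrM (ger0_norm c0) ler_wpM2l.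
Qed.

Lemma close_upto_form_exp k : close_upto k.*2 (local_rate ^+ k * delta)
  (fun t => local_form t ^+ k).
Proof.
elim: k => [|k IH].
  rewrite expr0 mul1r; apply: close_upto_eq close_upto1 => t.
  by rewrite expr0.
rewrite doubleS exprS -mulrA; apply: close_upto_eq (close_upto_form IH) => t.
by rewrite exprS.
Qed.

Hypothesis lr0 : 0 <= local_rate.

(** The [k]-th power contributes [local_rate ^+ k * delta]; dividing by $k!$ and summing gives a
    partial sum of the exponential series. *)
Lemma int_diff_exp_poly K : (K.*2 <= Dm)%N ->
  `|int_diff (fun t => exp_poly K (- local_form t))| <= expR local_rate * delta.
Proof.
move=> KD.
have hc : close_upto K.*2 (\sum_(0 <= k < K) (local_rate ^+ k / k`!%:R * delta))
    (fun t => \sum_(0 <= k < K) (((-1) ^+ k / k`!%:R) * local_form t ^+ k)).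
  rewrite big_mkord.
  apply: (@close_upto_eq _ _ (fun t => \sum_(k < K) ((-1) ^+ k / k`!%:R) * local_form t ^+ k)).
    by move=> t; rewrite big_mkord.
  apply: close_upto_sum => k.
  apply: close_upto_le (close_uptoZ _ (close_upto_form_exp k)).
    by rewrite leq_double ltnW.
  rewrite normrM normrX normrN1 expr1n mul1r normfV (ger0_norm (ler0n _ _)).
  by rewrite mulrCA mulrA.
have [_ _ /(_ (fun=> 0%N))] := hc.
move=> /(_ (fun=> KD)).
rewrite (_ : (fun t => _ * _) = (fun t => exp_poly K (- local_form t))); last first.
  apply/funext => t; have -> : monomial (fun=> 0%N) t = 1.
    by apply: big1 => i _; exact: expr0.
  rewrite mulr1.
  by apply: eq_bigr => k _; rewrite [in RHS]exprNn mulrAC.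
move=> /le_trans; apply; rewrite -mulr_suml ler_wpM2r//.
exact: exp_poly_le_expR.
Qed.

(** The Taylor polynomial is handled by the matched moments and the remainder by [exp_poly_tail],
    once for [G] and once for [H], whence the factor 2. *)
Lemma int_diff_exp K (U : R) : (K.*2 <= Dm)%N ->
    (forall t, Q t -> 0 <= local_form t <= U) ->
  `|int_diff (fun t => expR (- local_form t))| <=
    expR local_rate * delta + 2 * expR (expR 1 * U - K%:R).
Proof.
move=> KD hU.
have mq : measurable_fun setT local_form.
  by have [[]] := close_upto_form_exp 1.
have bq : mbo (fun t => expR (- local_form t)).
  split; first by apply: measurableT_comp => //; exact: measurableT_comp.
  exists 1 => t Qt; have /andP[h _] := hU _ Qt.
  by rewrite ger0_norm ?expR_ge0// -expR0 ler_expR oppr_le0.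
have bp : mbo (fun t => exp_poly K (- local_form t)).
  split.
    apply: measurable_sum => k; apply: measurable_funM; last exact: measurable_cst.
    by apply: measurable_funX; exact: measurableT_comp.
  exists (1 + expR (expR 1 * U - K%:R)) => t Qt; have /andP[h h'] := hU _ Qt.
  have h1 := exp_poly_tail K h.
  have -> : exp_poly K (- local_form t) = expR (- local_form t) -
     (expR (- local_form t) - exp_poly K (- local_form t)) by ring.
  rewrite (le_trans (ler_normB _ _))// lerD//.
    by rewrite ger0_norm ?expR_ge0// -expR0 ler_expR oppr_le0.
  by rewrite (le_trans h1)// ler_expR lerD2r ler_wpM2l// expR_ge0.
have be : mbo (fun t => expR (- local_form t) + (-1) * exp_poly K (- local_form t)).
  apply: measurable_bounded_onD => //; apply: measurable_bounded_onM => //.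
  exact: measurable_bounded_on_cst.
have -> : int_diff (fun t => expR (- local_form t)) =
    int_diff (fun t => exp_poly K (- local_form t)) +
    int_diff (fun t => expR (- local_form t) + (-1) * exp_poly K (- local_form t)).
  rewrite -int_diffD//; congr int_diff; apply/funext => t; ring.
rewrite (le_trans (ler_normD _ _))// lerD ?int_diff_exp_poly//.
have small (P : probability T R) : `|\int[P]_t (\1_Q t * (expR (- local_form t) +
    (-1) * exp_poly K (- local_form t)))| <= expR (expR 1 * U - K%:R).
  have ib := integrable_indic_mul P be.
  apply: normr_Rintegral_le.
    by case: be => mbe _; apply: measurable_funM => //; exact: measurable_indic.
  move=> t; rewrite indicE; case: (boolP (t \in Q)) => [/set_mem Qt|_]; last first.
    by rewrite mul0r normr0 expR_ge0.
  have /andP[h h'] := hU _ Qt.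
  rewrite mul1r mulN1r (le_trans (exp_poly_tail _ h))// ler_expR lerD2r.
  by rewrite ler_wpM2l// expR_ge0.
by rewrite /int_diff (le_trans (ler_normB _ _))// mulr_natl mulr2n lerD.
Qed.

End moment_matching.

(** * Localisation: a mixture at a point depends on moments over neighbouring cubes *)

Section lattice_cubes.
Context {R : realType} (d : nat).
Implicit Types (G H : probability (borel_rV R d) R) (x : 'rV[R]_d).

Lemma Rintegral_sum dT (T : measurableType dT) (P : probability T R)
    (I : Type) (s : seq I) (f : I -> T -> R) :
    (forall i, P.-integrable setT (EFin \o f i)) ->
  P.-integrable setT (EFin \o (fun t => \sum_(i <- s) f i t)) /\
  \int[P]_t (\sum_(i <- s) f i t) = \sum_(i <- s) \int[P]_t f i t.
Proof.
move=> fi.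
have isum s' : P.-integrable setT (EFin \o (fun t => \sum_(i <- s') f i t)).
  rewrite (_ : EFin \o _ = (fun t => \sum_(i <- s') (f i t)%:E)%E); last first.
    by apply/funext => t /=; rewrite sumEFin.
  by apply: integrable_sum => // i _; exact: fi.
split=> //; elim: s => [|i s IH].
  rewrite big_nil; under eq_Rintegral do rewrite big_nil.
  by rewrite /Rintegral integral0.
rewrite big_cons -IH -RintegralD//.
by apply: eq_Rintegral => t _; rewrite big_cons.
Qed.

Lemma floor_bounds (r : R) : (Num.floor r)%:~R <= r < (Num.floor r)%:~R + 1.
Proof. by have := floor_itv r; rewrite intrD. Qed.

(** The floor makes the cubes half-open, so that they are disjoint and cover the space. *)
Definition lattice_cube (b : R) (m : 'I_d -> int) : set (borel_rV R d) :=
  [set v | forall i, Num.floor ((v : 'rV[R]_d) 0 i / b) = m i].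

Definition cube_coord (b : R) (m : 'I_d -> int) (i : 'I_d) (v : borel_rV R d) : R :=
  (v : 'rV[R]_d) 0 i / b - (m i)%:~R.

Definition cube_moment (b : R) (m : 'I_d -> int) (a : 'I_d -> nat) G : R :=
  \int[G]_v (\1_(lattice_cube b m) v * monomial (cube_coord b m) a v).

Lemma measurable_cube_coord b m i : measurable_fun setT (cube_coord b m i).
Proof.
apply: measurable_funB; last exact: measurable_cst.
by apply: measurable_funM; [exact: measurable_coord|exact: measurable_cst].
Qed.

Lemma measurable_lattice_cube b m : measurable (lattice_cube b m).
Proof.
have -> : lattice_cube b m = \bigcap_(i in [set: 'I_d])
    (cube_coord b m i) @^-1` `[0, 1[%classic.
  apply/seteqP; split=> v /= hv i => [_|].
    rewrite /= in_itv/= /cube_coord subr_ge0 ltrBlDl.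
    by have := floor_bounds ((v : 'rV[R]_d) 0 i / b); rewrite hv.
  have := hv i I; rewrite /= in_itv/= /cube_coord subr_ge0 ltrBlDl => h.
  by apply: floor_def; rewrite intrD.
apply: fin_bigcap_measurable => // i _; rewrite -[X in measurable X]setTI.
exact: measurable_cube_coord.
Qed.

Lemma cube_coord_itv b m v : lattice_cube b m v ->
  forall i, 0 <= cube_coord b m i v < 1.
Proof.
move=> hv i; rewrite /cube_coord subr_ge0 ltrBlDl.
by have := floor_bounds ((v : 'rV[R]_d) 0 i / b); rewrite hv.
Qed.

Lemma cube_coord_le1 b m v : lattice_cube b m v ->
  forall i, `|cube_coord b m i v| <= 1.
Proof.
by move=> /cube_coord_itv h i; have /andP[h0 h1] := h i; rewrite ger0_norm// ltW.
Qed.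

Lemma cube_moment_itv b m a G : 0 <= cube_moment b m a G <= 1.
Proof.
apply/andP; split.
  apply: Rintegral_ge0 => v _; rewrite indicE.
  case: (boolP (v \in _)) => [/set_mem vQ|_]; last by rewrite mul0r.
  rewrite mul1r prodr_ge0// => i _; rewrite exprn_ge0//.
  by have /andP[] := cube_coord_itv vQ i.
apply: (le_trans (ler_norm _)); apply: normr_Rintegral_le.
  apply: measurable_funM; first exact: measurable_indic (measurable_lattice_cube b m).
  by apply: measurable_prod => i _; apply: measurable_funX; exact: measurable_cube_coord.
move=> v; rewrite indicE.
case: (boolP (v \in _)) => [/set_mem vQ|_]; last by rewrite mul0r normr0.
rewrite mul1r normr_prod; apply: prodr_ile1 => i _.
by rewrite normr_ge0 normrX exprn_ile1// cube_coord_le1.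
Qed.

Definition neighbour (b : R) x (o : {ffun 'I_d -> 'I_3}) (i : 'I_d) : int :=
  Num.floor (x 0 i / b) + (o i : nat)%:Z - 1.

Lemma neighbour_inj b x o o' :
  (forall i, neighbour b x o i = neighbour b x o' i) -> o = o'.
Proof.
move=> h; apply/ffunP => i; apply/val_inj => /=.
by have := h i; rewrite /neighbour => /addIr /addrI [].
Qed.

(** The indicator of the union of the $3^d$ cubes around [x], written as a sum so that integrals
    split over the cubes. *)
Definition near_count (b : R) x (v : borel_rV R d) : R :=
  \sum_(o : {ffun 'I_d -> 'I_3}) \1_(lattice_cube b (neighbour b x o)) v.

(** Outside these cubes some floor index of [v] differs from that of [x] by at least 2, so that
    coordinate differs by at least [b]. *)
Lemma near_countP (b : R) x (v : borel_rV R d) : 0 < b ->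
  near_count b x v = 1 \/
  (near_count b x v = 0 /\ b ^+ 2 <= sqnorm (x - (v : 'rV[R]_d))).
Proof.
move=> b0.
have [[oo vo]|hn] := pselect (exists o, lattice_cube b (neighbour b x o) v).
  left; rewrite /near_count (bigD1 oo)//= indicE mem_set// big1 ?addr0// => o' oo'.
  rewrite indicE memNset// => vo'; move/eqP: oo'; apply.
  by apply: (@neighbour_inj b x) => i; rewrite -vo -vo'.
right; split.
  rewrite /near_count big1// => o _; rewrite indicE memNset// => vo.
  by apply: hn; exists o.
pose fx i := Num.floor (x 0 i / b); pose fv i := Num.floor ((v : 'rV[R]_d) 0 i / b).
have [i hi] : exists i, ~~ (fx i - 1 <= fv i <= fx i + 1).
  apply/existsP; rewrite -negb_forall; apply/negP => /forallP h; apply: hn.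
  exists [ffun i => inord (absz (fv i - fx i + 1))] => i.
  rewrite /neighbour ffunE -/(fx i) -/(fv i) /=.
  have /andP[h1 h2] := h i.
  have h3 : 0 <= fv i - fx i + 1 by lia.
  rewrite inordK; last by rewrite -ltz_nat gez0_abs//; lia.
  by rewrite gez0_abs//; lia.
apply: le_trans (sqr_coord_le_sqnorm _ i); rewrite !mxE.
have := floor_bounds (x 0 i / b); have := floor_bounds ((v : 'rV[R]_d) 0 i / b).
rewrite -/(fx i) -/(fv i) => /andP[v1 v2] /andP[x1 x2].
have xb : x 0 i = x 0 i / b * b by rewrite divfK// gt_eqF.
have vb : (v : 'rV[R]_d) 0 i = (v : 'rV[R]_d) 0 i / b * b by rewrite divfK// gt_eqF.
rewrite xb vb -mulrBl exprMn ler_peMl ?sqr_ge0//.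
rewrite -real_normK ?num_real// exprn_ege1//.
move: hi; rewrite negb_and -!ltNge => /orP[h|h].
  have h' : (fv i)%:~R + 2 <= (fx i)%:~R :> R by rewrite -(intrD _ (fv i) 2) ler_int; lia.
  by rewrite ger0_norm; lra.
have h' : (fx i)%:~R + 2 <= (fv i)%:~R :> R by rewrite -(intrD _ (fx i) 2) ler_int; lia.
by rewrite ler0_norm; lra.
Qed.

Section sup_bound.
Variables (klow kbar : R) (Sigma : 'M[R]_d).
Hypotheses (klow0 : 0 < klow) (kbar0 : 0 < kbar) (Sigma_sym : Sigma^T = Sigma).
Hypotheses (Sigma_ge : loewner_le klow%:M Sigma).
Hypotheses (Sigma_le : loewner_le Sigma kbar%:M).
Variables (G H : probability (borel_rV R d) R) (b : R) (b0 : 0 < b) (x : 'rV[R]_d).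
Variables (Dm K : nat) (delta : R).
Hypotheses (delta0 : 0 <= delta) (KD : (K.*2 <= Dm)%N).
Hypothesis moments_close : forall o a, (forall i, (a i <= Dm)%N) ->
  `|cube_moment b (neighbour b x o) a G - cube_moment b (neighbour b x o) a H| <= delta.

Let phi (v : borel_rV R d) := gauss_density Sigma (x - (v : 'rV[R]_d)).
Let cst := (Num.sqrt ((2 * pi) ^+ d * \det Sigma))^-1.
Let phim := gauss_sup d klow.

Let cst_itv : 0 <= cst <= phim.
Proof.
apply/andP; split; first by rewrite invr_ge0 sqrtr_ge0.
have := gauss_density_le_sup klow0 kbar0 Sigma_sym Sigma_ge Sigma_le (0 : 'rV[R]_d).
by rewrite /gauss_density !mul0mx mxE mul0r oppr0 expR0 mulr1.
Qed.

Let lf o := local_form (cube_coord b (neighbour b x o)) (invmx Sigma) b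
  (fun i => x 0 i / b - (neighbour b x o i)%:~R).

Let lfE o v : lf o v =
  ((x - (v : 'rV[R]_d)) *m invmx Sigma *m (x - (v : 'rV[R]_d))^T) 0 0 / 2.
Proof.
rewrite /lf /local_form mxE mulr_suml exchange_big; apply: eq_bigr => j _/=.
rewrite mxE !mulr_suml; apply: eq_bigr => i _; rewrite !mxE /cube_coord.
by field; rewrite gt_eqF.
Qed.

Let phiE o v : phi v = cst * expR (- lf o v).
Proof. by rewrite lfE. Qed.

Let z_le o i : `|x 0 i / b - (neighbour b x o i)%:~R| <= 2.
Proof.
have := floor_bounds (x 0 i / b); rewrite /neighbour => /andP[h1 h2].
rewrite intrB intrD.
have h3 : 0 <= ((o i : nat)%:Z)%:~R :> R by rewrite ler0z.
have h4 : ((o i : nat)%:Z)%:~R <= 2%:~R :> R by rewrite ler_int lez_nat -ltnS.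
by rewrite ler_norml; lra.
Qed.

Let lf_le o v : lattice_cube b (neighbour b x o) v ->
  0 <= lf o v <= 5 * d%:R * b ^+ 2 / klow.
Proof.
move=> hv; rewrite lfE.
have h1 := form_inv_ge klow0 kbar0 Sigma_sym Sigma_ge Sigma_le (x - (v : 'rV[R]_d)).
have h2 := form_inv_le klow0 Sigma_sym Sigma_ge (x - (v : 'rV[R]_d)).
have h0 : 0 <= sqnorm (x - (v : 'rV[R]_d)) / kbar by rewrite divr_ge0 ?sqnorm_ge0// ltW.
apply/andP; split; first by rewrite divr_ge0// (le_trans h0).
rewrite ler_pdivrMr// (le_trans h2)// mulrAC ler_pM2r ?invr_gt0//.
(* Coordinates of [x - v] are at most [3 * b], from 2 for [z] and 1 for [y]; the 9 of the square is
   rounded up to 10. *)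
rewrite (_ : 5 * d%:R * b ^+ 2 * 2 = d%:R * (10 * b ^+ 2)); last by ring.
apply: (@le_trans _ _ (d%:R * (3 * b) ^+ 2)); last first.
  by rewrite ler_wpM2l// exprMn ler_wpM2r ?sqr_ge0//; lra.
apply: sqnorm_le_coord => i; rewrite !mxE.
have hz := z_le o i; have hy := cube_coord_le1 hv i.
have -> : x 0 i - (v : 'rV[R]_d) 0 i = b * ((x 0 i / b - (neighbour b x o i)%:~R) -
   cube_coord b (neighbour b x o) i v).
  by rewrite /cube_coord; field; rewrite gt_eqF.
rewrite normrM (ger0_norm (ltW b0)) mulrC ler_wpM2r ?(ltW b0)//.
by rewrite (le_trans (ler_normB _ _))//; lra.
Qed.

Definition cell_rate : R := (d * d)%:R * (b ^+ 2 * klow^-1 / 2 * (2 + 1) ^+ 2).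

(** Split both mixtures into the $3^d$ cubes near [x] and the rest. The rest is at distance at least
    [b], where the Gaussian is small, for each of the two measures; each near cube is an instance of
    [int_diff_exp] with [Z] equal to 2. *)
Lemma mixture_diff_le :
  `|mixture_density G Sigma x - mixture_density H Sigma x| <=
  phim * (2 * expR (- (b ^+ 2 / (2 * kbar))) + (3 ^ d)%:R *
   (expR cell_rate * delta + 2 * expR (expR 1 * (5 * d%:R * b ^+ 2 / klow) - K%:R))).
Proof.
have phim0 : 0 < phim := gauss_sup_gt0 d klow0.
have mphi : measurable_fun setT phi.
  apply: (measurableT_comp (measurable_gauss_density Sigma)).
  apply: (measurableT_comp (@measurable_subrV R d) (g := fun t : borel_rV R d => (x : borel_rV R d, t))).
  exact: measurable_pair1.
have phi0 v : 0 <= phi v by exact/ltW/(gauss_density_gt0 klow0 Sigma_sym Sigma_ge).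
pose far (v : borel_rV R d) := 1 - near_count b x v.
pose Q o := lattice_cube b (neighbour b x o).
have mQ o : measurable (Q o) := measurable_lattice_cube b (neighbour b x o).
have mfar : measurable_fun setT (fun v => far v * phi v).
  apply: measurable_funM => //; apply: measurable_funB => //.
  by apply: measurable_sum => o; exact: measurable_indic (mQ o).
have far_le v : `|far v * phi v| <= phim * expR (- (b ^+ 2 / (2 * kbar))).
  rewrite /far; have [->|[-> hv]] := near_countP x v b0.
    by rewrite subrr mul0r normr0 mulr_ge0 ?expR_ge0// ltW.
  rewrite subr0 mul1r ger0_norm//.
  apply: (le_trans (gauss_density_le klow0 kbar0 Sigma_sym Sigma_ge Sigma_le _)).
  rewrite ler_wpM2l ?(ltW phim0)// ler_expR lerN2.
  by apply: ler_wpM2r => //; rewrite invr_ge0 mulr_ge0//; exact: ltW.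
have mboQ o : measurable_bounded_on (Q o) (fun v => expR (- lf o v)).
  split.
    apply: measurableT_comp => //; apply: measurableT_comp => //.
    apply: measurable_sum => i; apply: measurable_sum => j; apply: measurable_funM => //.
    by apply: measurable_funM; apply: measurable_funB => //; exact: measurable_cube_coord.
  exists 1 => w Qw; have /andP[h _] := lf_le Qw.
  by rewrite ger0_norm ?expR_ge0// -expR0 ler_expR oppr_le0.
have intQ (P : probability (borel_rV R d) R) o :
    P.-integrable setT (EFin \o (fun v => \1_(Q o) v * phi v)).
  apply: (@bounded_integrable _ _ _ P _ phim).
    by apply: measurable_funM => //; exact: measurable_indic (mQ o).
  move=> w; rewrite normrM (ger0_norm (phi0 w)) -[leRHS]mul1r.
  rewrite ler_pM//; last exact: (gauss_density_le_sup klow0 kbar0 Sigma_sym Sigma_ge Sigma_le).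
  by rewrite indicE; case: (w \in _); rewrite ?normr1 ?normr0.
have decomp (P : probability (borel_rV R d) R) : mixture_density P Sigma x =
    \sum_o \int[P]_v (\1_(Q o) v * phi v) + \int[P]_v (far v * phi v).
  have [isum <-] := Rintegral_sum (index_enum {ffun 'I_d -> 'I_3}) (intQ P).
  rewrite -RintegralD//; last first.
    exact: bounded_integrable mfar far_le.
  apply: eq_Rintegral => v _; rewrite -mulr_suml -mulrDl.
  by rewrite -/(near_count b x v) /far [_ + (1 - _)]addrC subrK mul1r.
rewrite !decomp.
have -> : \sum_o \int[G]_v (\1_(Q o) v * phi v) + \int[G]_v (far v * phi v) -
  (\sum_o \int[H]_v (\1_(Q o) v * phi v) + \int[H]_v (far v * phi v)) =
  \sum_o (\int[G]_v (\1_(Q o) v * phi v) - \int[H]_v (\1_(Q o) v * phi v)) +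
  (\int[G]_v (far v * phi v) - \int[H]_v (far v * phi v)).
  rewrite sumrB; ring.
rewrite (le_trans (ler_normD _ _))// addrC mulrDr lerD//.
  rewrite (le_trans (ler_normB _ _))//.
  rewrite (_ : phim * (2 * _) = phim * expR (- (b ^+ 2 / (2 * kbar))) +
    phim * expR (- (b ^+ 2 / (2 * kbar)))); last by ring.
  by rewrite lerD//; exact: normr_Rintegral_le.
rewrite (le_trans (ler_norm_sum _ _ _))//.
have -> : (3 ^ d)%:R = \sum_(o : {ffun 'I_d -> 'I_3}) 1 :> R.
  by rewrite sumr_const card_ffun !card_ord.
rewrite mulr_suml mulr_sumr; apply: ler_sum => o _; rewrite mul1r.
have -> : \int[G]_v (\1_(Q o) v * phi v) - \int[H]_v (\1_(Q o) v * phi v) =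
   int_diff G H (Q o) (fun v => cst * expR (- lf o v)).
  rewrite /int_diff; congr (_ - _); apply: eq_Rintegral => v _; by rewrite (phiE o).
have /andP[c0 c1] := cst_itv.
rewrite int_diffZ// normrM (ger0_norm c0) ler_pM//.
have my i : measurable_fun setT (cube_coord b (neighbour b x o) i).
  exact: measurable_cube_coord.
have yQ v : Q o v -> forall i, `|cube_coord b (neighbour b x o) i v| <= 1.
  by move=> Qv i; exact: cube_coord_le1.
have BB i j : `|invmx Sigma i j| <= klow^-1.
  exact: (norm_inv_entry_le klow0 Sigma_sym Sigma_ge).
have lr0 : 0 <= local_rate d klow^-1 b 2.
  by rewrite /local_rate !mulr_ge0// ?exprn_ge0// ?invr_ge0 ltW.
exact: (int_diff_exp (mQ o) my yQ delta0 (@moments_close o) BB _ (z_le o) lr0 KD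
  (fun v Qv => lf_le Qv)).
Qed.

End sup_bound.
End lattice_cubes.

(** * Weights and tails *)

Section cauchy_weight.
Context {R : realType} (d : nat).
Variables (S : set 'rV[R]_d) (S0 : S !=set0) (M : R) (M0 : 0 < M).
Variables (rho : R) (s : seq 'rV[R]_d) (rhoM : 2 * rho <= M).
Hypothesis s_net : forall x, S x -> exists2 y, y \in s & norm2 (x - y) <= rho.

(** Integrable with explicit integral, yet decaying only polynomially away from [S]: dominating a
    bounded density by it costs only a logarithm of the distance. *)
Definition cauchy_weight (x : borel_rV R d) : R :=
  \sum_(y <- s) \prod_(i < d) (1 + (((x : 'rV[R]_d) - y) 0 i / (2 * M)) ^+ 2)^-1.

Let kernel (u : R) : R := (1 + (u / (2 * M)) ^+ 2)^-1.

Let kernel_ge0 u : 0 <= kernel u.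
Proof. by rewrite invr_ge0 addr_ge0// sqr_ge0. Qed.

Let mkernel : measurable_fun setT kernel.
Proof.
apply: continuous_measurable_fun => x; apply: cvgV.
  by rewrite gt_eqF// ltr_pwDl// sqr_ge0.
apply: cvgD; first exact: cvg_cst.
rewrite expr2; under eq_fun do rewrite expr2.
by apply: cvgM; apply: cvgM; (try exact: cvg_id); exact: cvg_cst.
Qed.

Let mprod : measurable_fun setT (fun x : borel_rV R d =>
  \prod_(i < d) kernel ((x : 'rV[R]_d) 0 i)).
Proof.
apply: measurable_prod => i _.
by apply: (measurableT_comp mkernel); exact: measurable_coord.
Qed.

Let mterm (y : 'rV[R]_d) : measurable_fun setT (fun x : borel_rV R d =>
  \prod_(i < d) (1 + (((x : 'rV[R]_d) - y) 0 i / (2 * M)) ^+ 2)^-1).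
Proof. exact: (measurableT_comp mprod (measurable_shift_rV y)). Qed.

Lemma measurable_cauchy_weight : measurable_fun setT cauchy_weight.
Proof. by apply: measurable_sum => y; exact: mterm. Qed.

Lemma cauchy_weight_ge0 x : 0 <= cauchy_weight x.
Proof.
by apply: sumr_ge0 => y _; apply: prodr_ge0 => i _; exact: kernel_ge0.
Qed.

Lemma integral_cauchy_weight :
  (\int[lebesgue_rV d]_x (cauchy_weight x)%:E =
   ((size s)%:R * (pi * (2 * M)) ^+ d)%:E)%E.
Proof.
rewrite /cauchy_weight; elim: s => [|y s' IH].
  by rewrite mul0r; under eq_integral do rewrite big_nil; rewrite integral0.
under eq_integral do rewrite big_cons.
rewrite ge0_integral_EFinD//; last 3 first.
- by apply: measurable_sum => y'; exact: mterm.
- by move=> x; apply: prodr_ge0 => i _; exact: kernel_ge0.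
- by move=> x; apply: sumr_ge0 => y' _; apply: prodr_ge0 => i _; exact: kernel_ge0.
rewrite IH (@integral_rV_shift R d y (fun x : borel_rV R d =>
  (\prod_(i < d) kernel ((x : 'rV[R]_d) 0 i))%:E)); last 2 first.
- exact/measurable_EFinP.
- by move=> x; rewrite lee_fin prodr_ge0.
rewrite (@integral_rV_prod R d (fun=> kernel) (fun=> pi * (2 * M)))//; last first.
  by move=> i; apply: integral_cauchy_kernel; rewrite mulr_gt0.
by rewrite prodr_const card_ord -EFinD /= -[(size s').+1%:R]natr1; congr EFin; ring.
Qed.

(** One summand is enough: some net point is within [2 * E] of [x], so each kernel is at least
    $1/(1+(E/M)^2)\ge\frac12(E/M)^{-2}$. *)
Lemma cauchy_weight_ge (x : 'rV[R]_d) (E : R) : M <= E -> dist_set S x <= E ->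
  (2^-1 ^+ d) * ((E / M) ^+ (2 * d))^-1 <= cauchy_weight x.
Proof.
move=> ME dE; have E0 : 0 < E := lt_le_trans M0 ME.
have [z Sz xz] : exists2 z, S z & norm2 (x - z) < dist_set S x + M / 2.
  by apply: dist_set_ltP => //; rewrite ltrDl divr_gt0.
have [y ys zy] := s_net Sz.
have xy : norm2 (x - y) <= 2 * E.
  rewrite -(subrKA z) (le_trans (ler_norm2D _ _))//.
  apply: (le_trans (lerD (ltW xz) zy)).
  by move: dE ME rhoM; lra.
rewrite /cauchy_weight (perm_big _ (perm_to_rem ys)) big_cons/=.
apply: (@le_trans _ _ (\prod_(i < d) (1 + ((x - y) 0 i / (2 * M)) ^+ 2)^-1)); last first.
  rewrite lerDl; apply: sumr_ge0 => y' _; apply: prodr_ge0 => i _; exact: kernel_ge0.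
rewrite exprM -exprVn -exprMn -[X in _ ^+ X](card_ord d) -prodr_const.
apply: ler_prod => i _; apply/andP; split.
  by rewrite mulr_ge0// invr_ge0 exprn_ge0// divr_ge0// ltW.
rewrite -invfM lef_pV2 ?posrE; last 2 first.
- by rewrite mulr_gt0// exprn_gt0// divr_gt0.
- by rewrite ltr_pwDl// sqr_ge0.
have h1 : 1 <= (E / M) ^+ 2.
  by apply: exprn_ege1; rewrite ler_pdivlMr ?mul1r.
have h2 : ((x - y) 0 i / (2 * M)) ^+ 2 <= (E / M) ^+ 2.
  rewrite -(real_normK (num_real (_ / _))) ler_pXn2r// ?nnegrE ?divr_ge0 ?(ltW E0) ?(ltW M0)//.
  rewrite normrM normfV (gtr0_norm (_ : 0 < 2 * M)) ?mulr_gt0//.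
  rewrite ler_pdivrMr ?mulr_gt0//.
  have -> : E / M * (2 * M) = 2 * E by field; rewrite gt_eqF.
  exact: le_trans (coord_le_norm2 _ _) xy.
lra.
Qed.

End cauchy_weight.

(** * Moments of the distance to the set under a Gaussian mixture *)

Section gaussian_tail.
Context {R : realType} (d : nat).
Variables (klow kbar : R) (Sigma : 'M[R]_d).
Hypotheses (klow0 : 0 < klow) (kbar0 : 0 < kbar) (Sigma_sym : Sigma^T = Sigma).
Hypotheses (Sigma_ge : loewner_le klow%:M Sigma).
Hypotheses (Sigma_le : loewner_le Sigma kbar%:M).
Hypothesis gauss1 : (\int[lebesgue_rV d]_x (gauss_density Sigma x)%:E = 1)%E.

Definition tail_const : R := gauss_sup d klow * (pi * Num.sqrt (20 * kbar)) ^+ d.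

Lemma tail_const_ge0 : 0 <= tail_const.
Proof.
by rewrite mulr_ge0 ?(ltW (gauss_sup_gt0 d klow0))// exprn_ge0// mulr_ge0// pi_ge0.
Qed.

Let gauss_ge0 x : 0 <= gauss_density Sigma x.
Proof. exact/ltW/(gauss_density_gt0 klow0 Sigma_sym Sigma_ge). Qed.

(** Since $\frac12-\frac9{20}=\frac1{20}$, the factor $e^{-|x|^2/(20\bar k)}$ remains;
    $e^{u^2}\ge1+u^2$ in each coordinate majorises it by Cauchy kernels. *)
Lemma integral_gauss_exp_le :
  (\int[lebesgue_rV d]_x (gauss_density Sigma x *
     expR (9 / 20 * sqnorm (x : 'rV[R]_d) / kbar))%:E <= tail_const%:E)%E.
Proof.
have s0 : 0 < Num.sqrt (20 * kbar) by rewrite sqrtr_gt0 mulr_gt0.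
pose ker (u : R) : R := (1 + (u / Num.sqrt (20 * kbar)) ^+ 2)^-1.
have ker0 u : 0 <= ker u by rewrite invr_ge0 addr_ge0// sqr_ge0.
have mker : measurable_fun setT ker.
  apply: continuous_measurable_fun => x; apply: cvgV.
    by rewrite gt_eqF// ltr_pwDl// sqr_ge0.
  apply: cvgD; first exact: cvg_cst.
  rewrite expr2; under eq_fun do rewrite expr2.
  by apply: cvgM; apply: cvgM; (try exact: cvg_id); exact: cvg_cst.
have mprod : measurable_fun setT (fun x : borel_rV R d =>
    \prod_(i < d) ker ((x : 'rV[R]_d) 0 i)).
  apply: measurable_prod => i _.
  by apply: (measurableT_comp mker); exact: measurable_coord.
have phim0 := gauss_sup_gt0 d klow0.
apply: (@le_trans _ _ (\int[lebesgue_rV d]_x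
   (gauss_sup d klow * \prod_(i < d) ker ((x : 'rV[R]_d) 0 i))%:E)%E).
  apply: ge0_le_integral_EFin.
  - apply: measurable_funM; first exact: measurable_gauss_density.
    apply: measurableT_comp => //; apply: measurable_funM => //.
    by apply: measurable_funM => //; exact: measurable_sqnorm.
  - exact: measurable_funM.
  - by move=> x; rewrite mulr_ge0// expR_ge0.
  move=> x; apply: (@le_trans _ _ (gauss_sup d klow *
      (expR (- (sqnorm (x : 'rV[R]_d) / (2 * kbar))) *
       expR (9 / 20 * sqnorm (x : 'rV[R]_d) / kbar)))).
    rewrite mulrA ler_wpM2r ?expR_ge0//.
    exact: (gauss_density_le klow0 kbar0 Sigma_sym Sigma_ge Sigma_le).
  rewrite ler_wpM2l ?(ltW phim0)// -expRD.
  have -> : - (sqnorm (x : 'rV[R]_d) / (2 * kbar)) + 9 / 20 * sqnorm (x : 'rV[R]_d) / kbar =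
     - (\sum_(i < d) ((x : 'rV[R]_d) 0 i / Num.sqrt (20 * kbar)) ^+ 2).
    under eq_bigr do rewrite exprMn exprVn sqr_sqrtr ?mulr_ge0 ?(ltW kbar0)//.
    rewrite -mulr_suml -/(sqnorm (x : 'rV[R]_d)); field; rewrite gt_eqF//.
  rewrite -sumrN expR_sum; apply: ler_prod => i _.
  rewrite expR_ge0 /= expRN lef_pV2 ?posrE ?expR_gt0 ?ltr_pwDl ?sqr_ge0//.
  exact: expR_ge1Dx.
rewrite ge0_integral_EFinZ//; last 2 first.
- exact: ltW.
- by move=> x; exact: prodr_ge0.
rewrite (@integral_rV_prod R d (fun=> ker) (fun=> pi * Num.sqrt (20 * kbar)))//; last first.
  by move=> i; exact: integral_cauchy_kernel.
by rewrite prodr_const card_ord -EFinM lee_fin.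
Qed.

Variables (S : set 'rV[R]_d) (S0 : S !=set0) (M L : R) (M0 : 0 < M).
Hypotheses (ML : 10 * kbar * L <= M ^+ 2) (L0 : 0 < L) (dL : 4 * d.+1%:R <= L ^+ 2).

Let r : R := d.+1%:R / (2 * L).

Definition excess (x : borel_rV R d) : R :=
  if M < dist_set S x then (dist_set S x / M) `^ r else 0.

Lemma excess_ge0 x : 0 <= excess x.
Proof. by rewrite /excess; case: ifP => // _; exact: powR_ge0. Qed.

Lemma measurable_excess : measurable_fun setT excess.
Proof.
apply: measurable_fun_ifT => //.
- apply: measurable_fun_ltr => //; exact: measurable_dist_set.
- apply: (measurableT_comp (measurable_powR r)).
  by apply: measurable_funM => //; exact: measurable_dist_set.
Qed.

(** Either the latent [t] accounts for half of the distance, and the base $2\mathfrak d_S(t)/M\ge1$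
    allows raising the exponent from [r] to [q]; or the noise does, and then $u=2|z|/M\ge1$
    satisfies $u^r\le e^{Lu^2/8}$, whereas [ML] makes the Gaussian exponent at least $\frac98Lu^2\ge
    L+\frac18Lu^2$. *)
Lemma excess_le (z t : 'rV[R]_d) (q : R) : r <= q ->
  excess (z + t : 'rV[R]_d) <=
  (2 * dist_set S t / M) `^ q + expR (- L) * expR (9 / 20 * sqnorm z / kbar).
Proof.
move=> rq; rewrite /excess; case: ifPn => [MD|_]; last first.
  by rewrite addr_ge0 ?powR_ge0// mulr_ge0// expR_ge0.
have r0 : 0 < r by rewrite divr_gt0// mulr_gt0.
set D := dist_set S _ in MD *.
have D0 : 0 < D := lt_trans M0 MD.
have Dle : D <= dist_set S t + norm2 z by rewrite /D addrC; exact: dist_setD.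
have DM0 : 0 <= D / M by rewrite divr_ge0// ltW.
have tM0 : 0 <= 2 * dist_set S t / M.
  by rewrite divr_ge0 ?(ltW M0)// mulr_ge0// dist_set_ge0.
have [h|h] := leP D (2 * dist_set S t).
  apply: (@le_trans _ _ ((2 * dist_set S t / M) `^ q)); last first.
    by rewrite lerDl mulr_ge0// expR_ge0.
  apply: (@le_trans _ _ ((2 * dist_set S t / M) `^ r)).
    apply: ge0_ler_powR; rewrite ?nnegrE ?(ltW r0)//.
    by rewrite ler_pM2r ?invr_gt0.
  apply: ler_powR => //.
  by rewrite ler_pdivlMr// mul1r (le_trans (ltW MD)).
have hz : D <= 2 * norm2 z by lra.
apply: (@le_trans _ _ (expR (- L) * expR (9 / 20 * sqnorm z / kbar))); last first.
  by rewrite lerDr powR_ge0.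
pose u := 2 * norm2 z / M.
have u1 : 1 <= u by rewrite ler_pdivlMr// mul1r (le_trans (ltW MD)).
have u0 : 0 < u := lt_le_trans ltr01 u1.
apply: (@le_trans _ _ (u `^ r)).
  apply: ge0_ler_powR; rewrite ?nnegrE ?(ltW r0) ?(ltW u0)//.
  by rewrite ler_pM2r ?invr_gt0.
rewrite /powR gt_eqF// -expRD ler_expR.
have lu : ln u <= u ^+ 2.
  have := expR_ge1Dx (ln u); rewrite lnK ?posrE// => h1.
  nra.
have sq : sqnorm z = u ^+ 2 * M ^+ 2 / 4.
  by rewrite -sqr_norm2 /u; field; rewrite gt_eqF.
have r8 : r <= L / 8.
  by rewrite /r ler_pdivrMr ?mulr_gt0//; move: dL; lra.
have h1 : 9 / 8 * u ^+ 2 * L <= 9 / 20 * sqnorm z / kbar.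
  rewrite sq ler_pdivlMr//.
  have -> : 9 / 20 * (u ^+ 2 * M ^+ 2 / 4) = 9 / 80 * u ^+ 2 * M ^+ 2 by field.
  have -> : 9 / 8 * u ^+ 2 * L * kbar = 9 / 80 * u ^+ 2 * (10 * kbar * L) by field.
  by rewrite ler_wpM2l// mulr_ge0// sqr_ge0.
have h2 : r * ln u <= L / 8 * u ^+ 2.
  apply: (@le_trans _ _ (r * u ^+ 2)); first by rewrite ler_wpM2l// ltW.
  by rewrite ler_wpM2r// sqr_ge0.
have u2 : 1 <= u ^+ 2 by rewrite exprn_ege1.
nra.
Qed.

Lemma integral_excess_le (G : probability (borel_rV R d) R) (q : R) : r <= q ->
  (\int[lebesgue_rV d]_x (mixture_density G Sigma x * excess x)%:E <=
   \int[G]_t ((2 * dist_set S (t : 'rV[R]_d) / M) `^ q)%:E + (expR (- L) * tail_const)%:E)%E.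
Proof.
move=> rq.
under eq_integral do rewrite EFinM.
rewrite (integral_mixture klow0 kbar0 Sigma_sym Sigma_ge Sigma_le G (g := fun x => (excess x)%:E)); last 2 first.
- by apply/measurable_EFinP; exact: measurable_excess.
- by move=> x; rewrite lee_fin excess_ge0.
pose A (t : borel_rV R d) := (2 * dist_set S (t : 'rV[R]_d) / M) `^ q.
have mA : measurable_fun setT A.
  apply: (measurableT_comp (measurable_powR q)); apply: measurable_funM => //.
  by apply: measurable_funM => //; exact: measurable_dist_set.
have A0 t : 0 <= A t by exact: powR_ge0.
pose c := expR (- L) * tail_const.
have c0 : 0 <= c by rewrite mulr_ge0 ?expR_ge0 ?tail_const_ge0.
rewrite -(integral_prob_cst G c%:E).
rewrite -(ge0_integral_EFinD G mA (measurable_cst c))//.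
apply: ge0_le_integral => //.
- by move=> t _; apply: integral_ge0 => x _; rewrite -EFinM lee_fin mulr_ge0// excess_ge0.
- apply: (@measurable_fun_fubini_tonelli_G _ _ _ _ _ (lebesgue_rV d)
    (fun p : borel_rV R d * borel_rV R d => ((gauss_density Sigma p.1)%:E *
      (excess ((p.1 : 'rV[R]_d) + (p.2 : 'rV[R]_d) : 'rV[R]_d))%:E)%E)).
    have madd : measurable_fun setT (fun p : borel_rV R d * borel_rV R d =>
        (p.1 : 'rV[R]_d) + (p.2 : 'rV[R]_d) : borel_rV R d).
      apply: measurable_fun_rV => j; under eq_fun do rewrite !mxE.
      apply: measurable_funD.
        by apply: (measurableT_comp (measurable_coord j)); exact: measurable_fst.
      by apply: (measurableT_comp (measurable_coord j)); exact: measurable_snd.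
    have mexc := measurableT_comp measurable_excess madd.
    have mphi1 : measurable_fun setT (fun p : borel_rV R d * borel_rV R d =>
        gauss_density Sigma p.1).
      exact: (measurableT_comp (measurable_gauss_density Sigma) measurable_fst).
    by apply: emeasurable_funM; apply/measurable_EFinP.
  by move=> p; apply: mule_ge0; rewrite lee_fin ?excess_ge0 ?gauss_ge0.
- by apply/measurable_EFinP; exact: measurable_funD.
move=> t _.
pose g (x : borel_rV R d) := expR (9 / 20 * sqnorm (x : 'rV[R]_d) / kbar).
have mg : measurable_fun setT g.
  apply: measurableT_comp => //; apply: measurable_funM => //.
  by apply: measurable_funM => //; exact: measurable_sqnorm.
have g0 x : 0 <= g x by exact: expR_ge0.
have mphi := measurable_gauss_density Sigma.
have mphig : measurable_fun setT (fun x : borel_rV R d => gauss_density Sigma x * g x).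
  exact: measurable_funM.
have maddt : measurable_fun setT (fun x : borel_rV R d =>
    (x : 'rV[R]_d) + (t : 'rV[R]_d) : borel_rV R d).
  have := @measurable_shift_rV R d (- (t : 'rV[R]_d)).
  by under eq_fun do rewrite opprK.
have mexct : measurable_fun setT (fun x : borel_rV R d =>
    excess ((x : 'rV[R]_d) + (t : 'rV[R]_d) : 'rV[R]_d)).
  exact: (measurableT_comp measurable_excess maddt).
have mAphi : measurable_fun setT (fun x : borel_rV R d => A t * gauss_density Sigma x).
  by apply: measurable_funM; first exact: measurable_cst.
have mLphig : measurable_fun setT (fun x : borel_rV R d =>
    expR (- L) * (gauss_density Sigma x * g x)).
  by apply: measurable_funM; first exact: measurable_cst.
apply: (@le_trans _ _ (\int[lebesgue_rV d]_x (A t * gauss_density Sigma x +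
    expR (- L) * (gauss_density Sigma x * g x))%:E)%E).
  under eq_integral do rewrite -EFinM.
  apply: ge0_le_integral_EFin.
  - exact: measurable_funM.
  - exact: measurable_funD.
  - by move=> x; rewrite mulr_ge0// excess_ge0.
  move=> x; apply: (le_trans (ler_wpM2l (gauss_ge0 x) (excess_le x t rq))).
  by rewrite mulrDr -/(A t) [A t * _]mulrC lerD2l mulrCA.
have phig0 (x : borel_rV R d) : 0 <= gauss_density Sigma x * g x by rewrite mulr_ge0.
have Aphi0 (x : borel_rV R d) : 0 <= A t * gauss_density Sigma x by rewrite mulr_ge0.
have Lphig0 (x : borel_rV R d) : 0 <= expR (- L) * (gauss_density Sigma x * g x).
  by rewrite mulr_ge0// expR_ge0.
rewrite (ge0_integral_EFinD _ mAphi mLphig Aphi0 Lphig0).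
rewrite (ge0_integral_EFinZ _ (A0 t) mphi gauss_ge0).
rewrite (ge0_integral_EFinZ _ (expR_ge0 _) mphig phig0).
rewrite gauss1 mule1 EFinD leeD2l// /c EFinM lee_wpmul2l// ?lee_fin ?expR_ge0//.
exact: integral_gauss_exp_le.
Qed.

End gaussian_tail.

(** * Finite codes for the mixing measures *)

Lemma neighbour_offset (fx fy : int) (o P : nat) :
    fx - fy + 1 <= P%:Z -> - P%:Z <= fx - fy - 1 -> (o <= 2)%N ->
  (0 <= fx + o%:Z - 1 - fy + P%:Z) /\ (fx + o%:Z - 1 - fy + P%:Z < (P.*2.+1)%:Z).
Proof. by move=> h1 h2 h3; split; lia. Qed.

Lemma int_diff_le (R : realType) (x y : R) (fx fy : int) (P : nat) :
    fx%:~R <= x < fx%:~R + 1 -> fy%:~R <= y < fy%:~R + 1 -> `|x - y| < P%:R - 2 ->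
  (fx - fy + 1 <= P%:Z) /\ (- P%:Z <= fx - fy - 1).
Proof.
move=> /andP[x1 x2] /andP[y1 y2]; rewrite ltr_norml => /andP[h1 h2].
by split; rewrite -(ler_int R) ?intrD ?intrB ?intrN; lra.
Qed.

Section codes.
Context {R : realType} (d : nat).
Variables (klow kbar : R).
Hypotheses (klow0 : 0 < klow) (kbar0 : 0 < kbar).

(** At $b^2=6\bar kL$, [kappa_form * L] is the [cell_rate], and [(kappa_deg - 3) * L] is $e$ times
    the bound on [local_form] over the near cubes. *)
Definition kappa_form : R := 27 * (d * d)%:R * kbar / klow.
Definition kappa_deg : R := 30 * expR 1 * d%:R * kbar / klow + 3.
Definition code_const : R :=
  (11 / Num.sqrt (6 * kbar)) ^+ d * (2 * kappa_deg + 3) ^+ d * (kappa_form + 4).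

Let kf0 : 0 <= kappa_form.
Proof. by rewrite divr_ge0 ?(ltW klow0)// !mulr_ge0// ltW. Qed.

Let kd0 : 3 <= kappa_deg.
Proof.
by rewrite lerDr divr_ge0 ?(ltW klow0)// !mulr_ge0 ?expR_ge0// ltW.
Qed.

Lemma code_const_ge0 : 0 <= code_const.
Proof.
by rewrite !mulr_ge0 ?exprn_ge0 ?divr_ge0 ?sqrtr_ge0 ?addr_ge0// mulr_ge0// (le_trans _ kd0).
Qed.

Variables (L M : R) (S : set 'rV[R]_d) (S0 : S !=set0) (rho : R) (s : seq 'rV[R]_d).
Hypotheses (L1 : 1 <= L) (ML : 6 * kbar * L <= M ^+ 2) (M0 : 0 < M).
Hypotheses (rhoM : 2 * rho <= M).
Hypothesis s_net : forall x, S x -> exists2 y, y \in s & norm2 (x - y) <= rho.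
Hypothesis L_large : gauss_sup d klow * (2 + 3 * (3 ^ d)%:R) <= L.

(** The parameters give each error term of [mixture_diff_le] a factor $e^{-3L}$: [b] does so for the
    far part, [K] for the Taylor remainder and [delta] for the moments. [P0] is large enough for
    offsets from the cell of a net point [y] to reach every neighbour cell of every [x] within
    [2 * M] of [y]; [Rq] counts the rounding levels of a number in $[0,1]$ at precision [delta]. *)
Let b : R := Num.sqrt (6 * kbar * L).
Let L0 : 0 < L. Proof. exact: lt_le_trans L1. Qed.
Let b0 : 0 < b. Proof. by rewrite sqrtr_gt0 !mulr_gt0. Qed.
Let b2 : b ^+ 2 = 6 * kbar * L. Proof. by rewrite sqr_sqrtr// !mulr_ge0// ltW. Qed.
Let bM : b <= M.
Proof. by rewrite -(@ler_pXn2r _ 2)// ?nnegrE ?b2// ltW. Qed.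

Let K : nat := (Num.trunc (kappa_deg * L)).+1.
Let Dm : nat := K.*2.
Let delta : R := expR (- ((kappa_form + 3) * L)).
Let P0 : nat := (Num.trunc (2 * M / b) + 3)%N.
Let Rq : nat := (Num.trunc delta^-1).+1.

Definition code_cell (y : 'rV[R]_d) (p : {ffun 'I_d -> 'I_(P0.*2.+1)}) (i : 'I_d) : int :=
  Num.floor (y 0 i / b) + (p i : nat)%:Z - P0%:Z.

Local Notation code_index :=
  ('I_(size s) * {ffun 'I_d -> 'I_(P0.*2.+1)} * {ffun 'I_d -> 'I_Dm.+1})%type.
Local Notation code_type := {ffun code_index -> 'I_Rq}.

(** Moments lie in $[0,1]$, so the rounded value is below [Rq] and [inord] returns it unchanged. *)
Definition code (G : probability (borel_rV R d) R) : code_type :=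
  [ffun J : code_index => inord (Num.trunc
    (cube_moment b (code_cell s`_(J.1.1) J.1.2) (fun i => J.2 i) G / delta))].

Let delta0 : 0 < delta. Proof. exact: expR_gt0. Qed.

Lemma code_moment_close G H (j : 'I_(size s)) p (a : 'I_d -> nat) :
    code G = code H -> (forall i, (a i <= Dm)%N) ->
  `|cube_moment b (code_cell s`_j p) a G - cube_moment b (code_cell s`_j p) a H| <= delta.
Proof.
move=> GH aD.
have := congr1 (fun f : code_type => f (j, p, [ffun i => inord (a i)])) GH.
rewrite !ffunE/=.
have -> : (fun i : 'I_d => ([ffun i0 => inord (a i0)] : {ffun 'I_d -> 'I_Dm.+1}) i : nat) = a.
  by apply/funext => i; rewrite ffunE inordK// ltnS.
have /andP[g0 g1] := cube_moment_itv b (code_cell s`_j p) a G.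
have /andP[h0 h1] := cube_moment_itv b (code_cell s`_j p) a H.
set g := cube_moment _ _ _ G in g0 g1 *; set h := cube_moment _ _ _ H in h0 h1 *.
have lt_Rq u : 0 <= u -> u <= 1 -> (Num.trunc (u / delta) < Rq)%N.
  move=> u0 u1; rewrite ltnS; apply: le_truncn.
  by rewrite ler_pdivrMr// mulVf// gt_eqF.
move=> /(congr1 val) /=; rewrite !inordK ?lt_Rq// => gh.
have /andP[ga gb] := truncn_itv (divr_ge0 g0 (ltW delta0)).
have /andP[ha hb] := truncn_itv (divr_ge0 h0 (ltW delta0)).
rewrite gh in ga gb; rewrite -natr1 in gb; rewrite -natr1 in hb.
have : `|g / delta - h / delta| <= 1 by rewrite ler_norml; lra.
by rewrite -mulrBl normrM normfV (gtr0_norm delta0) ler_pdivrMr// mul1r.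
Qed.

(** A point of $S^M$ is within [2 * M] of a net point, so its neighbour cells are all recorded. The
    total error is at most $Le^{-3L}\le e^{-2L}$ by [L_large]. *)
Lemma code_close Sigma (Sigma_sym : Sigma^T = Sigma)
    (Sigma_ge : loewner_le klow%:M Sigma) (Sigma_le : loewner_le Sigma kbar%:M)
    G H (x : 'rV[R]_d) : code G = code H -> dist_set S x <= M ->
  `|mixture_density G Sigma x - mixture_density H Sigma x| <= expR (- (2 * L)).
Proof.
move=> GH xM.
have [z Sz xz] : exists2 z, S z & norm2 (x - z) < dist_set S x + M / 2.
  by apply: dist_set_ltP => //; rewrite ltrDl divr_gt0.
have [y ys zy] := s_net Sz.
have xy : norm2 (x - y) <= 2 * M.
  rewrite -(subrKA z) (le_trans (ler_norm2D _ _))//.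
  by apply: (le_trans (lerD (ltW xz) zy)); move: xM rhoM; lra.
have jlt : (index y s < size s)%N by rewrite index_mem.
pose j : 'I_(size s) := Ordinal jlt.
have sj : s`_j = y by exact: nth_index.
have mom o (a : 'I_d -> nat) : (forall i, (a i <= Dm)%N) ->
    `|cube_moment b (neighbour b x o) a G - cube_moment b (neighbour b x o) a H| <= delta.
  move=> aD.
  pose p : {ffun 'I_d -> 'I_(P0.*2.+1)} :=
    [ffun i => inord (absz (neighbour b x o i - Num.floor (y 0 i / b) + P0%:Z))].
  suff -> : neighbour b x o = code_cell s`_j p by exact: code_moment_close.
  apply/funext => i; rewrite /code_cell sj ffunE.
  have hd : `|x 0 i / b - y 0 i / b| <= 2 * M / b.
    rewrite -mulrBl normrM normfV (gtr0_norm b0) ler_pM2r ?invr_gt0//.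
    by apply: le_trans xy; have := coord_le_norm2 (x - y) i; rewrite !mxE.
  have hP : 2 * M / b < P0%:R - 2.
    have := truncnS_gt (2 * M / b); rewrite /P0 natrD -natr1; lra.
  have [e1 e2] := int_diff_le (floor_bounds (x 0 i / b)) (floor_bounds (y 0 i / b))
    (le_lt_trans hd hP).
  have o2 : (o i <= 2)%N by rewrite -ltnS.
  have [w0 w1] := neighbour_offset e1 e2 o2.
  rewrite inordK; last by rewrite -ltz_nat gez0_abs.
  by rewrite gez0_abs// addrA addrK addrC subrK.
have := mixture_diff_le klow0 kbar0 Sigma_sym Sigma_ge Sigma_le b0 (ltW delta0) (leqnn Dm) mom.
move=> /le_trans; apply.
have -> : b ^+ 2 / (2 * kbar) = 3 * L by rewrite b2; field; rewrite gt_eqF.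
have -> : cell_rate d klow b = kappa_form * L.
  by rewrite /cell_rate b2 /kappa_form; field; rewrite gt_eqF.
rewrite -expRD (_ : kappa_form * L + - ((kappa_form + 3) * L) = - (3 * L)); last by ring.
have hK : expR (expR 1 * (5 * d%:R * b ^+ 2 / klow) - K%:R) <= expR (- (3 * L)).
  rewrite ler_expR.
  have := truncnS_gt (kappa_deg * L); rewrite -/K => hK.
  have -> : expR 1 * (5 * d%:R * b ^+ 2 / klow) = (kappa_deg - 3) * L.
    by rewrite b2 /kappa_deg; field; rewrite gt_eqF.
  lra.
have phim0 := gauss_sup_gt0 d klow0.
apply: (@le_trans _ _ (gauss_sup d klow * (2 + 3 * (3 ^ d)%:R) * expR (- (3 * L)))).
  rewrite -[leRHS]mulrA ler_wpM2l ?(ltW phim0)//.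
  have : (3 ^ d)%:R * (expR (- (3 * L)) + 2 * expR (expR 1 * (5 * d%:R * b ^+ 2 / klow) - K%:R)) <=
    (3 ^ d)%:R * (expR (- (3 * L)) + 2 * expR (- (3 * L))).
    by apply: ler_wpM2l => //; rewrite lerD2l; apply: ler_wpM2l.
  by move=> h; apply: (le_trans (lerD (lexx _) h)); lra.
apply: (@le_trans _ _ (expR L * expR (- (3 * L)))).
  rewrite ler_wpM2r ?expR_ge0// (le_trans L_large)//.
  have := expR_ge1Dx L; lra.
by rewrite -expRD ler_expR; lra.
Qed.

(** There are [Rq] levels with $\ln$ [Rq] $=O(L)$, for $|s|$ net points, $O((M/b)^d)$ cells and
    $O(L^d)$ exponents. As [b] is of order $\sqrt L$, the product has order $|s|M^dL^{d/2+1}$. *)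
Lemma ln_card_code :
  ln #|{: code_type}|%:R <= code_const * ((size s)%:R * M ^+ d * (Num.sqrt L ^+ d * L)).
Proof.
have hL1 := L1; have hkd := kd0; have hkf := kf0.
rewrite card_ffun !card_prod !card_ffun !card_ord.
have Rq0 : 0 < Rq%:R :> R by rewrite ltr0n.
rewrite natrX lnXn// -[leLHS]mulr_natr !natrM !natrX.
have hR : ln Rq%:R <= (kappa_form + 4) * L.
  rewrite -[leRHS]expRK ler_ln ?posrE ?expR_gt0//.
  have dV0 : 0 <= delta^-1 by rewrite invr_ge0 ltW.
  have /andP[h _] := truncn_itv dV0.
  rewrite /Rq -natr1 (le_trans (lerD h (lexx 1)))// /delta expRN invrK.
  rewrite (_ : (kappa_form + 4) * L = (kappa_form + 3) * L + L); last by ring.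
  rewrite expRD.
  have h2 : 2 <= expR L by have := expR_ge1Dx L; lra.
  have h1 : 1 <= expR ((kappa_form + 3) * L).
    by rewrite -expR0 ler_expR mulr_ge0 ?addr_ge0// ltW.
  nra.
have hD : Dm.+1%:R <= (2 * kappa_deg + 3) * L.
  have kL0 : 0 <= kappa_deg * L by rewrite mulr_ge0 ?(ltW L0)// (le_trans _ kd0).
  have /andP[h _] := truncn_itv kL0.
  rewrite /Dm /K -muln2 -natr1 natrM -natr1; lra.
have hP : P0.*2.+1%:R <= 11 * (M / b).
  have Mb1 : 1 <= M / b by rewrite ler_pdivlMr// mul1r.
  have Mb0 : 0 <= 2 * M / b by rewrite divr_ge0 ?(ltW b0)// mulr_ge0// ltW.
  have /andP[h _] := truncn_itv Mb0.
  rewrite /P0 -muln2 -natr1 natrM natrD; lra.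
have sL0 : 0 < Num.sqrt L by rewrite sqrtr_gt0.
have s60 : 0 < Num.sqrt (6 * kbar) by rewrite sqrtr_gt0 mulr_gt0.
have bE : b = Num.sqrt (6 * kbar) * Num.sqrt L by rewrite /b sqrtrM// mulr_ge0// ltW.
have LE : L = Num.sqrt L ^+ 2 by rewrite sqr_sqrtr// ltW.
have Mb0 : 0 <= 11 * (M / b) by rewrite mulr_ge0// divr_ge0// ltW.
have kdL0 : 0 <= (2 * kappa_deg + 3) * L.
  by rewrite mulr_ge0 ?(ltW L0)// addr_ge0// mulr_ge0// (le_trans _ hkd).
apply: (@le_trans _ _ (((kappa_form + 4) * L) *
  ((size s)%:R * (11 * (M / b)) ^+ d * ((2 * kappa_deg + 3) * L) ^+ d))).
  rewrite ler_pM//.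
  - by rewrite ln_ge0// ler1n.
  rewrite ler_pM ?exprn_ge0 ?mulr_ge0//.
    by apply: ler_wpM2l => //; apply: lerXn2r; rewrite ?nnegrE.
  by apply: lerXn2r; rewrite ?nnegrE.
rewrite le_eqVlt; apply/orP; left; apply/eqP.
rewrite /code_const bE.
rewrite (_ : 11 * (M / (Num.sqrt (6 * kbar) * Num.sqrt L)) =
   11 / Num.sqrt (6 * kbar) * M / Num.sqrt L); last by field; rewrite !gt_eqF.
set q := 11 / Num.sqrt (6 * kbar); rewrite !exprMn.
have -> : L ^+ d = Num.sqrt L ^+ d * Num.sqrt L ^+ d by rewrite -exprMn -expr2 -LE.
have xy : (Num.sqrt L)^-1 ^+ d * Num.sqrt L ^+ d = 1.
  by rewrite -exprMn mulVf ?expr1n// gt_eqF.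
move: xy; set x := Num.sqrt L ^+ d; set y := _^-1 ^+ d => xy.
apply/eqP; rewrite -subr_eq0.
set lhs := (X in X - _); set rhs := (X in _ - X).
have -> : lhs = rhs * (y * x) by rewrite /lhs /rhs; ring.
by rewrite xy mulr1 subrr.
Qed.

Lemma exists_code : exists (Code : finType) (f : probability (borel_rV R d) R -> Code),
  (forall Sigma : 'M[R]_d, Sigma^T = Sigma -> loewner_le klow%:M Sigma ->
     loewner_le Sigma kbar%:M -> forall G H (x : 'rV[R]_d),
     f G = f H -> dist_set S x <= M ->
     `|mixture_density G Sigma x - mixture_density H Sigma x| <= expR (- (2 * L))) /\
  ln #|Code|%:R <= code_const * ((size s)%:R * M ^+ d * (Num.sqrt L ^+ d * L)).
Proof.
exists ({ffun code_index -> 'I_Rq} : finType), code; split; last exact: ln_card_code.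
by move=> Sigma h1 h2 h3 G H x; exact: code_close.
Qed.

End codes.

(** * Deviation bounds *)

Section chernoff.
Context {R : realType}.

Lemma markov_ge dO (Omega : measurableType dO) (P : probability Omega R)
    (Z : Omega -> R) (a e : R) : measurable_fun setT Z -> (forall w, 0 <= Z w) ->
    0 < a -> (\int[P]_w (Z w)%:E <= e%:E)%E ->
  (P [set w | (a <= Z w)%R] <= (e / a)%:E)%E.
Proof.
move=> mZ Z0 a0 Ze.
have mA : measurable [set w | (a <= Z w)%R].
  have := mZ measurableT _ (measurable_itv `[a, +oo[); rewrite setTI.
  by congr measurable; apply/seteqP; split => w /=; rewrite in_itv/= andbT.
have h : (a%:E * P [set w | (a <= Z w)%R] <= e%:E)%E.
  apply: le_trans Ze; rewrite -(setIT [set w | (a <= Z w)%R]) -integral_indic//.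
  have mI : measurable_fun setT (\1_[set w | (a <= Z w)%R] : Omega -> R).
    exact: measurable_indic.
  have I0 w : 0 <= (\1_[set w | (a <= Z w)%R] w : R) by [].
  rewrite -(ge0_integral_EFinZ P (ltW a0) mI I0).
  apply: ge0_le_integral_EFin => //.
  - exact: measurable_funM.
  - by move=> w; rewrite mulr_ge0// ltW.
  - move=> w; rewrite indicE; case: (boolP (w \in _)) => [/set_mem/= aw|_].
      by rewrite mulr1.
    by rewrite mulr0.
rewrite -(@lee_pmul2l _ a%:E)// ?lte_fin// -EFinM.
by rewrite mulrC divfK// gt_eqF.
Qed.

Lemma ge0_integral_EFin_sum dT (T : measurableType dT) (mu : {measure set T -> \bar R})
    (I : Type) (s : seq I) (f : I -> T -> R) :
    (forall i, measurable_fun setT (f i)) -> (forall i x, 0 <= f i x) ->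
  (\int[mu]_x (\sum_(i <- s) f i x)%:E = \sum_(i <- s) \int[mu]_x (f i x)%:E)%E.
Proof.
move=> mf f0; elim: s => [|i s IH].
  by rewrite big_nil; under eq_integral do rewrite big_nil; rewrite integral0.
rewrite big_cons -IH; under eq_integral do rewrite big_cons.
rewrite ge0_integral_EFinD//; first exact: measurable_sum.
by move=> x; exact: sumr_ge0.
Qed.

Context (d n : nat) (klow kbar : R).
Hypotheses (klow0 : 0 < klow) (kbar0 : 0 < kbar).
Context (Sigma : 'I_n -> 'M[R]_d).
Hypotheses (Sigma_sym : forall i, (Sigma i)^T = Sigma i).
Hypotheses (Sigma_ge : forall i, loewner_le klow%:M (Sigma i)).
Hypotheses (Sigma_le : forall i, loewner_le (Sigma i) kbar%:M).
Hypothesis gauss1 : forall i,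
  (\int[lebesgue_rV d]_x (gauss_density (Sigma i) x)%:E = 1)%E.
Context (Gstar : probability (borel_rV R d) R).
Context (dO : measure_display) (Omega : measurableType dO) (P : probability Omega R).
Context (X : 'I_n -> {RV P >-> borel_rV R d}).
Hypothesis X_indep : mutually_independent X.
Hypothesis X_density : forall i, has_density (X i) (mixture_density Gstar (Sigma i)).

Let fstar i (x : borel_rV R d) := mixture_density Gstar (Sigma i) x.

Let fstar_gt0 i x : 0 < fstar i x.
Proof. exact: (mixture_density_gt0 klow0 kbar0 (Sigma_sym i)). Qed.

Let mfstar i : measurable_fun setT (fstar i).
Proof. exact: (measurable_mixture_density klow0 kbar0 (Sigma_sym i)). Qed.

Lemma integral_comp_density i (g : borel_rV R d -> R) : measurable_fun setT g ->
    (forall x, 0 <= g x) ->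
  (\int[P]_w (g (X i w))%:E =
   \int[lebesgue_rV d]_x (mixture_density Gstar (Sigma i) x * g x)%:E)%E.
Proof.
move=> mg g0.
have mgE : measurable_fun setT (EFin \o g) by exact/measurable_EFinP.
transitivity (\int[distribution P (X i)]_x (g x)%:E)%E.
  by rewrite (ge0_integral_distribution (X i) mgE)// => x; rewrite lee_fin.
rewrite -(@integral_transfer R _ _ _ _ (lebesgue_rV d) (distribution P (X i)) id (fstar i) (EFin \o g))//.
- by move=> x; exact/ltW/fstar_gt0.
- by move=> A mA; apply/esym; exact: (X_density i mA).
Qed.

(** Square roots turn the mean of a likelihood ratio into an affinity; [v] pays for replacing the
    estimator by the representative of its code. *)
Definition sqrt_ratio (v : borel_rV R d -> R) (H : probability (borel_rV R d) R)
    (i : 'I_n) (x : borel_rV R d) : R :=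
  Num.sqrt (mixture_density H (Sigma i) x + v x) /
  Num.sqrt (mixture_density Gstar (Sigma i) x).

Section fixed_weight.
Variables (v : borel_rV R d -> R) (sg : R).
Hypotheses (mv : measurable_fun setT v) (v0 : forall x, 0 <= v x) (sg0 : 0 < sg).
Hypothesis int_v : (\int[lebesgue_rV d]_x (v x)%:E <= (sg ^+ 2)%:E)%E.

Let sqrt_ratio_ge0 H i x : 0 <= sqrt_ratio v H i x.
Proof. by rewrite divr_ge0. Qed.

Let msqrt_ratio H i : measurable_fun setT (sqrt_ratio v H i).
Proof.
apply: measurable_funM.
  apply: (measurableT_comp measurable_Num_sqrt); apply: measurable_funD => //.
  exact: (measurable_mixture_density klow0 kbar0 (Sigma_sym i)).
(* The denominator is positive, so its inverse is the exponential of minus its logarithm, a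
   composition of measurable maps. *)
rewrite (_ : (fun x => _) = (fun x => expR (- ln (Num.sqrt (fstar i x))))); last first.
  by apply/funext => x; rewrite expRN lnK// posrE sqrtr_gt0 fstar_gt0.
apply: measurableT_comp => //; apply: measurableT_comp => //.
exact: (measurableT_comp (@measurable_ln R)
  (measurableT_comp measurable_Num_sqrt (mfstar i))).
Qed.

Lemma measurable_prod_sqrt_ratio H :
  measurable_fun setT (fun w => \prod_i sqrt_ratio v H i (X i w)).
Proof.
apply: measurable_prod => i _.
by apply: (measurableT_comp (msqrt_ratio H i)).
Qed.

(** By independence the mean is a product of factors at most $1-h_i^2+\sigma\le
    e^{\sigma-h_i^2}$. *)
Lemma integral_prod_sqrt_ratio_le H (B : R) :
    B <= \sum_i hellinger2 (mixture_density H (Sigma i)) (mixture_density Gstar (Sigma i)) ->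
  (\int[P]_w (\prod_i sqrt_ratio v H i (X i w))%:E <= (expR (n%:R * sg - B))%:E)%E.
Proof.
move=> hB.
pose h i := hellinger2 (mixture_density H (Sigma i)) (mixture_density Gstar (Sigma i)).
have e_le i : (\int[P]_w (sqrt_ratio v H i (X i w))%:E <= (expR (sg - h i))%:E)%E.
  rewrite (integral_comp_density i (msqrt_ratio H i) (sqrt_ratio_ge0 H i)).
  under eq_integral => x _.
    rewrite (_ : _ * _ = Num.sqrt (mixture_density H (Sigma i) x + v x) *
       Num.sqrt (mixture_density Gstar (Sigma i) x)); last first.
      rewrite /sqrt_ratio mulrCA; congr (_ * _).
      rewrite -[X in X / _](sqr_sqrtr (ltW (fstar_gt0 i x))) expr2 mulfK//.
      by rewrite gt_eqF// sqrtr_gt0 fstar_gt0.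
    over.
  apply: (@le_trans _ _ (1 - h i + sg)%:E); last first.
    rewrite lee_fin -addrA [- h i + sg]addrC; exact: expR_ge1Dx.
  apply: integral_sqrt_add_le => //.
  - exact: (measurable_mixture_density klow0 kbar0 (Sigma_sym i)).
  - exact: mfstar.
  - by move=> x; exact/ltW/(mixture_density_gt0 klow0 kbar0 (Sigma_sym i)).
  - by move=> x; exact/ltW/fstar_gt0.
  - exact: (integral_mixture1 klow0 kbar0 (Sigma_sym i)).
  - exact: (integral_mixture1 klow0 kbar0 (Sigma_sym i)).
have e_ge0 i : (0 <= \int[P]_w (sqrt_ratio v H i (X i w))%:E)%E.
  by apply: integral_ge0 => w _; rewrite lee_fin.
pose e i := fine (\int[P]_w (sqrt_ratio v H i (X i w))%:E).
have eE i : (\int[P]_w (sqrt_ratio v H i (X i w))%:E = (e i)%:E)%E.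
  by rewrite fineK// ge0_fin_numE// (le_lt_trans (e_le i))// ltry.
rewrite (indep_integral_prod X_indep (msqrt_ratio H) (sqrt_ratio_ge0 H) eE) lee_fin.
apply: (@le_trans _ _ (\prod_i expR (sg - h i))).
  apply: ler_prod => i _; rewrite -!lee_fin -eE e_ge0/=; exact: e_le.
rewrite -expR_sum ler_expR sumrB sumr_const card_ord mulr_natl lerD2l lerN2.
exact: hB.
Qed.

(** The union over codes is taken by one application of Markov's inequality to the sum of the
    products. *)
Lemma prob_sqrt_ratio_le (Code : finType) (bad : pred Code)
    (rep : Code -> probability (borel_rV R d) R) (B tau : R) :
    (forall j, bad j -> B <= \sum_i hellinger2 (mixture_density (rep j) (Sigma i))
       (mixture_density Gstar (Sigma i))) ->
  (P [set w | (expR (- tau) <= \sum_(j | bad j) \prod_i sqrt_ratio v (rep j) i (X i w))%R] <=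
   (#|Code|%:R * expR (tau + n%:R * sg - B))%:E)%E.
Proof.
move=> hbad.
pose F j w := \prod_i sqrt_ratio v (rep j) i (X i w).
pose s := [seq j <- index_enum Code | bad j].
have F0 j w : 0 <= F j w by exact: prodr_ge0.
have mF j : measurable_fun setT (F j) by exact: measurable_prod_sqrt_ratio.
pose Z w := \sum_(j <- s) F j w.
rewrite (_ : [set w | _] = [set w | expR (- tau) <= Z w]); last first.
  by apply/seteqP; split => w /=; rewrite /Z big_filter.
have mZ : measurable_fun setT Z by exact: measurable_sum.
have Z0 w : 0 <= Z w by exact: sumr_ge0.
have ZE : (\int[P]_w (Z w)%:E <= (#|Code|%:R * expR (n%:R * sg - B))%:E)%E.
  rewrite (ge0_integral_EFin_sum P s mF F0) big_filter.
  apply: (@le_trans _ _ (\sum_(j : Code) (expR (n%:R * sg - B))%:E)%E).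
    rewrite big_mkcond/=; apply: lee_sum => j _; case: ifPn => [bj|_].
      exact: integral_prod_sqrt_ratio_le (hbad _ bj).
    by rewrite lee_fin expR_ge0.
  by rewrite sumEFin lee_fin sumr_const -[leLHS]mulr_natl.
apply: (le_trans (markov_ge mZ Z0 (expR_gt0 _) ZE)).
by rewrite lee_fin -mulrA expRN invrK -expRD addrC addrA.
Qed.

End fixed_weight.

Variables (S : set 'rV[R]_d) (S0 : S !=set0) (M L : R) (M0 : 0 < M) (L0 : 0 < L).
Hypothesis d0 : (0 < d)%N.

(** Outside $S^M$, [3 * L] compensates the scale $e^{-2L}$ of [weight] and the bound $e^L$ on the
    mixture, and the logarithm cancels the polynomial decay of [weight]. *)
Definition tail_score (x : borel_rV R d) : R :=
  if M < dist_set S x then 3 * L + 2 * d%:R * ln (dist_set S x / M) else 0.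

Lemma measurable_tail_score : measurable_fun setT tail_score.
Proof.
apply: measurable_fun_ifT => //.
- apply: measurable_fun_ltr => //; exact: measurable_dist_set.
- apply: measurable_funD => //; apply: measurable_funM => //.
  apply: (measurableT_comp (@measurable_ln R)).
  by apply: measurable_funM => //; exact: measurable_dist_set.
Qed.

(** The parameter turns $2d\ln(D/M)$ into $r\ln(D/M)$, the logarithm of [excess], and [3 * L] into
    $3(d+1)/(4d)\le3/2$. *)
Lemma expR_tail_score_le x : expR (d.+1%:R / (4 * d%:R * L) * tail_score x) <=
  1 + expR (3 / 2) * excess S M L x.
Proof.
rewrite /tail_score /excess; case: ifPn => [MD|_]; last first.
  by rewrite !mulr0 expR0 addr0.
have d1 : 1 <= d%:R :> R by rewrite ler1n.
have dp : 0 < d%:R :> R by rewrite ltr0n.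
have DM : 0 < dist_set S x / M by rewrite divr_gt0// (lt_trans M0).
rewrite mulrDr expRD -[leLHS]add0r lerD// ler_pM ?expR_ge0//.
  rewrite ler_expR.
  have -> : d.+1%:R / (4 * d%:R * L) * (3 * L) = 3 * d.+1%:R / (4 * d%:R).
    by field; rewrite !gt_eqF.
  rewrite ler_pdivrMr ?mulr_gt0// -natr1; lra.
rewrite /powR gt_eqF// ler_expR mulrA.
have -> : d.+1%:R / (4 * d%:R * L) * (2 * d%:R) = d.+1%:R / (2 * L) :> R.
  by field; rewrite !gt_eqF.
by [].
Qed.

Lemma prob_tail_score_le (E0 omega : R) :
    (forall i, (\int[lebesgue_rV d]_x (mixture_density Gstar (Sigma i) x * excess S M L x)%:E
       <= E0%:E)%E) ->
  (P [set w | (omega <= \sum_i tail_score (X i w))%R] <=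
   (expR (- (d.+1%:R / (4 * d%:R * L)) * omega + n%:R * (expR (3 / 2) * E0)))%:E)%E.
Proof.
move=> hE0; set lam := d.+1%:R / (4 * d%:R * L).
have lam0 : 0 < lam by rewrite divr_gt0// !mulr_gt0// ltr0n.
pose g (x : borel_rV R d) := expR (lam * tail_score x).
have mg : measurable_fun setT g.
  by apply: measurableT_comp => //; apply: measurable_funM => //; exact: measurable_tail_score.
have g0 x : 0 <= g x by exact: expR_ge0.
have mexc := measurable_excess S0 M L.
have exc0 x : 0 <= excess S M L x := excess_ge0 S M L x.
have g_le i : (\int[P]_w (g (X i w))%:E <= (expR (expR (3 / 2) * E0))%:E)%E.
  rewrite (integral_comp_density i mg g0).
  have mfe : measurable_fun setT (fun x => fstar i x * excess S M L x).
    exact: (measurable_funM (mfstar i) mexc).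
  have mcfe : measurable_fun setT (fun x => expR (3 / 2) * (fstar i x * excess S M L x)).
    by apply: measurable_funM.
  have fe0 x : 0 <= fstar i x * excess S M L x by rewrite mulr_ge0// ltW.
  have cfe0 x : 0 <= expR (3 / 2) * (fstar i x * excess S M L x).
    by rewrite mulr_ge0// expR_ge0.
  apply: (@le_trans _ _ (\int[lebesgue_rV d]_x (fstar i x +
      expR (3 / 2) * (fstar i x * excess S M L x))%:E)%E).
    apply: ge0_le_integral_EFin.
    - exact: (measurable_funM (mfstar i) mg).
    - exact: (measurable_funD (mfstar i) mcfe).
    - by move=> x; exact: (mulr_ge0 (ltW (fstar_gt0 i x)) (g0 x)).
    - move=> x; apply: (le_trans (ler_wpM2l (ltW (fstar_gt0 i x)) (expR_tail_score_le x))).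
      by rewrite mulrDr mulr1 mulrCA.
  rewrite (ge0_integral_EFinD _ (mfstar i) mcfe (fun x => ltW (fstar_gt0 i x)) cfe0).
  rewrite (ge0_integral_EFinZ _ (expR_ge0 _) mfe fe0).
  rewrite (integral_mixture1 klow0 kbar0 (Sigma_sym i) (Sigma_ge i) (Sigma_le i) Gstar (gauss1 i)).
  apply: (@le_trans _ _ (1 + expR (3 / 2) * E0)%:E); last by rewrite lee_fin expR_ge1Dx.
  rewrite EFinD leeD2l// EFinM; apply: lee_wpmul2l; last exact: hE0.
  by rewrite lee_fin expR_ge0.
pose e i := fine (\int[P]_w (g (X i w))%:E).
have e_ge0 i : (0 <= \int[P]_w (g (X i w))%:E)%E.
  by apply: integral_ge0 => w _; rewrite lee_fin.
have eE i : (\int[P]_w (g (X i w))%:E = (e i)%:E)%E.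
  by rewrite fineK// ge0_fin_numE// (le_lt_trans (g_le i))// ltry.
have prE := indep_integral_prod X_indep (fun=> mg) (fun=> g0) eE.
have mZ : measurable_fun setT (fun w => \prod_i g (X i w)).
  by apply: measurable_prod => i _; apply: (measurableT_comp mg).
have Z0 w : 0 <= \prod_i g (X i w) by exact: prodr_ge0.
have Zle : (\int[P]_w (\prod_i g (X i w))%:E <= (expR (n%:R * (expR (3 / 2) * E0)))%:E)%E.
  rewrite prE lee_fin.
  apply: (@le_trans _ _ (\prod_(i < n) expR (expR (3 / 2) * E0))).
    by apply: ler_prod => i _; rewrite -!lee_fin -eE e_ge0/=.
  by rewrite prodr_const card_ord expRM_natl.
have := markov_ge mZ Z0 (expR_gt0 (lam * omega)) Zle.
rewrite -expRN -expRD addrC -mulNr; apply: le_trans.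
rewrite le_eqVlt; apply/orP; left; apply/eqP; congr (P _).
apply/seteqP; split => w /=; rewrite -expR_sum ler_expR -mulr_sumr ler_pM2l//.
Qed.

End chernoff.

(** * The rate as a real number: volume and moment terms *)

Section rate.
Context {R : realType} (d : nat).
Variables (S : set 'rV[R]_d) (S0 : S !=set0) (G : probability (borel_rV R d) R).

Lemma dist_moment_poweR (M q : R) : 0 < M -> 0 < q ->
  ((2%:E * dist_moment S G q * M^-1%:E) `^ q =
   \int[G]_t ((2 * dist_set S (t : 'rV[R]_d) / M) `^ q)%:E)%E.
Proof.
move=> M0 q0; rewrite /dist_moment expectation.unlock.
have mq : measurable_fun setT (fun t : borel_rV R d => dist_set S t `^ q).
  by apply: (measurableT_comp (measurable_powR q)); exact: measurable_dist_set.
have dq0 (t : borel_rV R d) : 0 <= dist_set S t `^ q by exact: powR_ge0.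
have int0 : (0 <= \int[G]_t (dist_set S (t : 'rV[R]_d) `^ q)%:E)%E.
  by apply: integral_ge0 => t _; rewrite lee_fin.
rewrite [(2%:E * _)%E]muleC -muleA poweRM ?poweR_ge0//; last first.
  by rewrite -EFinM lee_fin mulr_ge0// invr_ge0 ltW.
rewrite -poweRrM mulVf ?gt_eqF// poweRe1// -EFinM poweR_EFin muleC.
rewrite -(ge0_integral_EFinZ G (powR_ge0 _ _) mq dq0).
apply: eq_integral => t _; congr EFin.
rewrite -powRM ?dist_set_ge0//; last by rewrite mulr_ge0// invr_ge0 ltW.
by rewrite mulrAC.
Qed.

(** Finiteness of the rate makes both summands finite, since their coefficients are positive. The
    last clause passes to the infimum a bound proved for every [q], as the infimum need not be
    attained. *)
Lemma rate_decomposition (kbar M e2 L : R) (n : nat) :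
    0 < kbar -> 0 < M -> L = ln n%:R -> 0 < L -> (0 < n)%N ->
    rate kbar n M S G = e2%:E ->
  exists V J : R, [/\ 0 <= J,
    lebesgue_rV d (fattening S (Num.sqrt kbar)) = V%:E,
    n%:R * e2 = V * M ^+ d * (Num.sqrt L ^+ d * L) + n%:R * J &
    forall x c, (forall q, d.+1%:R / (2 * L) <= q ->
      (x <= \int[G]_t ((2 * dist_set S (t : 'rV[R]_d) / M) `^ q)%:E + c%:E)%E) ->
      (x <= (J / L + c)%:E)%E].
Proof.
move=> k0 M0 LE L0 n0; rewrite /rate -LE.
have np : 0 < n%:R :> R by rewrite ltr0n.
set A := lebesgue_rV d _; set B := ereal_inf _.
have sLE : L `^ (d%:R / 2 + 1) = Num.sqrt L ^+ d * L.
  rewrite powRD; last by rewrite (gt_eqF L0) implybT.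
  by rewrite powRr1 ?(ltW L0)// [d%:R / 2]mulrC powRrM powR12_sqrt ?(ltW L0)// powR_mulrn ?sqrtr_ge0.
rewrite sLE.
have sL0 : 0 < Num.sqrt L by rewrite sqrtr_gt0.
set cst := M ^+ d / n%:R * (Num.sqrt L ^+ d * L).
have cst0 : 0 < cst by rewrite !mulr_gt0 ?exprn_gt0 ?invr_gt0.
have A0 : (0 <= A)%E by exact: measure_ge0.
have B0 : (0 <= B)%E.
  apply: le_ereal_inf_tmp => _ [q _ <-].
  by rewrite mule_ge0 ?poweR_ge0// lee_fin ltW.
have hB q : d.+1%:R / (2 * L) <= q ->
   (B <= \int[G]_t ((2 * dist_set S (t : 'rV[R]_d) / M) `^ q)%:E * L%:E)%E.
  move=> hq; have q0 : 0 < q by apply: lt_le_trans hq; rewrite divr_gt0// mulr_gt0.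
  by rewrite -dist_moment_poweR//; apply: ereal_inf_lbound; exists q.
have hB' y : (forall q, d.+1%:R / (2 * L) <= q ->
   (y <= \int[G]_t ((2 * dist_set S (t : 'rV[R]_d) / M) `^ q)%:E * L%:E)%E) -> (y <= B)%E.
  move=> hy; apply: le_ereal_inf_tmp => _ [q hq <-].
  have q0 : 0 < q by apply: lt_le_trans hq; rewrite divr_gt0// mulr_gt0.
  by rewrite dist_moment_poweR//; exact: hy.
clearbody B; case: B B0 hB hB' => [J| |]//; last first.
  move=> _ _ _; rewrite addey// -ltNye (lt_le_trans (ltNyr 0))//.
  by rewrite mule_ge0// lee_fin ltW.
move: A A0 => [V| |]// V0 J0 hB hB'; last first.
  by rewrite gt0_mulye ?lte_fin.
rewrite -EFinM -EFinD => -[e2E]; exists V, J; split=> //.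
  rewrite -e2E /cst; field; exact/lt0r_neq0.
move=> x c hx.
have : ((x - c%:E) * L%:E <= J%:E)%E.
  apply: hB' => q hq; apply: lee_wpmul2r; first by rewrite lee_fin ltW.
  by rewrite leeBlDr//; exact: hx.
rewrite -lee_pdivlMr// => h.
by rewrite EFinD -leeBlDr.
Qed.

End rate.

(** * Domination of a mixture by the representative of its code and the weight *)

Section domination.
Context {R : realType} (d : nat) (klow kbar : R).
Hypotheses (klow0 : 0 < klow) (kbar0 : 0 < kbar).
Variables (L M : R) (S : set 'rV[R]_d) (S0 : S !=set0) (rho : R) (s : seq 'rV[R]_d).
Hypotheses (M0 : 0 < M) (rhoM : 2 * rho <= M).
Hypothesis s_net : forall x, S x -> exists2 y, y \in s & norm2 (x - y) <= rho.
Hypothesis L_large : gauss_sup d klow <= L.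

(** Normalised to be at least $e^{-2L}$, the accuracy of the code, on all of $S^M$. *)
Definition weight (x : borel_rV R d) : R :=
  2 ^+ d * expR (- (2 * L)) * cauchy_weight M s x.

Lemma weight_ge0 x : 0 <= weight x.
Proof. by rewrite /weight !mulr_ge0 ?expR_ge0 ?cauchy_weight_ge0 ?exprn_ge0. Qed.

Lemma measurable_weight : measurable_fun setT weight.
Proof. by apply: measurable_funM => //; exact: measurable_cauchy_weight. Qed.

Lemma integral_weight : (\int[lebesgue_rV d]_x (weight x)%:E =
  (expR (- (2 * L)) * ((size s)%:R * (4 * pi * M) ^+ d))%:E)%E.
Proof.
rewrite /weight ge0_integral_EFinZ.
- rewrite integral_cauchy_weight// -EFinM; congr EFin.
  rewrite -[in LHS]mulrA mulrCA; congr (_ * _); rewrite mulrCA -exprMn; congr (_ * _ ^+ _).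
  by ring.
- by rewrite mulr_ge0 ?expR_ge0// exprn_ge0.
- exact: measurable_cauchy_weight.
- by move=> x; exact: cauchy_weight_ge0.
Qed.

Lemma weight_ge (x : 'rV[R]_d) (E : R) : M <= E -> dist_set S x <= E ->
  expR (- (2 * L)) * ((E / M) ^+ (2 * d))^-1 <= weight x.
Proof.
move=> ME dE; have := cauchy_weight_ge S0 M0 rhoM s_net ME dE => h.
have c0 : 0 <= 2 ^+ d * expR (- (2 * L)) by rewrite mulr_ge0 ?expR_ge0// exprn_ge0.
apply: le_trans (ler_wpM2l c0 h).
rewrite le_eqVlt; apply/orP; left; apply/eqP.
rewrite [2 ^+ d * _]mulrC -mulrA; congr (_ * _).
by rewrite mulrA -exprMn mulfV ?expr1n ?mul1r.
Qed.

Variable Sigma : 'M[R]_d.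
Hypotheses (Sigma_sym : Sigma^T = Sigma).
Hypotheses (Sigma_ge : loewner_le klow%:M Sigma).
Hypotheses (Sigma_le : loewner_le Sigma kbar%:M).

(** On $S^M$ the weight exceeds the code error. Outside, the mixture is at most [gauss_sup] $\le
    L\le e^L$, and the factor $e^{3L}(D/M)^{2d}$ times the lower bound of [weight] is exactly
    $e^L$. *)
Lemma mixture_le_tail_score (G H : probability (borel_rV R d) R) (x : 'rV[R]_d) :
    (dist_set S x <= M ->
     `|mixture_density G Sigma x - mixture_density H Sigma x| <= expR (- (2 * L))) ->
  mixture_density G Sigma x <=
  expR (tail_score S M L x) * (mixture_density H Sigma x + weight x).
Proof.
move=> GH; have H0 := ltW (mixture_density_gt0 klow0 kbar0 Sigma_sym Sigma_ge Sigma_le H x).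
rewrite /tail_score; case: ifPn => [MD|]; last first.
  rewrite -leNgt => DM; rewrite expR0 mul1r.
  have := weight_ge (lexx M) DM.
  rewrite divff ?gt_eqF// expr1n invr1 mulr1 => h.
  by have := GH DM; rewrite ler_norml; move: h; lra.
set D := dist_set S x in MD *.
have DM : 0 < D / M by rewrite divr_gt0// (lt_trans M0).
apply: (@le_trans _ _ (expR L)).
  apply: le_trans (mixture_density_le klow0 kbar0 Sigma_sym Sigma_ge Sigma_le G x) _.
  by apply: (le_trans L_large); have := expR_ge1Dx L; lra.
have -> : expR (3 * L + 2 * d%:R * ln (D / M)) = expR (3 * L) * (D / M) ^+ (2 * d).
  rewrite expRD; congr (_ * _); rewrite -natrM mulrC expRM_natr lnK//.
apply: (@le_trans _ _ (expR (3 * L) * (D / M) ^+ (2 * d) * weight x)); last first.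
  by rewrite ler_wpM2l ?lerDr// mulr_ge0 ?expR_ge0// exprn_ge0// ltW.
have p0 : 0 < expR (3 * L) * (D / M) ^+ (2 * d) by rewrite mulr_gt0 ?expR_gt0// exprn_gt0.
apply: le_trans (ler_wpM2l (ltW p0) (weight_ge (ltW MD) (lexx D))).
rewrite mulrACA divff; last by rewrite gt_eqF// exprn_gt0.
by rewrite mulr1 -expRD ler_expR; lra.
Qed.

End domination.

(** * The deviation inequality for large samples *)

Section large_sample.
Context {R : realType} (d : nat) (klow kbar c : R).
Hypotheses (d0 : (0 < d)%N) (klow0 : 0 < klow) (kbar0 : 0 < kbar) (c0 : 0 < c).

(** [vol_const] converts a volume into a bound on the net size; [log_const] gives $L\le$ [log_const]
    $\cdot A/L$. The terms of [dev_const] pay for, in order, the number of codes, the threshold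
    [tau], the integral of the weight, and the target exponent $t^2L$. *)
Definition vol_const : R := (d%:R / Num.sqrt kbar) ^+ d.
Definition log_const : R := vol_const / Num.sqrt (10 * kbar).
Definition score_const : R :=
  4 * (log_const + expR (3 / 2) * tail_const d klow kbar * log_const + expR (3 / 2)).
Definition dev_const : R := code_const d klow kbar * vol_const +
  (c + score_const) / 2 + (4 * pi) ^+ d * vol_const + vol_const.
Definition log_threshold : R := 1 + 10^-1 / kbar + 4 * d.+1%:R +
  gauss_sup d klow * (2 + 3 * (3 ^ d)%:R).

Lemma vol_const_gt0 : 0 < vol_const.
Proof. by rewrite exprn_gt0// divr_gt0 ?sqrtr_gt0// ltr0n. Qed.

Lemma log_const_gt0 : 0 < log_const.
Proof. by rewrite divr_gt0 ?vol_const_gt0// sqrtr_gt0 mulr_gt0. Qed.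

Lemma score_const_ge0 : 0 <= score_const.
Proof.
have lc := ltW log_const_gt0; have tc := tail_const_ge0 d kbar klow0.
apply: mulr_ge0 => //; apply: addr_ge0; last exact: expR_ge0.
apply: addr_ge0 => //; apply: mulr_ge0 => //; apply: mulr_ge0 => //; exact: expR_ge0.
Qed.

Lemma dev_const_ge0 : 0 <= dev_const.
Proof.
have vc := ltW vol_const_gt0; have sc := score_const_ge0.
have cc := code_const_ge0 d klow0 kbar0.
rewrite /dev_const; apply: addr_ge0 => //; apply: addr_ge0; first apply: addr_ge0.
- exact: mulr_ge0.
- by apply: divr_ge0 => //; apply: addr_ge0 => //; exact: ltW.
- by apply: mulr_ge0 => //; apply: exprn_ge0; rewrite mulr_ge0 ?pi_ge0.
Qed.

Context (n : nat) (Sigma : 'I_n -> 'M[R]_d).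
Hypotheses (Sigma_sym : forall i, (Sigma i)^T = Sigma i).
Hypotheses (Sigma_ge : forall i, loewner_le klow%:M (Sigma i)).
Hypotheses (Sigma_le : forall i, loewner_le (Sigma i) kbar%:M).
Hypothesis gauss1 : forall i,
  (\int[lebesgue_rV d]_x (gauss_density (Sigma i) x)%:E = 1)%E.
Context (Gstar : probability (borel_rV R d) R).
Context (dO : measure_display) (Omega : measurableType dO) (P : probability Omega R).
Context (X : 'I_n -> {RV P >-> borel_rV R d}).
Hypothesis X_indep : mutually_independent X.
Hypothesis X_density : forall i, has_density (X i) (mixture_density Gstar (Sigma i)).
Context (M : R) (S : set 'rV[R]_d) (S0 : S !=set0) (e2 : R).
Hypothesis n2 : (2 <= n)%N.
Hypothesis hM : Num.sqrt (10 * kbar * ln n%:R) <= M.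
Hypothesis rateE : rate kbar n M S Gstar = e2%:E.

Let L : R := ln n%:R.
Let np : 0 < n%:R :> R. Proof. by rewrite ltr0n (leq_trans _ n2). Qed.
Let nE : n%:R = expR L. Proof. by rewrite lnK. Qed.
Let L0 : 0 < L. Proof. by rewrite ln_gt0// ltr1n. Qed.
Let M2 : 10 * kbar * L <= M ^+ 2.
Proof.
rewrite -(@sqr_sqrtr _ (10 * kbar * L)); last by rewrite !mulr_ge0// ltW.
by apply: lerXn2r; rewrite ?nnegrE ?sqrtr_ge0// (le_trans _ hM)// sqrtr_ge0.
Qed.
Let M0 : 0 < M.
Proof. by rewrite (lt_le_trans _ hM)// sqrtr_gt0 !mulr_gt0. Qed.

(** The upper bound turns the net size [m] into volume; the lower one uses $M\ge\sqrt{10\bar kL}$,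
    so that $M^dL^{d/2}$ is at least of order $L^d$. *)
Lemma volume_term_bounds (m V J : R) : 1 <= m -> m * (Num.sqrt kbar / d%:R) ^+ d <= V ->
    0 <= J -> n%:R * e2 = V * M ^+ d * (Num.sqrt L ^+ d * L) + n%:R * J ->
  m * M ^+ d * (Num.sqrt L ^+ d * L) <= vol_const * (n%:R * e2) /\
  (Num.sqrt (10 * kbar) * L) ^+ d * L <= m * M ^+ d * (Num.sqrt L ^+ d * L).
Proof.
move=> m1 sV J0 nE2.
have sk0 : 0 < Num.sqrt kbar by rewrite sqrtr_gt0.
have sL0 : 0 < Num.sqrt L by rewrite sqrtr_gt0.
have vp := vol_const_gt0.
have vV : m <= vol_const * V.
  have -> : m = vol_const * (m * (Num.sqrt kbar / d%:R) ^+ d).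
    rewrite mulrCA -exprMn.
    have -> : d%:R / Num.sqrt kbar * (Num.sqrt kbar / d%:R) = 1.
      by field; rewrite !gt_eqF// ltr0n.
    by rewrite expr1n mulr1.
  by rewrite ler_wpM2l// ltW.
have q0 : 0 <= M ^+ d * (Num.sqrt L ^+ d * L).
  by rewrite !mulr_ge0 ?exprn_ge0// ltW.
have nJ : 0 <= vol_const * (n%:R * J) by rewrite !mulr_ge0// ltW.
split.
  rewrite nE2 mulrDr -[leLHS]addr0 lerD//.
  by have := ler_wpM2r q0 vV; rewrite !mulrA.
apply: (@le_trans _ _ (M ^+ d * (Num.sqrt L ^+ d * L))); last first.
  by rewrite -[leRHS]mulrA ler_peMl.
rewrite mulrA ler_wpM2r ?(ltW L0)// -exprMn.
have LE : L = Num.sqrt L * Num.sqrt L by rewrite -expr2 sqr_sqrtr// ltW.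
rewrite {1}LE mulrA; apply: lerXn2r; rewrite ?nnegrE ?mulr_ge0 ?sqrtr_ge0// ?(ltW M0)//.
by rewrite ler_wpM2r ?sqrtr_ge0// -sqrtrM// mulr_ge0// ltW.
Qed.

Lemma rate_ge : 0 <= e2 /\
  (Num.sqrt (10 * kbar) * L) ^+ d * L <= vol_const * (n%:R * e2).
Proof.
have [V [J [J0 VE nE2 _]]] := rate_decomposition S0 kbar0 M0 (erefl L) L0
  (leq_trans (isT : (0 < 2)%N) n2) rateE.
have sk0 : 0 < Num.sqrt kbar by rewrite sqrtr_gt0.
have [s [s0 _ _ sV]] := exists_separated_net S0 d0 sk0 VE.
have s1 : 1 <= (size s)%:R :> R by rewrite ler1n.
have [h1 h2] := volume_term_bounds s1 sV J0 nE2.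
have h := le_trans h2 h1; split=> //.
have : 0 <= vol_const * (n%:R * e2).
  by apply: le_trans h; rewrite mulr_ge0 ?(ltW L0)// exprn_ge0// mulr_ge0 ?sqrtr_ge0// ltW.
by rewrite !pmulr_rge0 ?vol_const_gt0.
Qed.

Hypothesis L_large : log_threshold <= L.

Let L_conds : [/\ 1 <= L, 1 <= 10 * kbar * L, 4 * d.+1%:R <= L ^+ 2,
  gauss_sup d klow * (2 + 3 * (3 ^ d)%:R) <= L & gauss_sup d klow <= L].
Proof.
have g0 := gauss_sup_gt0 d klow0.
have i0 : 0 < 10^-1 / kbar by rewrite divr_gt0.
have t0 : 0 <= 3 * (3 ^ d)%:R :> R by rewrite mulr_ge0.
have dd : 0 < 4 * d.+1%:R :> R by rewrite mulr_gt0.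
have gg : 0 <= gauss_sup d klow * (2 + 3 * (3 ^ d)%:R) by rewrite mulr_ge0 ?addr_ge0// ltW.
move: L_large; rewrite /log_threshold => hL.
have L1 : 1 <= L by lra.
have gL : gauss_sup d klow * (2 + 3 * (3 ^ d)%:R) <= L by lra.
split=> //.
- have h : 10^-1 / kbar <= L by lra.
  have : (10 * kbar) * (10^-1 / kbar) <= (10 * kbar) * L by rewrite ler_wpM2l// mulr_ge0// ltW.
  by rewrite (_ : (10 * kbar) * (10^-1 / kbar) = 1)//; field; rewrite gt_eqF.
- have h : 4 * d.+1%:R <= L by lra.
  by rewrite (le_trans h)// expr2 ler_peMr// ltW.
- apply: le_trans gL; rewrite ler_peMr ?(ltW g0)//; lra.
Qed.

Let M1 : 1 <= M.
Proof.
have [_ h _ _ _] := L_conds.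
rewrite -(@ler_pXn2r _ 2)// ?nnegrE ?(ltW M0)// expr1n.
exact: le_trans h M2.
Qed.

Let rhoM : 2 * Num.sqrt kbar <= M.
Proof.
have [h _ _ _ _] := L_conds.
rewrite -(@ler_pXn2r _ 2)// ?nnegrE ?(ltW M0) ?mulr_ge0 ?sqrtr_ge0//.
apply: le_trans M2; rewrite exprMn sqr_sqrtr ?(ltW kbar0)//.
have : kbar <= kbar * L by rewrite ler_peMr// ltW.
have := kbar0; lra.
Qed.

Let M6 : 6 * kbar * L <= M ^+ 2.
Proof.
apply: le_trans M2; have : 0 < kbar * L by rewrite mulr_gt0.
lra.
Qed.

Variables (Ghat : Omega -> probability (borel_rV R d) R).

Let loss (w : Omega) : R :=
  avg_hellinger2 (fun i => mixture_density (Ghat w) (Sigma i))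
                 (fun i => mixture_density Gstar (Sigma i)).

Hypothesis mloss : measurable_fun setT loss.
Hypothesis near_max : {ae P, forall w,
  avg_loglik Sigma (fun i => X i w) Gstar - avg_loglik Sigma (fun i => X i w) (Ghat w)
  <= c * e2}.

(** Off a null set, a large loss forces one of two events: the tail scores sum to at least [omega]
    ([E2]), or the products over the bad codes sum to at least [expR (- tau)] ([E1]). Each has
    probability at most $e^{-t^2L}$. *)
Lemma deviation_bound (t : R) : 1 <= t ->
  (P [set w | (dev_const * t ^+ 2 * e2 <= loss w)%R] <=
   (2 * expR (- (t ^+ 2 * L)))%:E)%E.
Proof.
move=> t1; have t2 : 1 <= t ^+ 2 by rewrite exprn_ege1.
have [L1 kL dL gL1 gL2] := L_conds.
have [V [J [J0 VE nE2 tailJ]]] := rate_decomposition S0 kbar0 M0 (erefl L) L0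
  (leq_trans (isT : (0 < 2)%N) n2) rateE.
have sk0 : 0 < Num.sqrt kbar by rewrite sqrtr_gt0.
have sL0 : 0 < Num.sqrt L by rewrite sqrtr_gt0.
have [s [s0 _ s_net sV]] := exists_separated_net S0 d0 sk0 VE.
pose A := n%:R * e2.
pose Y := (size s)%:R * M ^+ d.
pose T := Y * (Num.sqrt L ^+ d * L).
have s1 : 1 <= (size s)%:R :> R by rewrite ler1n.
have vp := vol_const_gt0.
have [TA TL] : T <= vol_const * A /\ (Num.sqrt (10 * kbar) * L) ^+ d * L <= T.
  exact: volume_term_bounds sV J0 nE2.
have Y1 : 1 <= Y by rewrite /Y; apply: mulr_ege1 => //; exact: exprn_ege1.
have sL1 : 1 <= Num.sqrt L ^+ d.
  apply: exprn_ege1; rewrite -(@ler_pXn2r _ 2)// ?nnegrE ?sqrtr_ge0//.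
  by rewrite expr1n sqr_sqrtr// ltW.
have YT : Y <= T.
  rewrite /T ler_peMr ?(le_trans _ Y1)//; exact: mulr_ege1.
have LT : L <= T.
  rewrite /T mulrA ler_peMl ?(ltW L0)//; exact: mulr_ege1.
have A0 : 0 <= A.
  by have [e20 _] := rate_ge; rewrite mulr_ge0.
have LA : L <= vol_const * A := le_trans LT TA.
(* A / L dominates L because d >= 1 *)
have LA2 : L <= log_const * (A / L).
  have s10 : 0 < Num.sqrt (10 * kbar) by rewrite sqrtr_gt0 mulr_gt0.
  have kL1 : 1 <= Num.sqrt (10 * kbar) * L.
    rewrite -(@ler_pXn2r _ 2)// ?nnegrE ?mulr_ge0 ?sqrtr_ge0 ?(ltW L0)//.
    rewrite expr1n exprMn sqr_sqrtr ?mulr_ge0 ?(ltW kbar0)// expr2 mulrA.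
    exact: mulr_ege1.
  have h : Num.sqrt (10 * kbar) * L * L <= vol_const * A.
    apply: le_trans (le_trans TL TA); rewrite ler_wpM2r ?(ltW L0)//.
    by rewrite -{1}(expr1 (_ * L)) ler_weXn2l.
  rewrite /log_const (_ : _ / _ * (_ / _) = vol_const * A / (Num.sqrt (10 * kbar) * L)).
    by rewrite ler_pdivlMr ?mulr_gt0// mulrC.
  by field; rewrite !gt_eqF.
have [Code [code [code_close ln_code]]] := exists_code klow0 kbar0 S0 L1 M6 M0 rhoM s_net gL1.
(* With this choice [n * sg] is $(4\pi)^dY=O(A)$; as $(4\pi)^dY\ge1$, its square dominates its first
   power in the integral of the weight. *)
pose sg := expR (- L) * ((4 * pi) ^+ d * Y).
have pid0 : 0 < (4 * pi) ^+ d :> R by rewrite exprn_gt0// mulr_gt0// pi_gt0.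
have pid1 : 1 <= (4 * pi) ^+ d :> R.
  by apply: exprn_ege1; have := pi_ge2 R; lra.
have sg0 : 0 < sg by rewrite mulr_gt0 ?expR_gt0// mulr_gt0// (lt_le_trans ltr01).
pose v := weight L M s.
have mv : measurable_fun setT v := measurable_weight L M s.
have v0 x : 0 <= v x := weight_ge0 L M s x.
have int_v : (\int[lebesgue_rV d]_x (v x)%:E <= (sg ^+ 2)%:E)%E.
  have w1 : 1 <= (4 * pi) ^+ d * Y by exact: mulr_ege1.
  have -> : sg ^+ 2 = expR (- (2 * L)) * ((4 * pi) ^+ d * Y) ^+ 2.
    rewrite /sg exprMn; congr (_ * _).
    by rewrite -expRM_natl; congr expR; ring.
  rewrite integral_weight// lee_fin ler_wpM2l ?expR_ge0//.
  have -> : (size s)%:R * (4 * pi * M) ^+ d = (4 * pi) ^+ d * Y.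
    by rewrite exprMn mulrCA.
  by rewrite expr2 ler_peMl// (le_trans _ w1).
have e30 : 0 <= expR (3 / 2) :> R := expR_ge0 _.
pose E0 := J / L + expR (- L) * tail_const d klow kbar.
have hE0 i : (\int[lebesgue_rV d]_x (mixture_density Gstar (Sigma i) x * excess S M L x)%:E
    <= E0%:E)%E.
  apply: tailJ => q hq.
  exact: (integral_excess_le klow0 kbar0 (Sigma_sym i) (Sigma_ge i) (Sigma_le i)
    (gauss1 i) S0 M0 M2 L0 dL).
pose omega := score_const * t ^+ 2 * A.
pose tau := (c * A + omega) / 2.
pose B := dev_const * t ^+ 2 * A.
pose hsum (G : probability (borel_rV R d) R) := \sum_i hellinger2 (mixture_density G (Sigma i))
  (mixture_density Gstar (Sigma i)).
(* A code is bad if some measure carrying it is far from [Gstar]; [rep] picks such a measure, so the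
   estimator of a bad sample has the code of a fixed far measure. *)
pose bad j := `[< exists2 G, code G = j & B <= hsum G >].
have [rep repP] : exists rep : Code -> probability (borel_rV R d) R,
    forall j, bad j -> code (rep j) = j /\ B <= hsum (rep j).
  have /choice[f fP] : forall j, exists G, bad j -> code G = j /\ B <= hsum G.
    move=> j; case: (boolP (bad j)) => [/asboolP[G h1 h2]|_]; first by exists G.
    by exists Gstar.
  by exists f.
have P1 := prob_sqrt_ratio_le klow0 kbar0 Sigma_sym Sigma_ge Sigma_le gauss1 X_indep
  X_density mv v0 sg0 int_v tau (fun j bj => (repP j bj).2).
have P2 := prob_tail_score_le klow0 kbar0 Sigma_sym Sigma_ge Sigma_le gauss1 X_indep
  X_density S0 M0 L0 d0 omega hE0.
have nsg : n%:R * sg = (4 * pi) ^+ d * Y.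
  by rewrite nE /sg mulrA -expRD subrr expR0 mul1r.
have tA : A <= t ^+ 2 * A by rewrite ler_peMl.
have cc := code_const_ge0 d klow0 kbar0.
have sc := score_const_ge0.
have lc := ltW log_const_gt0.
have tc := tail_const_ge0 d kbar klow0.
have bound1 : #|Code|%:R * expR (tau + n%:R * sg - B) <= expR (- (t ^+ 2 * L)).
  have Code0 : 0 < #|Code|%:R :> R.
    by rewrite ltr0n; apply/card_gt0P; exists (code Gstar).
  rewrite -[X in X * _]lnK// -expRD ler_expR nsg.
  have b1 : ln #|Code|%:R <= code_const d klow kbar * vol_const * (t ^+ 2 * A).
    rewrite (le_trans ln_code)// -/Y -/T -mulrA ler_wpM2l// (le_trans TA)//.
    by rewrite ler_wpM2l// ltW.
  have b2 : (4 * pi) ^+ d * Y <= (4 * pi) ^+ d * vol_const * (t ^+ 2 * A).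
    rewrite -mulrA ler_wpM2l ?(ltW pid0)// (le_trans YT)// (le_trans TA)//.
    by rewrite ler_wpM2l// ltW.
  have b3 : t ^+ 2 * L <= vol_const * (t ^+ 2 * A).
    by rewrite mulrCA ler_wpM2l// (le_trans _ t2).
  have b4 : c * A <= c * (t ^+ 2 * A) by rewrite ler_wpM2l// ltW.
  rewrite /tau /B /omega /dev_const.
  move: b1 b2 b3 b4; lra.
have bound2 : expR (- (d.+1%:R / (4 * d%:R * L)) * omega + n%:R * (expR (3 / 2) * E0)) <=
    expR (- (t ^+ 2 * L)).
  rewrite ler_expR.
  have dp : 0 < d%:R :> R by rewrite ltr0n.
  have AL0 : 0 <= A / L by rewrite divr_ge0// ltW.
  (* Since $ne^{-L}=1$, the Gaussian part of [E0] contributes only a constant. *)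
  have nE0 : n%:R * (expR (3 / 2) * E0) <=
      expR (3 / 2) * (A / L + tail_const d klow kbar).
    rewrite mulrCA ler_wpM2l// /E0 mulrDr lerD//.
      rewrite mulrA ler_pM2r ?invr_gt0//.
      rewrite /A nE2 lerDr -(mulrA V) mulr_ge0//.
        by rewrite -lee_fin -VE measure_ge0.
      by rewrite !mulr_ge0 ?exprn_ge0// ltW.
    by rewrite nE mulrA -expRD subrr expR0 mul1r.
  have lam : (4 * L)^-1 <= d.+1%:R / (4 * d%:R * L).
    have -> : d.+1%:R / (4 * d%:R * L) = (4 * L)^-1 + (4 * d%:R * L)^-1.
      by rewrite -[d.+1%:R]natr1; field; rewrite !gt_eqF.
    by rewrite lerDl invr_ge0 mulr_ge0 ?(ltW L0)// mulr_ge0// ltW.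
  have omega0 : 0 <= omega by rewrite /omega mulr_ge0// mulr_ge0// sqr_ge0.
  have b1 := ler_wpM2r omega0 lam.
  have eo : (4 * L)^-1 * omega = score_const / 4 * (t ^+ 2 * (A / L)).
    by rewrite /omega; field; rewrite gt_eqF.
  rewrite eo in b1.
  have tAL : A / L <= t ^+ 2 * (A / L) by rewrite ler_peMl.
  have b2 : t ^+ 2 * L <= log_const * (t ^+ 2 * (A / L)).
    by rewrite mulrCA ler_wpM2l// (le_trans _ t2).
  have b3 : tail_const d klow kbar <= tail_const d klow kbar * log_const * (t ^+ 2 * (A / L)).
    rewrite -mulrA ler_peMr// (le_trans L1)// (le_trans LA2)//.
    by rewrite ler_wpM2l.
  have b4 := ler_wpM2l e30 b3; have b5 := ler_wpM2l e30 tAL.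
  move: b1 b2 b4 b5 nE0; rewrite /score_const.
  set AL := t ^+ 2 * (A / L); move: (expR (3 / 2)) => q.
  lra.
have [N [mN PN0 subN]] := near_max.
pose E1 := [set w | expR (- tau) <= \sum_(j | bad j) \prod_i sqrt_ratio Sigma Gstar v (rep j) i (X i w)].
pose E2 := [set w | omega <= \sum_i tail_score S M L (X i w)].
have mge (f : Omega -> R) (a : R) : measurable_fun setT f -> measurable [set w | a <= f w].
  move=> mf; have := mf measurableT _ (measurable_itv `[a, +oo[); rewrite setTI.
  by congr measurable; apply/seteqP; split => w /=; rewrite in_itv/= andbT.
have mE1 : measurable E1.
  apply: mge; under eq_fun do rewrite -big_filter.
  apply: measurable_sum => j.
  exact: (measurable_prod_sqrt_ratio klow0 kbar0 Sigma_sym Sigma_ge Sigma_le).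
have mE2 : measurable E2.
  apply: mge; apply: measurable_sum => i.
  by apply: (measurableT_comp (measurable_tail_score S0 M L)).
have incl : [set w | dev_const * t ^+ 2 * e2 <= loss w] `<=` N `|` (E1 `|` E2).
  move=> w /= hw; case: (pselect (N w)) => [Nw|Nw]; [by left|right].
  case: (pselect (E2 w)) => [Ew|Ew]; [by right|left].
  have {}Ew : \sum_i tail_score S M L (X i w) < omega by rewrite ltNge; apply/negP.
  have lik : avg_loglik Sigma (fun i => X i w) Gstar -
      avg_loglik Sigma (fun i => X i w) (Ghat w) <= c * e2.
    by apply: contrapT => h; apply: Nw; exact: subN.
  pose fs i := mixture_density Gstar (Sigma i) (X i w : 'rV[R]_d).
  pose fh i := mixture_density (Ghat w) (Sigma i) (X i w : 'rV[R]_d).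
  have likA : \sum_i (ln (fs i) - ln (fh i)) <= c * A.
    rewrite sumrB /A mulrCA -ler_pdivrMl//.
    by move: lik; rewrite /avg_loglik -mulrBr.
  pose j := code (Ghat w).
  have bj : bad j.
    apply/asboolP; exists (Ghat w) => //.
    move: hw; rewrite /loss /avg_hellinger2 -/(hsum (Ghat w)) ler_pdivlMl//.
    by rewrite /B /A mulrCA.
  have [rj _] := repP j bj.
  have fs0 i : 0 < fs i.
    exact: (mixture_density_gt0 klow0 kbar0 (Sigma_sym i) (Sigma_ge i) (Sigma_le i)).
  have fh0 i : 0 < fh i.
    exact: (mixture_density_gt0 klow0 kbar0 (Sigma_sym i) (Sigma_ge i) (Sigma_le i)).
  have sqrt_expR (u : R) : Num.sqrt (expR u) = expR (u / 2).
    have -> : expR u = expR (u / 2) ^+ 2 by rewrite -expRM_natl; congr expR; field.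
    by rewrite sqrtr_sqr ger0_norm ?expR_ge0.
  (* The representative shares the code of the estimator, so its mixture plus [v] is at least
     $e^{-W}$ times the estimated density. *)
  have ratio_ge i : expR ((ln (fh i) - tail_score S M L (X i w) - ln (fs i)) / 2) <=
      sqrt_ratio Sigma Gstar v (rep j) i (X i w).
    rewrite mulrBl expRD expRN /sqrt_ratio -/(fs i) -!sqrt_expR (lnK (fs0 i)).
    rewrite ler_pM2r ?invr_gt0 ?sqrtr_gt0//; apply: ler_wsqrtr.
    rewrite expRD expRN (lnK (fh0 i)) ler_pdivrMr ?expR_gt0// [leRHS]mulrC.
    apply: (mixture_le_tail_score klow0 kbar0 S0 M0 rhoM s_net gL2 (Sigma_sym i)
      (Sigma_ge i) (Sigma_le i)).
    by apply: code_close => //; rewrite rj.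
  have prod_ge : expR (- tau) <= \prod_i sqrt_ratio Sigma Gstar v (rep j) i (X i w).
    apply: (@le_trans _ _
      (\prod_i expR ((ln (fh i) - tail_score S M L (X i w) - ln (fs i)) / 2))).
      rewrite -expR_sum ler_expR -mulr_suml.
      have -> : \sum_i (ln (fh i) - tail_score S M L (X i w) - ln (fs i)) =
          - (\sum_i (ln (fs i) - ln (fh i))) - \sum_i tail_score S M L (X i w).
        rewrite -sumrN -sumrB; apply: eq_bigr => i _; ring.
      by rewrite /tau; move: likA Ew; lra.
    by apply: ler_prod => i _; rewrite expR_ge0/=.
  rewrite /E1/= (bigD1 j)//=; apply: (le_trans prod_ge); rewrite lerDl.
  by apply: sumr_ge0 => k _; apply: prodr_ge0 => i _; rewrite divr_ge0.
have mloss_set := mge _ (dev_const * t ^+ 2 * e2) mloss.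
apply: (le_trans (le_measure _ _ _ incl)); rewrite ?inE//.
  by apply: measurableU => //; exact: measurableU.
have mE12 : measurable (E1 `|` E2) by exact: measurableU.
apply: (le_trans (measureU2 _ mN mE12)).
rewrite [X in (X + _)%E]PN0 add0e; apply: (le_trans (measureU2 _ mE1 mE2)).
rewrite mulr_natl mulr2n EFinD leeD//.
  by apply: (le_trans P1); rewrite lee_fin.
by apply: (le_trans P2); rewrite lee_fin.
Qed.

End large_sample.

(** * From the deviation inequality to all sample sizes and to the mean *)

Lemma avg_hellinger2_itv (R : realType) d n (f g : 'I_n -> borel_rV R d -> R) :
    (0 < n)%N -> (forall i, 0 <= hellinger2 (f i) (g i) <= 1) ->
  0 <= avg_hellinger2 f g <= 1.
Proof.
move=> n0 h; have np : 0 < n%:R :> R by rewrite ltr0n.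
rewrite /avg_hellinger2; apply/andP; split.
  rewrite mulr_ge0// ?invr_ge0 ?ler0n//.
  by apply: sumr_ge0 => i _; have /andP[] := h i.
rewrite ler_pdivrMl// mulr1 -[n in leRHS]card_ord -sumr_const.
by apply: ler_sum => i _; have /andP[] := h i.
Qed.

(** As [f] is at most 1, it is below [a] plus the indicator of its exceeding [a]. *)
Lemma expectation_le_of_tail (R : realType) dO (Omega : measurableType dO)
    (P : probability Omega R) (f : Omega -> R) (a p : R) :
    measurable_fun setT f -> (forall w, 0 <= f w <= 1) -> 0 <= a ->
    (P [set w | (a <= f w)%R] <= p%:E)%E ->
  ('E_P[f] <= (a + p)%:E)%E.
Proof.
move=> mf f01 a0 hp; rewrite expectation.unlock.
have mA : measurable [set w | a <= f w].
  have := mf measurableT _ (measurable_itv `[a, +oo[); rewrite setTI.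
  by congr measurable; apply/seteqP; split => w /=; rewrite in_itv/= andbT.
have mI : measurable_fun setT (\1_[set w | a <= f w] : Omega -> R).
  exact: measurable_indic.
apply: (@le_trans _ _ (\int[P]_w (a + \1_[set w | (a <= f w)%R] w)%:E)%E).
  apply: ge0_le_integral_EFin => //.
  - exact: measurable_funD.
  - by move=> w; have /andP[] := f01 w.
  move=> w; have /andP[_ f1] := f01 w; rewrite indicE.
  case: (boolP (w \in _)) => [_|]; first by rewrite (le_trans f1)// lerDr.
  rewrite notin_setE/= => /negP; rewrite -ltNge => fa.
  by rewrite addr0 ltW.
rewrite (ge0_integral_EFinD P (measurable_cst a) mI (fun=> a0))//.
rewrite [X in (X + _)%E](integral_prob_cst P a%:E) integral_indic// setIT EFinD.
by rewrite leeD2l.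
Qed.

Lemma rate_ge0 (R : realType) d (kbar : R) n (M : R) (S : set 'rV[R]_d) G :
  (0 < n)%N -> 0 <= M -> (0 <= rate kbar n M S G)%E.
Proof.
move=> n0 M0; rewrite /rate adde_ge0//.
  apply: mule_ge0; first exact: measure_ge0.
  by rewrite lee_fin !mulr_ge0 ?invr_ge0 ?exprn_ge0 ?powR_ge0.
apply: le_ereal_inf_tmp => _ [q _ <-].
by rewrite mule_ge0 ?poweR_ge0// lee_fin ln_ge0// ler1n.
Qed.

(** A lower bound for $\varepsilon_n^2$ below the threshold: [rate_ge] with $\ln n\ge\ln2$ and $n\le
    e^{\mathrm{threshold}}$. *)
Definition floor_const (R : realType) (d : nat) (klow kbar : R) : R :=
  (Num.sqrt (10 * kbar) * ln 2) ^+ d * ln 2 /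
  (vol_const d kbar * expR (log_threshold d klow kbar)).

Unset Implicit Arguments.

Theorem theorem7 (R : realType) (d : nat) (klow kbar c : R)
    (hd : (1 <= d)%N) (hklow : 0 < klow) (hk : klow <= kbar) (hc : 0 < c) :
  exists2 C : R, 0 < C &
  forall (n : nat) (hn : (2 <= n)%N)
    (Sigma : 'I_n -> 'M[R]_d)
    (Sigma_sym : forall i, (Sigma i)^T = Sigma i)
    (Sigma_ge : forall i, loewner_le klow%:M (Sigma i))
    (Sigma_le : forall i, loewner_le (Sigma i) kbar%:M)
    (Gstar : probability (borel_rV R d) R)
    (dO : measure_display) (Omega : measurableType dO)
    (P : probability Omega R) (X : 'I_n -> {RV P >-> borel_rV R d})
    (X_indep : mutually_independent X)
    (X_density : forall i, has_density (X i) (mixture_density Gstar (Sigma i)))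
    (M : R) (hM : Num.sqrt (10 * kbar * ln n%:R) <= M)
    (S : set 'rV[R]_d) (S_neq0 : S !=set0) (S_compact : compact S)
    (Ghat : ('I_n -> 'rV[R]_d) -> probability (borel_rV R d) R),
  let data := fun (w : Omega) (i : 'I_n) => X i w : 'rV[R]_d in
  let eps2 := rate kbar n M S Gstar in
  let loss := fun w : Omega =>
    avg_hellinger2 (fun i => mixture_density (Ghat (data w)) (Sigma i))
                   (fun i => mixture_density Gstar (Sigma i)) in
  measurable_fun setT loss ->
  {ae P, forall w, ((avg_loglik Sigma (data w) Gstar
                     - avg_loglik Sigma (data w) (Ghat (data w)))%:E
                    <= c%:E * eps2)%E} ->
  (Num.max (expR 1 * klow `^ (- (d%:R / 2))) ((2 * pi) `^ (d%:R / 2)) < n%:R ->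
   forall t : R, 1 <= t ->
   (P [set w | C%:E * (t ^+ 2)%:E * eps2 <= (loss w)%:E]
    <= (2 * n%:R `^ (- t ^+ 2))%:E)%E) /\
  ('E_P[loss] <= C%:E * eps2)%E.
Proof.
have kbar0 : 0 < kbar := lt_le_trans hklow hk.
have ln20 : 0 < ln 2 :> R by rewrite ln_gt0// ltr1n.
have vc := vol_const_gt0 hd kbar0.
have dc := dev_const_ge0 hd hklow kbar0 hc.
have fc : 0 < floor_const d klow kbar.
  have s10 : 0 < Num.sqrt (10 * kbar) by rewrite sqrtr_gt0 mulr_gt0.
  apply: divr_gt0; last by rewrite mulr_gt0 ?expR_gt0.
  by rewrite mulr_gt0// exprn_gt0// mulr_gt0.
(* [C0] serves samples above the threshold, with [2 * vol_const] for the $2/n$ of the mean; the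
   extra term of [C] makes $C\varepsilon_n^2>1$ below it. *)
pose C0 := dev_const d klow kbar c + 2 * vol_const d kbar.
pose C := C0 + 2 / floor_const d klow kbar.
have C00 : 0 < C0 by rewrite ltr_wpDl// mulr_gt0.
have i0 : 0 < 2 / floor_const d klow kbar.
  by apply: divr_gt0; [rewrite ltr0n|exact: fc].
have C_gt0 : 0 < C by rewrite addr_gt0.
exists C => // n hn Sigma Sigma_sym Sigma_ge Sigma_le Gstar dO Omega P X X_indep
  X_density M hM S S_neq0 S_compact Ghat data eps2 loss mloss near_max.
have n0 : (0 < n)%N := leq_trans (isT : (0 < 2)%N) hn.
have np : 0 < n%:R :> R by rewrite ltr0n.
have L0 : 0 < ln n%:R :> R by rewrite ln_gt0// ltr1n.
have M0 : 0 < M by apply: lt_le_trans hM; rewrite sqrtr_gt0 !mulr_gt0.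
have gauss1 i : (\int[lebesgue_rV d]_x (gauss_density (Sigma i) x)%:E = 1)%E.
  (* The law of [X i] has total mass 1 and a mixture as density, which normalises the Gaussian. *)
  apply: (integral_gauss_of_mixture hklow kbar0 (Sigma_sym i) (Sigma_ge i) (Sigma_le i) (G := Gstar)).
  rewrite -(X_density i _ measurableT); exact: probability_setT.
have loss01 w : 0 <= loss w <= 1.
  apply: avg_hellinger2_itv => // i.
  have [||||||h1 h2 _] := @hellinger_affinity R d (mixture_density (Ghat (data w)) (Sigma i))
    (mixture_density Gstar (Sigma i)).
  - exact: (measurable_mixture_density hklow kbar0 (Sigma_sym i) (Sigma_ge i) (Sigma_le i)).
  - exact: (measurable_mixture_density hklow kbar0 (Sigma_sym i) (Sigma_ge i) (Sigma_le i)).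
  - by move=> x; exact/ltW/(mixture_density_gt0 hklow kbar0 (Sigma_sym i) (Sigma_ge i) (Sigma_le i)).
  - by move=> x; exact/ltW/(mixture_density_gt0 hklow kbar0 (Sigma_sym i) (Sigma_ge i) (Sigma_le i)).
  - exact: (integral_mixture1 hklow kbar0 (Sigma_sym i) (Sigma_ge i) (Sigma_le i)).
  - exact: (integral_mixture1 hklow kbar0 (Sigma_sym i) (Sigma_ge i) (Sigma_le i)).
  by rewrite h1 h2.
have : (0 <= eps2)%E by apply: rate_ge0 => //; exact: ltW.
(* For an infinite rate the event is empty and the bound on the mean is trivial. *)
case E2 : eps2 => [e2| |]// _; last first.
  split=> [_ t t1|]; last by rewrite gt0_muley ?lte_fin// leey.
  have t2 : 0 < t ^+ 2 by rewrite exprn_gt0// (lt_le_trans ltr01).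
  have Ct : 0 < C * t ^+ 2 by exact: mulr_gt0.
  rewrite -EFinM gt0_muley ?lte_fin//.
  rewrite (_ : [set w | _] = set0); last by apply/seteqP; split => w //=; rewrite leye_eq.
  by rewrite measure0 lee_fin mulr_ge0// powR_ge0.
have [e20 e2_ge] := rate_ge hd kbar0 S_neq0 hn hM E2.
have nearR : {ae P, forall w, avg_loglik Sigma (fun i => X i w) Gstar -
    avg_loglik Sigma (fun i => X i w) (Ghat (data w)) <= c * e2}.
  apply: filterS near_max => w; by rewrite E2 -EFinM lee_fin.
have expE (t : R) : n%:R `^ (- t ^+ 2) = expR (- (t ^+ 2 * ln n%:R)).
  by rewrite /powR gt_eqF// mulNr.
have [Lge|Llt] := leP (log_threshold d klow kbar) (ln n%:R).
  have dev t (t1 : 1 <= t) := deviation_bound hd hklow kbar0 hc Sigma_sym Sigma_ge Sigma_le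
    gauss1 X_indep X_density S_neq0 hn hM E2 Lge mloss nearR t1.
  split=> [_ t t1|].
    rewrite expE; apply: le_trans (dev t t1).
    have mset (a : R) : measurable [set w | a <= loss w].
      have := mloss measurableT _ (measurable_itv `[a, +oo[); rewrite setTI.
      by congr measurable; apply/seteqP; split => w /=; rewrite in_itv/= andbT.
    have -> : [set w | (C%:E * (t ^+ 2)%:E * e2%:E <= (loss w)%:E)%E] =
        [set w | C * t ^+ 2 * e2 <= loss w].
      by apply/seteqP; split => w /=; rewrite -!EFinM lee_fin.
    apply: le_measure; rewrite ?inE; [exact: mset|exact: mset|].
    move=> w /=; apply: le_trans; rewrite ler_wpM2r// ler_wpM2r ?sqr_ge0//.
    by rewrite /C /C0; move: vc i0; lra.
  have dev1 := dev 1 (lexx _); rewrite expr1n mulr1 mul1r in dev1.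
  have a0 : 0 <= dev_const d klow kbar c * e2 by rewrite mulr_ge0.
  apply: (le_trans (expectation_le_of_tail mloss loss01 a0 dev1)).
  rewrite -EFinM lee_fin.
  have h1 : 0 < 10^-1 / kbar by rewrite divr_gt0.
  have h2 : 0 <= 4 * d.+1%:R :> R by [].
  have h3 : 0 <= gauss_sup d klow * (2 + 3 * (3 ^ d)%:R).
    by rewrite mulr_ge0 ?(ltW (gauss_sup_gt0 d hklow)).
  have [L1 kL] : 1 <= ln n%:R :> R /\ 10^-1 / kbar <= ln n%:R.
    by move: Lge; rewrite /log_threshold => Lge; split; lra.
  have kL1 : 1 <= Num.sqrt (10 * kbar) * ln n%:R.
    rewrite -(@ler_pXn2r _ 2)// ?nnegrE ?mulr_ge0 ?sqrtr_ge0 ?(ltW L0)//.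
    rewrite expr1n exprMn sqr_sqrtr ?mulr_ge0 ?(ltW kbar0)// expr2 mulrA.
    have e1 : 10 * kbar * (10^-1 / kbar) = 1 by field; rewrite gt_eqF.
    apply: mulr_ege1 => //; rewrite -[leLHS]e1.
    by rewrite ler_wpM2l// mulr_ge0// ltW.
  have n_e2 : n%:R^-1 <= vol_const d kbar * e2.
    rewrite -[leLHS]mulr1 ler_pdivrMl//.
    apply: (@le_trans _ _ ((Num.sqrt (10 * kbar) * ln n%:R) ^+ d * ln n%:R)).
      by apply: mulr_ege1 => //; exact: exprn_ege1.
    by rewrite mulrCA.
  rewrite expRN lnK//.
  have : 0 <= 2 / floor_const d klow kbar * e2 by rewrite mulr_ge0// ltW.
  by rewrite /C /C0; move: n_e2; lra.
(* Below the threshold the bound exceeds 1, hence every value of the loss. *)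
have e2_big : 1 < C * e2.
  have h1 : floor_const d klow kbar <= e2.
    have l2 : ln 2 <= ln n%:R :> R by rewrite ler_ln ?posrE// ler_nat.
    have s10 : 0 <= Num.sqrt (10 * kbar) by exact: sqrtr_ge0.
    rewrite /floor_const ler_pdivrMr ?mulr_gt0 ?expR_gt0//.
    apply: (@le_trans _ _ ((Num.sqrt (10 * kbar) * ln n%:R) ^+ d * ln n%:R)).
      rewrite ler_pM ?exprn_ge0 ?mulr_ge0 ?(ltW ln20)//.
      by apply: lerXn2r; rewrite ?nnegrE ?mulr_ge0 ?(ltW ln20) ?(ltW L0)// ler_wpM2l.
    apply: (le_trans e2_ge).
    rewrite (_ : e2 * _ = vol_const d kbar * (expR (log_threshold d klow kbar) * e2)).
      rewrite ler_wpM2l ?(ltW vc)// ler_wpM2r// -[leLHS]lnK//.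
      by rewrite ler_expR ltW.
    by ring.
  have : 2 <= 2 / floor_const d klow kbar * e2.
    by rewrite mulrAC ler_pdivlMr// ler_wpM2l.
  have : 0 <= C0 * e2 by rewrite mulr_ge0// ltW.
  by rewrite /C; lra.
split=> [_ t t1|].
  rewrite (_ : [set w | _] = set0).
    by rewrite measure0 lee_fin mulr_ge0// powR_ge0.
  apply/seteqP; split => // w /=; rewrite -!EFinM lee_fin => h.
  have /andP[_ l1] := loss01 w.
  have t2 : 1 <= t ^+ 2 by rewrite exprn_ege1.
  have := le_trans h l1; rewrite leNgt => /negP; apply.
  rewrite mulrAC (lt_le_trans e2_big)// ler_peMr// mulr_ge0//; exact: ltW.
rewrite -EFinM expectation.unlock.
apply: (@le_trans _ _ (\int[P]_w (cst 1 w)%:E)%E).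
  apply: ge0_le_integral_EFin => //.
    by move=> w; have /andP[] := loss01 w.
  by move=> w; have /andP[] := loss01 w.
by rewrite (integral_prob_cst P 1%:E) lee_fin ltW.
Qed.
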